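(* In the setting described in the context, suppose that there exists a stochastic process $W$ on $X$, with symmetric probability kernel, satisfying the following homogenization property: for every $t\ge 0$, $$\lim_{n\to\infty}\frac1{a_n}\sum_{x\in V_n}\bigl|P^n_t\varphi(x)-P_t\varphi(x)\bigr|=0\qquad\text{for all }\varphi\in C_c(X),$$ where $P_t\varphi(x):=\mathbb{E}[\varphi(W(t|x))]$ and $W(t|x)$ denotes the process $W$ started at $x\in X$ (evaluated at time $t$). Then the following holds. Let $\rho_0:X\to[0,\infty)$ be a bounded Borel function and let $(\mu_n)_{n\ge1}$ be a sequence with $\mu_n$ a probability measure on $\{0,1\}^{V_n}$ such that, for any $\delta>0$ and any $\varphi\in\{P_t\psi : t\ge 0,\ \psi\in C_c(X)\}$, $$\lim_{n\to\infty}\mu_n\Bigl(\Bigl|\frac1{a_n}\sum_{x\in V_n}\varphi(x)\eta_x-\int_X\varphi(u)\rho_0(u)\,m(du)\Bigr|>\delta\Bigr)=0.$$ Then for any $\delta>0$, any $t>0$ and any $\varphi\in C_c(X)$, $$\lim_{n\to\infty}\mathbb{P}_{\mu_n}\Bigl(\Bigl|\frac1{a_n}\sum_{x\in V_n}\varphi(x)\eta_x(t)-\int_X\varphi(u)\,(P_t\rho_0)(u)\,m(du)\Bigr|>\delta\Bigr)=0.$$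
   Context: **Graphs.** $X$ is a metric space endowed with a Radon measure $m$; $C_c(X)$ is the space of continuous compactly supported real functions on $X$. For each $n\ge1$, $G_n=(V_n,E_n)$ is a graph with unoriented edges, whose vertex set $V_n$ is a locally finite subset of $X$; write $x\sim y$ if $\{x,y\}\in E_n$. There is a fixed sequence of positive constants $a_n$ with $a_n\to\infty$ such that $m_n:=\frac1{a_n}\sum_{x\in V_n}\delta_x$ converges vaguely to $m$. **Exclusion process.** For each $n$ let $b_n>0$ be a rescaling constant and $\{c_n(b):b\in E_n\}$ a nonnegative conductance field; write $c_n(x,y)=c_n(\{x,y\})$. The exclusion process on $G_n$ is the Markov process on $\{0,1\}^{V_n}$ (product topology) whose generator acts on functions $f$ depending on finitely many coordinates as $$\mathcal{L}_nf(\eta)=b_n\sum_{\{x,y\}\in E_n}c_n(x,y)\bigl(f(\eta^{x,y})-f(\eta)\bigr),$$ where $\eta^{x,y}$ is obtained from $\eta$ by exchanging the values $\eta_x$ and $\eta_y$. The dynamics is assumed to be well defined and is constructed graphically as follows. On a probability space $(\Omega,\mathcal{F},\mathbb{P})$ let $N^n_b(\cdot)$, $b\in E_n$, be independent Poisson processes with $\mathbb{E}[N^n_b(t)]=b_nc_n(b)t$. Standing assumption: for each $n$ there exists $\varepsilon>0$ such that, for almost all $\omega$, the graph obtained from $G_n$ by keeping only the bonds $b$ with $N^n_b(\varepsilon)[\omega]\ge1$ has only connected components of finite cardinality. Consequently a.s., for every $k\in\{0,1,2,\dots\}$ and $k\varepsilon<t\le(k+1)\varepsilon$, the graph $\mathcal{G}^n_t(\omega)$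 with vertex set $V_n$ and edges $b\in E_n$ such that $N^n_b(t)>N^n_b(k\varepsilon)$ has only finite connected components. Given $\eta(k\varepsilon)$, the configuration $\eta(t)$ is defined on each connected component $\mathcal{C}$ of $\mathcal{G}^n_t(\omega)$ by starting from $\eta(k\varepsilon)$ and, in increasing order of the finitely many jump times $s\in(k\varepsilon,t]$ of the processes $N^n_b$ with $b$ a bond in $\mathcal{C}$, exchanging the values at $x$ and $y$ whenever $N^n_{\{x,y\}}$ jumps at $s$. Iterating over $k$ defines $\eta(t)$ for all $t\ge0$ from $\eta(0)$. $\mathbb{P}_{\mu_n}$ denotes the law of the exclusion process on $G_n$ when $\eta(0)$ has law $\mu_n$ (independent of the Poisson processes). **Random walk.** $X_n(t|x)$ denotes the continuous-time random walk on $V_n$ started at $x\in V_n$ with generator $\mathbb{L}_nh(x)=b_n\sum_{y\in V_n:\,y\sim x}c_n(x,y)(h(y)-h(x))$ (this is the exclusion process with a single particle). For a function $\varphi$ on $V_n$ (or the restriction to $V_n$ of a function on $X$), $P^n_t\varphi(x):=\mathbb{E}[\varphi(X_n(t|x))]$, $x\in V_n$. **Symmetric kernel.** That $W$ has symmetric probability kernel means symmetry with respect to $m$: the kernels $P_t(x,du)$ of $W(t|x)$ satisfy $m(dx)P_t(x,du)=m(du)P_t(u,dx)$ for every $t\ge 0$. *)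

(* Defs.v *)
From HB Require Import structures.
From mathcomp Require Import all_boot all_order all_algebra finmap.
From mathcomp Require Import all_classical all_reals all_analysis.
From mathcomp Require Import measurable_realfun.

Set Implicit Arguments.
Unset Strict Implicit.
Unset Printing Implicit Defensive.

Import Order.TTheory GRing.Theory Num.Theory.
Import numFieldNormedType.Exports.

Local Open Scope classical_set_scope.
Local Open Scope ring_scope.

(* Measurable types of the library are pointed, hence so is X. *)
#[short(type="pmetricType")]
HB.structure Definition PointedMetric (R : numDomainType) :=
  {T of Pointed T & Metric R T}.

(* Unconditional sum of a real family. It is the usual sum when the family is
   absolutely summable; otherwise its value is meaningless. *)
Definition rsum (R : realType) (T : choiceType) (D : set T) (f : T -> R) : R :=
  fine (\esum_(x in D) (Num.max (f x) 0)%:E)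
  - fine (\esum_(x in D) (Num.max (- f x) 0)%:E).

Section Space.
Context (R : realType) (X : pmetricType R).

Definition borel := g_sigma_algebraType (@open X).

Definition radon (m : {measure set borel -> \bar R}) : Prop :=
  (forall x : X, exists U : set X, [/\ open U, U x & (m U < +oo)%E]) /\
  (forall U : set X, open U ->
     m U = ereal_sup [set m K | K in [set K : set X | compact K /\ K `<=` U]]).

Definition Cc (phi : X -> R) : Prop :=
  continuous phi /\ compact (closure [set x | phi x != 0]).

Definition locally_finite (V : set X) : Prop :=
  forall x : X, exists2 U : set X, nbhs x U & finite_set (U `&` V).

End Space.

Section Independence.
Context (R : realType) (d : measure_display) (Om : measurableType d)
  (P : probability Om R).

Definition independent_family (I : choiceType) (D : set I)
    (F : I -> set (set Om)) : Prop :=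
  forall J : {fset I}, [set` J] `<=` D ->
  forall A : I -> set Om, (forall i, i \in J -> F i (A i)) ->
    P (\bigcap_(i in [set` J]) A i) = (\prod_(i <- J) P (A i))%E.

Definition independent_systems (F G : set (set Om)) : Prop :=
  forall A B, F A -> G B -> P (A `&` B) = (P A * P B)%E.

End Independence.

Section Poisson.
Context (R : realType) (d : measure_display) (Om : measurableType d)
  (P : probability Om R).

Definition sigma_of_process (T : set R) (N : R -> Om -> nat) : set (set Om) :=
  <<s [set A | exists t k, T t /\ A = N t @^-1` [set k]] >>.

(* The second argument of poisson_prob is a dummy; poisson_prob 0 is the Dirac
   mass at 0, so that rate 0 is covered. *)
Record poisson_process (lambda : R) (N : R -> Om -> nat) : Prop := {
  poisson_measurable : forall t, 0 <= t -> measurable_fun [set: Om] (N t) ;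
  poisson_start : forall w, N 0 w = 0%N ;
  poisson_nondecreasing : forall w s t, 0 <= s <= t -> (N s w <= N t w)%N ;
  poisson_right_continuous : forall w t, 0 <= t ->
    \forall s \near t^'+, N s w = N t w ;
  poisson_increments : forall s t k A, 0 <= s <= t ->
    sigma_of_process `[0, s] N A ->
    P (A `&` [set w | (N t w - N s w)%N = k]) =
    (P A * poisson_prob (lambda * (t - s)) 0 [set k])%E }.

End Poisson.

(* An unoriented edge is the two-element set of its endpoints. *)
Section Graph.
Context (R : realType) (V : choiceType).
Implicit Types (E O : set (set V)) (c : set V -> R).

Definition unoriented_graph E : Prop :=
  forall b, E b -> exists x y : V, x != y /\ b = [set x; y].

Definition component O (x : V) : set V :=
  [set y | exists p : seq V,
     path (fun u v => `[< O [set u; v] >]) x p /\ last x p = y].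

Definition finite_components O : Prop :=
  forall x, finite_set (component O x).

Definition walk_generator (bn : R) E c (h : V -> R) (x : V) : R :=
  bn * rsum [set y | E [set x; y]] (fun y => c [set x; y] * (h y - h x)).

Section RandomWalk.
Context (d : measure_display) (Om : measurableType d) (P : probability Om R).

Definition semigroup (Y : V -> R -> Om -> V) (t : R) (h : V -> R) (x : V) : R :=
  fine 'E_P[fun w => h (Y x t w)].

(* Y x is the path started at x. Paths are right-continuous with left limits
   for the discrete topology of V, so there is no explosion; L is the generator
   on finitely supported functions. *)
Record random_walk (L : (V -> R) -> V -> R) (Y : V -> R -> Om -> V) : Prop := {
  walk_measurable : forall x t y, 0 <= t -> measurable [set w | Y x t w = y] ;
  walk_start : forall x, \forall w \ae P, Y x 0 w = x ;
  walk_right_continuous : forall x, \forall w \ae P, forall t, 0 <= t ->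
    \forall s \near t^'+, Y x s w = Y x t w ;
  walk_left_limits : forall x, \forall w \ae P, forall t, 0 < t ->
    exists y, \forall s \near t^'-, Y x s w = y ;
  walk_markov : forall (x y z : V) (s t : R) (past : seq (R * V)),
    0 <= s -> 0 <= t -> (forall e, e \in past -> 0 <= e.1 <= s) ->
    let A := [set w | forall e, e \in past -> Y x e.1 w = e.2] in
    P (A `&` [set w | Y x s w = y] `&` [set w | Y x (s + t) w = z]) =
    (P (A `&` [set w | Y x s w = y]) * P [set w | Y y t w = z])%E ;
  walk_derivative : forall h : V -> R, finite_set [set x | h x != 0] ->
    forall x, t^-1 * (semigroup Y t h x - h x) @[t --> 0^'+] --> L h x }.

End RandomWalk.

Definition config :=
  g_sigma_algebraType
    [set A : set (V -> bool) | exists x, A = [set eta | eta x]].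

Definition exchange (x y : V) (eta : V -> bool) : V -> bool :=
  fun z => if z == x then eta y else if z == y then eta x else eta z.

Section Graphical.
Variables (E : set (set V)) (eps : R).

Definition open_bonds (N : set V -> R -> nat) (u t : R) : set (set V) :=
  [set b | E b /\ (N b u < N b t)%N].

(* The bond b, inside C, rings at time s in ]u, t]. *)
Definition rings (N : set V -> R -> nat) (C : set V) (u t s : R) (b : set V)
    : Prop :=
  [/\ u < s <= t, E b, b `<=` C & forall r, 0 <= r < s -> (N b r < N b s)%N].

(* The list l enumerates, by strictly increasing times, all the rings in C: its
   items are (s, (y, z)) with {y, z} ringing at time s. Almost surely no two
   bonds ring at the same time, so such an l exists when C is finite. *)
Definition graphical (N : set V -> R -> nat) (eta : R -> V -> bool) : Prop :=
  forall (k : nat) (t : R), k%:R * eps < t <= k.+1%:R * eps ->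
  forall x : V,
  let u := k%:R * eps in
  let C := component (open_bonds N u t) x in
  exists l : seq (R * (V * V)),
    [/\ sorted <%R [seq e.1 | e <- l],
        forall e, e \in l -> rings N C u t e.1 [set e.2.1; e.2.2],
        forall s b, rings N C u t s b ->
          exists2 e, e \in l & e.1 = s /\ [set e.2.1; e.2.2] = b
      & forall v, C v ->
          eta t v = foldl (fun z e => exchange e.2.1 e.2.2 z) (eta u) l v].

End Graphical.

Section Exclusion.
Context (d : measure_display) (Om : measurableType d) (P : probability Om R).

Record poisson_clocks (bn : R) E c (N : set V -> R -> Om -> nat) : Prop := {
  clock_poisson : forall b, E b -> poisson_process P (bn * c b) (N b) ;
  clock_independent :
    independent_family P E (fun b => sigma_of_process `[0, +oo[ (N b)) }.

Definition percolation_bound E (N : set V -> R -> Om -> nat) (eps : R) : Prop :=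
  0 < eps /\
  \forall w \ae P, finite_components [set b | E b /\ (1 <= N b eps w)%N].

(* eta is (a measurable version of) the exclusion process built from the clocks
   N, with initial law mu and initial configuration independent of N; P is then
   the probability denoted by P_mu. *)
Record exclusion_process E (N : set V -> R -> Om -> nat) (eps : R)
    (mu : probability config R) (eta : R -> Om -> V -> bool) : Prop := {
  exclusion_measurable : forall t, 0 <= t ->
    measurable_fun [set: Om] (eta t : Om -> config) ;
  exclusion_initial_law : forall A : set config, measurable A ->
    P (eta 0 @^-1` A) = mu A ;
  exclusion_initial_independent :
    independent_systems P
      [set eta 0 @^-1` A | A in (measurable : set (set config))]
      <<s \bigcup_(b in E) sigma_of_process `[0, +oo[ (N b) >> ;
  exclusion_graphical : \forall w \ae P,
    graphical E eps (fun b t => N b t w) (fun t => eta t w) }.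

End Exclusion.

End Graph.

Section LimitProcess.
Context (R : realType) (X : pmetricType R) (d : measure_display)
  (Om : measurableType d) (P : probability Om R).

(* W x t is the process started at x, evaluated at time t. *)
Definition kernel_average (W : X -> R -> Om -> X) (t : R) (phi : X -> R)
  (x : X) : R := fine 'E_P[fun w => phi (W x t w)].

(* The last clause is m(dx) P_t(x, du) = m(du) P_t(u, dx) as measures on X * X,
   the first coordinate being x and the second u. *)
Record symmetric_process (m : {measure set (borel X) -> \bar R})
    (W : X -> R -> Om -> X) : Prop := {
  process_measurable : forall x t, 0 <= t ->
    measurable_fun [set: Om] (W x t : Om -> borel X) ;
  process_start : forall x, \forall w \ae P, W x 0 w = x ;
  process_kernel : forall t (A : set (borel X)), 0 <= t -> measurable A ->
    measurable_fun [set: borel X]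
      ((fun x => P (W x t @^-1` A)) : borel X -> \bar R) ;
  process_symmetric : forall t (D : set (borel X * borel X)),
    0 <= t -> measurable D ->
    (\int[m]_x P [set w | D (x, W x t w)] =
     \int[m]_u P [set w | D (W u t w, u)])%E }.

End LimitProcess.

(* Main.v *)
Require Import Defs.
From mathcomp Require Import all_boot all_order all_algebra finmap.
From mathcomp Require Import all_classical all_reals all_analysis.
From mathcomp Require Import measurable_realfun.
From mathcomp Require Import ring lra.

(** The proof rests on the duality of the exclusion process with the random walk
    and on a variance bound, both obtained from the exchanges that the clocks
    perform.

    Fix a graph. An exchange of values is a change of the site at which the old
    configuration is read, so the value [eta_t v] is [eta_0] at the ancestor of
    [v], the site reached by following the exchanges backwards from [v]. In the
    finite components of the graphical construction this line is determined by
    finitely many rings ([ancestry_exists]). On the event that the ancestral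
    lines of given sites stay in a finite set, the process can be replaced by
    the dynamics of finitely many bonds, and, on a grid in which no step has two
    rings, by a composition of independent random exchanges
    ([backtrack_trace], [history_lawP]).

    For such compositions let [Q] be the one-step average, a symmetric operator.
    Given the initial configuration, the statistic [sum phi(v) eta_t(v)] has mean
    [sum (Q^n phi)(y) eta_0(y)]. Its variance is at most [sum phi^2]: one exchange
    creates a fluctuation no larger than the decrease of the squared norm of the
    test function under [Q], and these decreases telescope ([one_step_sqr],
    [history_sqr]).

    The powers of [Q] converge in total variation to the transition probabilities
    of the walk ([finite_approximation]). The walk is only given by its generator
    at time 0, which is compared with [Q] on a finite set [S] with killing outside
    [S]; the killed kernels are products of many short steps that agree to first
    order, the walk dominates its killed version, and the killed finite dynamics
    loses little mass, because the ancestral lines stay in [S]. This gives at the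
    same time the symmetry of the walk ([transition_sym]).

    Chebyshev's inequality then bounds, on the [n]-th graph, the probability that
    [sum phi(v) eta_t(v)] and [sum (P^n_t phi)(y) eta_0(y)] differ by more than
    [a_n delta] by [sum phi^2 / (a_n delta)^2] ([deviation_probability]), which
    tends to 0 because [sum phi^2 / a_n] converges and [a_n] diverges. By
    homogenization [P^n_t phi] can be replaced by [P_t phi], the assumption on the
    initial laws gives the limit [int (P_t phi) rho_0 dm], and the symmetry of the
    limiting kernel turns it into [int phi (P_t rho_0) dm] ([pairing_sym]). *)

Set Implicit Arguments.
Unset Strict Implicit.
Unset Printing Implicit Defensive.

Import Order.TTheory GRing.Theory Num.Theory.
Import numFieldNormedType.Exports.

Local Open Scope classical_set_scope.
Local Open Scope ring_scope.

(** * Exchanges along bonds *)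

Section Swap.
Context (V : choiceType).
Implicit Types (b : set V) (x y v : V).

(** The exchange across a bond given as a set of sites. The default value of
    [xget] makes it the identity away from the bond. *)
Definition swap b x : V := xget x [set y | x != y /\ b = [set x; y]].

Definition oswap (o : option (set V)) x : V :=
  if o is Some b then swap b x else x.

(** The list [os] is chronological and the search for the ancestor of [v] goes
    backwards, so the last exchange is the first one applied to [v]. *)
Definition trace (os : seq (option (set V))) v : V := foldr oswap v os.

Lemma set2_inj x y z : x != y -> [set x; y] = [set x; z] -> y = z.
Proof.
move=> xy e; have : [set x; z] y by rewrite -e; right.
by move=> [] // yx; move: xy; rewrite yx eqxx.
Qed.

Lemma swap_pair x y : x != y -> swap [set x; y] x = y.
Proof.
move=> xy; apply: xget_unique; first by [].
by move=> z [xz /(set2_inj xy)].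
Qed.

Lemma swap_out b x : ~ b x -> swap b x = x.
Proof.
rewrite /swap; case: xgetP => // y _ [_ e] bx.
by exfalso; apply: bx; rewrite e; left.
Qed.

Lemma swap_case b x :
  swap b x = x \/ (x != swap b x /\ b = [set x; swap b x]).
Proof. by rewrite /swap; case: xgetP => [y -> [xy e]|]; [right|left]. Qed.

Lemma swapK b : involutive (swap b).
Proof.
move=> x; case: (swap_case b x) => [e|[xy e]]; first by rewrite !e.
by rewrite {1}e setUC swap_pair // eq_sym.
Qed.

Lemma oswapK o : involutive (oswap o).
Proof. by case: o => [b|] x //=; rewrite swapK. Qed.

Lemma swap_in b x : b x -> b (swap b x).
Proof.
by move=> bx; case: (swap_case b x) => [->//|[_ e]]; rewrite [b in b _]e; right.
Qed.

(** Exchanging two values amounts to reading the old configuration at the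
    exchanged site. This turns the forward construction of the process into a
    backward search for the site from which a value comes. *)
Lemma exchangeE x y (eta : V -> bool) z :
  x != y -> exchange x y eta z = eta (swap [set x; y] z).
Proof.
move=> xy; rewrite /exchange; case: eqVneq => [->|zx].
  by rewrite swap_pair.
case: eqVneq => [->|zy].
  by rewrite setUC swap_pair // eq_sym.
by rewrite swap_out // => -[] e; [move: zx|move: zy]; rewrite e eqxx.
Qed.

End Swap.

(** * Tracing a site backwards in time *)

Section Backtrack.
Context (R : realType) (V : choiceType).
Implicit Types (L : seq (R * set V)) (v : V) (r s t u : R).

(** The ancestor at time [r] of the site [v]: [L] lists rings by increasing
    time, and those after [r] are undone. *)
Definition backtrack L v r : V :=
  foldr (fun e x => swap e.2 x) v [seq e <- L | r < e.1].

Lemma backtrack_late L v r : (forall e, e \in L -> e.1 <= r) ->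
  backtrack L v r = v.
Proof.
move=> h; rewrite /backtrack (eq_in_filter (a2 := pred0)) ?filter_pred0//.
by move=> e /h; rewrite leNgt => /negbTE.
Qed.

Lemma backtrack_cat L1 L2 v r :
  backtrack (L1 ++ L2) v r = backtrack L1 (backtrack L2 v r) r.
Proof. by rewrite /backtrack filter_cat foldr_cat. Qed.

Lemma backtrack_sub L (A : set V) v r : A v ->
  (forall e, e \in L -> e.2 `<=` A) -> A (backtrack L v r).
Proof.
rewrite /backtrack => Av.
elim: L => [|e L IH] //= hL.
have {}IH : A (foldr (fun e x => swap e.2 x) v [seq e <- L | r < e.1]).
  by apply: IH => e' e'L; apply: hL; rewrite inE e'L orbT.
case: ifP => //= _; set x := foldr _ _ _ in IH *.
case: (pselect (e.2 x)) => [ex|ex]; last by rewrite swap_out.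
by apply: (hL e); [rewrite mem_head|exact: swap_in].
Qed.

Variables (E : set (set V)) (N : set V -> R -> nat).

Definition jumps (b : set V) s := forall r, 0 <= r < s -> (N b r < N b s)%N.

(** A finite list of rings that determines the whole ancestral line of the site
    [v] at time [t]. Completeness is only asked for the bonds that touch the
    ancestor at the time of the ring, as all other rings leave the ancestral line
    unchanged. *)
Record ancestry t v L : Prop := {
  anc_sorted : sorted <%R [seq e.1 | e <- L] ;
  anc_ring : forall e, e \in L -> [/\ 0 < e.1 <= t, E e.2 & jumps e.2 e.1] ;
  anc_complete : forall s b, 0 < s <= t -> E b -> jumps b s ->
    b (backtrack L v s) -> (s, b) \in L }.

Hypothesis hE : unoriented_graph E.
Hypothesis N_nd : forall b, E b -> forall s t, 0 <= s <= t -> (N b s <= N b t)%N.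
Hypothesis N_rc : forall b, E b -> forall t, 0 <= t ->
  \forall s \near t^'+, N b s = N b t.

(** The last time at which the counter still has its initial value does not
    exist, by right-continuity: the supremum of these times is a ring. *)
Lemma jump_exists b u t : E b -> 0 <= u -> (N b u < N b t)%N -> u <= t ->
  exists2 s, u < s <= t & jumps b s.
Proof.
move=> Eb u0 Nut ut.
pose A := [set s | u <= s <= t /\ N b s = N b u].
have Au : A u by split=> //; rewrite lexx.
have hA : has_sup A.
  by split; [exists u|exists t => s [/andP[]]].
pose s := sup A.
have us : u <= s by apply: ub_le_sup => //; exact: hA.2.
have st : s <= t by apply: ge_sup; [exists u|move=> y [/andP[]]].
have s0 : 0 <= s by apply: le_trans us.
have low r : u <= r -> r < s -> N b r = N b u.
  move=> ur rs; have [r' Ar' rr'] := sup_adherent (eps := s - r) (ltac:(lra)) hA.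
  have {}rr' : r < r' by move: rr'; rewrite -/s opprB addrC subrK.
  apply/eqP; rewrite eqn_leq; apply/andP; split; last by apply: N_nd => //; rewrite u0.
  case: Ar' => /andP[ur' r't] <-; apply: N_nd => //.
  by rewrite (le_trans u0)//= ltW.
have Ns : (N b u < N b s)%N.
  rewrite ltnNge; apply/negP => Nle.
  have Ns : N b s = N b u.
    by apply/eqP; rewrite eqn_leq Nle; apply: N_nd => //; rewrite u0.
  have {}st : s < t.
    by rewrite lt_neqAle st andbT; apply/eqP => e; move: Nut; rewrite -e Ns ltnn.
  have H : \forall r \near s^'+, N b r = N b s /\ (s < r /\ r < t).
    apply: filterI; first exact: N_rc.
    by apply: filterI; [exact: nbhs_right_gt|exact: nbhs_right_lt].
  have [s' [Ns' [ss' s't]]] := @filter_ex _ _ (at_right_proper_filter s) _ H.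
  have As' : A s'.
    by rewrite /A /= Ns' Ns (le_trans us (ltW ss')) (ltW s't).
  suff : s' <= s by rewrite leNgt ss'.
  by apply: ub_le_sup As'; exact: hA.2.
exists s => //.
  rewrite st andbT lt_neqAle us andbT; apply/eqP => e; move: Ns; rewrite -e ltnn.
  by [].
move=> r /andP[r0 rs]; case: (leP u r) => ur; first by rewrite low.
by apply: leq_ltn_trans Ns; apply: N_nd => //; rewrite r0 ltW.
Qed.

Lemma bond_neq x y : E [set x; y] -> x != y.
Proof.
move=> /hE [x' [y' [xy e]]]; apply/eqP => eq_xy; rewrite -eq_xy in e.
have xx z : [set x'; y'] z -> z = x by rewrite -e => -[].
by move: xy; rewrite (xx x' (or_introl erefl)) (xx y' (or_intror erefl)) eqxx.
Qed.

Lemma foldl_exchange (eta : V -> bool) (l : seq (R * (V * V))) v :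
  (forall e, e \in l -> e.2.1 != e.2.2) ->
  foldl (fun z e => exchange e.2.1 e.2.2 z) eta l v =
  eta (foldr (fun e x => swap e.2 x) v
         [seq (e.1, [set e.2.1; e.2.2]) | e <- l]).
Proof.
elim: l eta => [|e l IH] eta hl //=.
rewrite IH => [|e' e'l]; last by apply: hl; rewrite inE e'l orbT.
by rewrite exchangeE //; apply: hl; rewrite mem_head.
Qed.

Variables (eps : R) (eta : R -> V -> bool).
Hypothesis eps0 : 0 < eps.
Hypothesis hgr : graphical E eps N eta.

(** Within one time window, a bond that rings and touches the component of [v]
    lies inside this component. Hence the ancestor never leaves the component,
    and the finite list of the rings in it is complete for the ancestor. *)
Lemma ancestry_level (k : nat) t v : k%:R * eps < t <= k.+1%:R * eps ->
  exists L, [/\ sorted <%R [seq e.1 | e <- L],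
    forall e, e \in L -> [/\ k%:R * eps < e.1 <= t, E e.2 & jumps e.2 e.1],
    forall s b, k%:R * eps < s <= t -> E b -> jumps b s ->
      b (backtrack L v s) -> (s, b) \in L
  & eta t v = eta (k%:R * eps) (backtrack L v (k%:R * eps))].
Proof.
move=> ht; have /andP[ut tu] := ht.
have u0 : 0 <= k%:R * eps by rewrite mulr_ge0 // ltW.
have [] := hgr ht v; set u := k%:R * eps in ht ut u0 *.
set C := component _ _ => l [lsorted lring lcompl leta].
set L := [seq (e.1, [set e.2.1; e.2.2]) | e <- l].
have Lring e : e \in L -> rings E N C u t e.1 e.2.
  by move=> /mapP[e' /lring + ->].
have Cv : C v by exists [::].
exists L; split.
- by rewrite -map_comp.
- by move=> e /Lring[].
- move=> s b /andP[us st] Eb jb bx.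
  have Cx : C (backtrack L v s).
    by apply: backtrack_sub => // e /Lring[].
  have [e el [<- <-]] : exists2 e, e \in l & e.1 = s /\ [set e.2.1; e.2.2] = b.
    apply: lcompl; split => //; first by rewrite us.
    move=> y y_b; case: (eqVneq y (backtrack L v s)) => [->//|yx].
    case: Cx => p [pp lastp]; exists (rcons p y).
    rewrite last_rcons rcons_path pp lastp; split=> //=.
    apply/asboolP; have -> : [set backtrack L v s; y] = b.
      have [x' [y' [_ e]]] := hE Eb; move: y_b bx; rewrite e.
      by move=> [] ey [] ex; move: yx; rewrite ey ex ?eqxx // setUC.
    split=> //; apply: (@leq_trans (N b s)); first by apply: jb; rewrite u0.
    by apply: N_nd => //; rewrite (le_trans u0 (ltW us)).
  by apply/mapP; exists e.
- rewrite leta // foldl_exchange.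
    rewrite /backtrack (eq_in_filter (a2 := predT)) ?filter_predT //.
    by move=> e /Lring[/andP[->]].
  by move=> e /lring[_ Ee _ _]; apply: bond_neq.
Qed.

Lemma backtrack_early L v r s : (forall e, e \in L -> r < e.1 /\ s < e.1) ->
  backtrack L v r = backtrack L v s.
Proof.
move=> h; congr foldr; apply: eq_in_filter => e /h [re se].
by rewrite re se.
Qed.

Lemma ancestry_step (k : nat) t v : k%:R * eps < t <= k.+1%:R * eps ->
  (forall w, exists2 L, ancestry (k%:R * eps) w L &
    eta (k%:R * eps) w = eta 0 (backtrack L w 0)) ->
  exists2 L, ancestry t v L & eta t v = eta 0 (backtrack L v 0).
Proof.
move=> ht; have [L2 [so2 ri2 co2 ->]] := ancestry_level v ht.
have /andP[ut tu] := ht.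
have u0 : 0 <= k%:R * eps by rewrite mulr_ge0 // ltW.
set u := k%:R * eps in ht ut u0 so2 ri2 co2 * => hw.
have [L1 [so1 ri1 co1] ->] := hw (backtrack L2 v u).
have back2 r : r <= u -> backtrack L2 v r = backtrack L2 v u.
  move=> ru; apply: backtrack_early => e /ri2[/andP[ue _] _ _]; split => //.
  exact: le_lt_trans ue.
exists (L1 ++ L2); last by rewrite backtrack_cat back2.
split.
- rewrite lt_sorted_pairwise map_cat pairwise_cat; apply/and3P; split.
  + apply/allrelP => x1 x2 /mapP[e1 /ri1[/andP[_ e1u] _ _] ->].
    by move=> /mapP[e2 /ri2[/andP[ue2 _] _ _] ->]; apply: le_lt_trans ue2.
  + by rewrite -lt_sorted_pairwise.
  + by rewrite -lt_sorted_pairwise.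
- move=> e; rewrite mem_cat => /orP[/ri1|/ri2] [/andP[e0 e1] Ee je]; split => //.
    by rewrite e0 (le_trans e1) // ltW.
  by rewrite e1 andbT (le_lt_trans u0).
- move=> s b /andP[s0 st] Eb jb; rewrite backtrack_cat mem_cat.
  case: (leP s u) => su; first by rewrite back2 // => bx; rewrite co1 // s0.
  rewrite backtrack_late => [bx|e /ri1[/andP[_ eu] _ _]].
    by rewrite co2 ?orbT // su.
  by rewrite (le_trans eu) // ltW.
Qed.

Lemma ancestry_levels (k : nat) v :
  exists2 L, ancestry (k%:R * eps) v L &
    eta (k%:R * eps) v = eta 0 (backtrack L v 0).
Proof.
elim: k v => [|k IH] v.
  exists [::]; last by rewrite mul0r.
  split => // s b; rewrite mul0r => /andP[s0 s1].
  by move: (lt_le_trans s0 s1); rewrite ltxx.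
by apply: ancestry_step IH; rewrite lexx andbT ltr_pM2r // ltr_nat.
Qed.

(** The windows are traversed backwards: the ancestor found at the beginning of
    a window is traced further in the component that contains it in the
    preceding window, and the lists are concatenated. *)
Lemma ancestry_exists t v : 0 < t ->
  exists2 L, ancestry t v L & eta t v = eta 0 (backtrack L v 0).
Proof.
move=> t0.
have [k kt] : exists k : nat, k%:R * eps < t <= k.+1%:R * eps.
  have ex : exists n : nat, t <= n%:R * eps.
    have [n hn] : exists n : nat, t / eps <= n%:R.
      exists (Num.truncn (t / eps)).+1; exact/ltW/truncnS_gt.
    by exists n; rewrite -ler_pdivrMr.
  case: (ex_minnP ex) => -[|k] tk kmin.
    by move: tk; rewrite mul0r leNgt t0.
  exists k; rewrite tk andbT ltNge; apply/negP => /kmin; by rewrite ltnn.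
by apply: ancestry_step kt _ => w; apply: ancestry_levels.
Qed.

Lemma filter_time_split L u u' : sorted <%R [seq e.1 | e <- L] -> u <= u' ->
  [seq e <- L | u < e.1] =
    [seq e <- L | u < e.1 <= u'] ++ [seq e <- L | u' < e.1].
Proof.
rewrite lt_sorted_pairwise => so uu'.
elim: L so => [|e L IH] //= /andP[/allP he /IH ->].
case: (ltP u' e.1) => [u'e|eu'].
  rewrite (le_lt_trans uu' u'e) andbF.
  rewrite (eq_in_filter (a2 := pred0) (a1 := fun e => u < e.1 <= u')).
    by rewrite filter_pred0.
  move=> e' e'L /=; rewrite leNgt (lt_trans u'e) ?andbF //.
  by apply: he; exact: map_f.
by rewrite andbT; case: ifP.
Qed.

(** At most one bond of [B] rings between [u] and [u'], so [L] has at most one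
    entry there. If it has none while [b] rings, then [b] does not touch the
    ancestor, by completeness of [L]. *)
Lemma backtrack_step (B : set (set V)) L t v u u' o :
  ancestry t v L -> 0 <= u -> u <= u' -> u' <= t -> B `<=` E ->
  (forall e, e \in L -> B e.2) ->
  (if o is Some b then B b else True) ->
  (forall b, B b -> (N b u' - N b u)%N = (o == Some b)) ->
  backtrack L v u = oswap o (backtrack L v u').
Proof.
move=> [so ri co] u0 uu' u't BE LB oB hN.
have split_L := filter_time_split so uu'.
rewrite {1}/backtrack split_L foldr_cat -/(backtrack L v u').
set x := backtrack L v u'.
set M := [seq e <- L | u < e.1 <= u'] in split_L *.
have M_ring e : e \in M -> [/\ u < e.1 <= u', e \in L, B e.2,
    (N e.2 u < N e.2 e.1)%N & (N e.2 e.1 <= N e.2 u')%N].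
  rewrite mem_filter => /andP[ue eL]; have [/andP[e0 _] Ee je] := ri _ eL.
  have /andP[ue1 eu'] := ue.
  split=> //; [exact: LB|by apply: je; rewrite u0|].
  by apply: N_nd => //; rewrite (ltW e0).
have M_o e : e \in M -> o = Some e.2.
  move=> /M_ring[_ _ Be lt1 le2]; apply/eqP; move: (hN _ Be).
  by case: eqP => // _ /eqP; rewrite subn_eq0 leqNgt (leq_trans lt1).
have M_so : sorted <%R [seq e.1 | e <- M].
  have := so; rewrite !lt_sorted_pairwise !pairwise_map.
  by move=> h; apply: subseq_pairwise h; exact: filter_subseq.
case: M M_ring M_o M_so split_L => [|e [|e' M]] M_ring M_o M_so split_L /=.
- case: o oB hN {M_o} => [b|] //= Bb hN; rewrite swap_out // => bx.
  have Nb : (N b u < N b u')%N by rewrite -subn_gt0 hN // eqxx.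
  have [s /andP[us su'] jb] := jump_exists (BE _ Bb) u0 Nb uu'.
  have xs : backtrack L v s = x.
    congr foldr; apply: eq_in_filter => e eL; apply/idP/idP; last first.
      exact: le_lt_trans.
    move=> se; have : e \in [seq e <- L | u < e.1].
      by rewrite mem_filter eL (lt_trans us se).
    by rewrite split_L /= mem_filter => /andP[].
  have sbL : (s, b) \in L.
    apply: co => //; last by rewrite xs.
      by rewrite (le_lt_trans u0 us) (le_trans su').
    exact: BE.
  have : (s, b) \in [seq e <- L | u < e.1] by rewrite mem_filter sbL us.
  by rewrite split_L /= mem_filter /= ltNge su'.
- by rewrite (M_o e) ?mem_head.
- have ee' : e.1 < e'.1 by move: M_so => /= /andP[].
  have e'M : e' \in [:: e, e' & M] by rewrite !inE eqxx orbT.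
  have eM : e \in [:: e, e' & M] by rewrite mem_head.
  have [_ eL Be lt1 le2] := M_ring _ eM.
  have [_ e'L _ lt1' le2'] := M_ring _ e'M.
  have /= [ebe'] := etrans (esym (M_o _ eM)) (M_o _ e'M).
  have [_ _ je'] := ri _ e'L.
  have [/andP[e0 _] _ _] := ri _ eL.
  have := je' e.1; rewrite (ltW e0) ee' -ebe' => /(_ isT) lt3.
  have := hN _ Be; rewrite (M_o _ eM) eqxx => h1.
  have : (2 <= N e.2 u' - N e.2 u)%N.
    rewrite leq_subRL; last by rewrite (leq_trans (ltnW lt1)).
    rewrite addn2; apply: leq_ltn_trans lt1 _; apply: leq_trans lt3 _.
    by rewrite ebe'.
  by rewrite h1.
Qed.

(** The clocks are observed on the grid of mesh [h]. The entry [None] stands for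
    a step without rings; a step with two rings has no outcome at all. *)
Definition outcome (B : set (set V)) (h : R) (os : seq (option (set V))) :=
  forall j, (j < size os)%N -> forall b, B b ->
    (N b (j.+1%:R * h) - N b (j%:R * h))%N = (nth None os j == Some b).

(** Composing the outcomes of the steps gives the ancestor exactly, whatever
    the mesh, since a step with an outcome has at most one ring of [B]. *)
Lemma backtrack_trace (B : set (set V)) L t v (h : R) os :
  ancestry t v L -> 0 <= h -> t = (size os)%:R * h -> B `<=` E ->
  (forall e, e \in L -> B e.2) ->
  (forall b, Some b \in os -> B b) ->
  outcome B h os ->
  forall j, (j <= size os)%N ->
    trace (drop j os) v = backtrack L v (j%:R * h).
Proof.
move=> anc h0 tE BE LB osB hout j jn.
have {jn}[i [-> jn]] : exists i, j = (size os - i)%N /\ (i <= size os)%N.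
  by exists (size os - j)%N; rewrite subKn // leq_subr.
elim: i jn => [|i IH] jn.
  rewrite subn0 drop_size backtrack_late // -tE => e eL.
  by have [/andP[]] := anc_ring anc eL.
set k := (size os - i.+1)%N.
have kE : (size os - i)%N = k.+1 by rewrite /k subnSK.
have ks : (k < size os)%N by rewrite -kE leq_subr.
rewrite (drop_nth None) //= -kE IH ?(ltnW jn) // kE.
apply: esym; apply: (@backtrack_step B _ t) => //.
- by rewrite mulr_ge0.
- by rewrite ler_wpM2r // ler_nat.
- by rewrite tE ler_wpM2r // ler_nat.
- by have := mem_nth None ks; case: nth => [b /osB|].
- exact: hout.
Qed.

End Backtrack.

(** * Averages over a random composition of exchanges *)

Section Stirring.
Context (R : realType) (V : choiceType).
Variables (B : seq (set V)) (p : option (set V) -> R) (Lam : {fset V}).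
Implicit Types (o : option (set V)) (os : seq (option (set V)))
  (f g h sigma : V -> R) (x y v : V) (n : nat).

Definition outcomes : seq (option (set V)) := None :: [seq Some b | b <- B].

Fixpoint histories n : seq (seq (option (set V))) :=
  if n is n'.+1 then [seq o :: os | o <- outcomes, os <- histories n']
  else [:: [::]].

Definition weight os : R := \prod_(o <- os) p o.

Definition average h x : R := \sum_(o <- outcomes) p o * h (oswap o x).

Definition inner f g : R := \sum_(x <- Lam) f x * g x.

Lemma history_consP n os : os \in histories n.+1 ->
  exists o os', [/\ o \in outcomes, os' \in histories n & os = o :: os'].
Proof. exact: allpairsPdep. Qed.

Lemma size_history n os : os \in histories n -> size os = n.
Proof.
elim: n os => [|n IH] os; first by rewrite inE => /eqP->.
by move=> /history_consP[q [os' [_ /IH <- ->]]].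
Qed.

Lemma mem_history n os b : os \in histories n -> Some b \in os -> b \in B.
Proof.
elim: n os => [|n IH] os; first by rewrite inE => /eqP->.
move=> /history_consP[q [os' [qB /IH os'n ->]]].
rewrite inE => /orP[/eqP eo|//]; move: qB; rewrite -eo inE /=.
by move=> /mapP[b' b'B [->]].
Qed.

Lemma sum_histories n (F : seq (option (set V)) -> R) :
  \sum_(os <- histories n.+1) F os =
  \sum_(o <- outcomes) \sum_(os <- histories n) F (o :: os).
Proof. by rewrite big_allpairs_dep. Qed.

Lemma weight_cons o os : weight (o :: os) = p o * weight os.
Proof. by rewrite /weight big_cons. Qed.

Lemma average_trace n h v :
  \sum_(os <- histories n) weight os * h (trace os v) = iter n average h v.
Proof.
elim: n h => [|n IH] h; first by rewrite big_seq1 /weight big_nil mul1r.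
rewrite sum_histories iterSr -IH exchange_big /=; apply: eq_bigr => os _.
rewrite /average mulr_sumr; apply: eq_bigr => o _.
by rewrite /weight big_cons mulrA (mulrC (p o)).
Qed.

Hypothesis p_ge0 : forall o, o \in outcomes -> 0 <= p o.
Hypothesis p_sum : \sum_(o <- outcomes) p o = 1.
Hypothesis p_None : 1 / 2 <= p None.
Hypothesis B_Lam : forall b, b \in B -> forall x, b x -> x \in Lam.

Lemma weight_ge0 n os : os \in histories n -> 0 <= weight os.
Proof.
elim: n os => [|n IH] os; first by rewrite inE => /eqP ->; rewrite /weight big_nil.
by move=> /history_consP[q [os' [qB /IH w0 ->]]]; rewrite weight_cons mulr_ge0 ?p_ge0.
Qed.

Lemma weight_sum n : \sum_(os <- histories n) weight os = 1.
Proof.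
elim: n => [|n IH]; first by rewrite big_seq1 /weight big_nil.
rewrite sum_histories -p_sum; apply: eq_bigr => o _.
rewrite -[RHS]mulr1 -IH mulr_sumr; apply: eq_bigr => os _.
by rewrite /weight big_cons.
Qed.

Lemma oswap_Lam o x : o \in outcomes -> x \in Lam -> oswap o x \in Lam.
Proof.
case: o => [b|] //=; rewrite inE /= => /mapP[b' b'B [->]] xL.
have [bx|bx] := pselect (b' x); last by rewrite swap_out.
by apply: B_Lam b'B _ _; apply: swap_in.
Qed.

Lemma sum_oswap o g : o \in outcomes ->
  \sum_(x <- Lam) g (oswap o x) = \sum_(x <- Lam) g x.
Proof.
move=> oO; rewrite -(big_map (oswap o) predT g); apply: perm_big.
apply: uniq_perm; [|exact: fset_uniq|].
  by rewrite map_inj_uniq ?fset_uniq //; apply: inv_inj; exact: oswapK.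
move=> x; apply/mapP/idP => [[y yL ->]|xL]; first exact: oswap_Lam.
by exists (oswap o x); rewrite ?oswapK // oswap_Lam.
Qed.

Lemma innerC f g : inner f g = inner g f.
Proof. by apply: eq_bigr => x _; rewrite mulrC. Qed.

Lemma inner_oswap o f g : o \in outcomes ->
  inner (f \o oswap o) g = inner f (g \o oswap o).
Proof.
move=> oO; rewrite /inner -(sum_oswap _ oO); apply: eq_bigr => x _ /=.
by rewrite oswapK.
Qed.

Lemma inner_average_r f g :
  inner f (average g) = \sum_(o <- outcomes) p o * inner f (g \o oswap o).
Proof.
rewrite /inner (eq_bigr (fun x => \sum_(o <- outcomes) p o * (f x * g (oswap o x)))).
  by rewrite exchange_big; apply: eq_bigr => o _; rewrite mulr_sumr.
by move=> x _; rewrite mulr_sumr; apply: eq_bigr => o _; rewrite mulrCA.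
Qed.

Lemma inner_average f g : inner (average f) g = inner f (average g).
Proof.
rewrite innerC !inner_average_r [LHS]big_seq [RHS]big_seq.
by apply: eq_bigr => o oO; rewrite innerC inner_oswap.
Qed.

Lemma inner_average_iter n f g :
  inner (iter n average f) g = inner f (iter n average g).
Proof.
by elim: n f g => // n IH f g; rewrite iterS inner_average IH -iterSr.
Qed.

Lemma average_iter_Lam n h1 h2 : {in Lam, h1 =1 h2} ->
  {in Lam, iter n average h1 =1 iter n average h2}.
Proof.
elim: n => [|n IH] h12 //= x xL; rewrite /average big_seq [RHS]big_seq.
by apply: eq_bigr => o oO; rewrite IH // oswap_Lam.
Qed.

(** An exchange changes [inner g sigma] by [(g y - g x) (sigma x - sigma y)],
    while it moves [g] by [2 (g y - g x)^2] in squared norm. *)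
Lemma exchange_sqr o g sigma : o \in outcomes -> (forall x, 0 <= sigma x <= 1) ->
  (inner g (sigma \o oswap o) - inner g sigma) ^+ 2 <=
  1 / 2 * inner (g \o oswap o \- g) (g \o oswap o \- g).
Proof.
move=> oO hs; rewrite -inner_oswap //.
have -> : inner (g \o oswap o) sigma - inner g sigma =
    \sum_(x <- Lam) (g (oswap o x) - g x) * sigma x.
  by rewrite /inner -sumrB; apply: eq_bigr => x _; rewrite mulrBl.
rewrite /inner /=.
case: o oO => [b|] oO /=; last first.
  by rewrite !big1 ?mulr0 ?expr0n // => x _; rewrite subrr mul0r.
have [[x xL bx]|hb] := pselect (exists2 x, x \in Lam & x != swap b x); last first.
  have sb x : x \in Lam -> swap b x = x.
    by move=> xL; apply/eqP; apply/negPn/negP => bx; apply: hb; exists x => //; rewrite eq_sym.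
  rewrite !big_seq !big1 ?mulr0 ?expr0n // => x xL; rewrite sb // subrr mul0r //.
set y := swap b x in bx *.
have yL : y \in Lam by exact: (oswap_Lam oO xL).
have sy : swap b y = x by rewrite swapK.
have bE : b = [set x; y] by case: (swap_case b x) => [e|[]//]; move: bx; rewrite /y e eqxx.
have two F : (forall z, z != x -> z != y -> F z = 0) ->
    \sum_(z <- Lam) F z = F x + F y :> R.
  move=> hF; rewrite (big_fsetD1 x) //= (big_fsetD1 y) /=; last first.
    by rewrite in_fsetD1 eq_sym bx yL.
  rewrite addrA big_seq big1 ?addr0 // => z; rewrite !in_fsetD1 => /and3P[zy zx _].
  exact: hF.
have out z : z != x -> z != y -> swap b z = z.
  move=> zx zy; apply: swap_out; rewrite bE => -[] e; [move: zx|move: zy];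
  by rewrite e eqxx.
rewrite !two => [|z zx zy|z zx zy]; try by rewrite out // subrr mul0r.
rewrite sy -/y.
have -> : (g y - g x) * sigma x + (g x - g y) * sigma y =
  (g y - g x) * (sigma x - sigma y) by ring.
have -> : 1 / 2 * ((g y - g x) * (g y - g x) + (g x - g y) * (g x - g y)) =
  (g y - g x) ^+ 2 by field.
rewrite exprMn ler_piMr ?sqr_ge0 //.
by have := hs x; have := hs y; nra.
Qed.

(** As [average] is a symmetric contraction, the decrease of the squared norm is
    the Dirichlet form of the step, up to the square of the mean displacement.
    Since the identity has weight at least 1/2, the Cauchy-Schwarz inequality
    shows that this square takes away at most half of the Dirichlet form. *)
Lemma average_sqr g : inner (average g) (average g) <= inner g g -
  1 / 2 * \sum_(o <- outcomes) p o * inner (g \o oswap o \- g) (g \o oswap o \- g).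
Proof.
pose D o x := g (oswap o x) - g x.
pose S x := \sum_(o <- outcomes) p o * D o x.
have avE x : average g x = g x + S x.
  rewrite /average /S /D.
  under [in RHS]eq_bigr do rewrite mulrBr.
  by rewrite sumrB -mulr_suml p_sum mul1r addrC subrK.
have S2 x : S x ^+ 2 <= 1 / 2 * \sum_(o <- outcomes) p o * D o x ^+ 2.
  have D0 : D None x = 0 by rewrite /D subrr.
  rewrite /S /outcomes !big_cons D0 expr0n !mulr0 !add0r.
  set A := \sum_(o <- _) _.
  have eA : A = \sum_(o <- [seq Some b | b <- B]) p o * D o x by [].
  clearbody A.
  (* Cauchy-Schwarz with total weight at most 1/2: center the square at 2 A *)
  have : 0 <= \sum_(o <- [seq Some b | b <- B]) p o * (D o x - 2 * A) ^+ 2.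
    rewrite big_seq; apply: sumr_ge0 => o oO.
    by rewrite mulr_ge0 ?sqr_ge0 // p_ge0 // inE oO orbT.
  have -> : \sum_(o <- [seq Some b | b <- B]) p o * (D o x - 2 * A) ^+ 2 =
      \sum_(o <- [seq Some b | b <- B]) p o * D o x ^+ 2
      + (- 4 * A) * A + (4 * A ^+ 2) * \sum_(o <- [seq Some b | b <- B]) p o.
    have -> : (- 4 * A) * A =
        \sum_(o <- [seq Some b | b <- B]) (- 4 * A) * (p o * D o x).
      by rewrite -mulr_sumr -eA.
    rewrite !mulr_sumr -!big_split /=; apply: eq_bigr => o _; ring.
  have := p_sum; rewrite /outcomes big_cons; set q := \sum_(o <- _) p o => pq.
  have q2 : q <= 1 / 2 by have := p_None; lra.
  set T := \sum_(o <- _) _ => hT; have := sqr_ge0 A.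
  by nra.
have -> : inner (average g) (average g) =
    inner g g + 2 * inner g S + \sum_(x <- Lam) S x ^+ 2.
  rewrite /inner mulr_sumr -!big_split /=; apply: eq_bigr => x _.
  by rewrite avE; ring.
have -> : 2 * inner g S =
    - \sum_(o <- outcomes) p o * inner (g \o oswap o \- g) (g \o oswap o \- g).
  have -> : inner g S = \sum_(o <- outcomes) p o * inner g (D o).
    rewrite /inner /S (eq_bigr (fun x => \sum_(o <- outcomes) p o * (g x * D o x))).
      by rewrite exchange_big; apply: eq_bigr => o _; rewrite mulr_sumr.
    by move=> x _; rewrite mulr_sumr; apply: eq_bigr => o _; rewrite mulrCA.
  rewrite mulr_sumr -sumrN [LHS]big_seq [RHS]big_seq; apply: eq_bigr => o oO.
  have : inner (g \o oswap o) (g \o oswap o) = inner g g.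
    by rewrite /inner -[RHS](sum_oswap _ oO).
  have -> : inner (g \o oswap o) (g \o oswap o) = inner g g + 2 * inner g (D o)
      + inner (g \o oswap o \- g) (g \o oswap o \- g).
    rewrite /inner mulr_sumr -!big_split /=; apply: eq_bigr => x _.
    by rewrite /D; ring.
  by move=> e; rewrite mulrCA -mulrN; congr *%R; lra.
have : \sum_(x <- Lam) S x ^+ 2 <= 1 / 2 *
    \sum_(o <- outcomes) p o * inner (g \o oswap o \- g) (g \o oswap o \- g).
  apply: le_trans (_ : \sum_(x <- Lam) (1 / 2 * \sum_(o <- outcomes) p o * D o x ^+ 2) <= _).
    by apply: ler_sum => x _; exact: S2.
  rewrite -mulr_sumr exchange_big /= ler_wpM2l //; apply: ler_sum => o _.
  by rewrite -mulr_sumr.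
lra.
Qed.

(** The fluctuation of the linear statistic [inner phi sigma] created by one
    random exchange is paid for by the decrease of the norm of [phi]. *)
Lemma one_step_sqr g sigma : (forall x, 0 <= sigma x <= 1) ->
  \sum_(o <- outcomes) p o * inner g (sigma \o oswap o) ^+ 2 <=
  inner g (average sigma) ^+ 2 + inner g g - inner (average g) (average g).
Proof.
move=> hs; set a := inner g sigma.
have h1 : \sum_(o <- outcomes) p o * (inner g (sigma \o oswap o) - a) ^+ 2 <=
    inner g g - inner (average g) (average g).
  apply: (@le_trans _ _ (1 / 2 * \sum_(o <- outcomes) p o * inner (g \o oswap o \- g) (g \o oswap o \- g))).
    rewrite mulr_sumr big_seq [leRHS]big_seq; apply: ler_sum => o oO.
    rewrite [leRHS]mulrCA; apply: ler_wpM2l; [exact: p_ge0|exact: exchange_sqr].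
  have := average_sqr g; lra.
set A := inner g (average sigma).
have eA : A = \sum_(o <- outcomes) p o * inner g (sigma \o oswap o).
  exact: inner_average_r.
clearbody a A.
have : \sum_(o <- outcomes) p o * (inner g (sigma \o oswap o) - a) ^+ 2 =
   \sum_(o <- outcomes) p o * inner g (sigma \o oswap o) ^+ 2
   - 2 * a * A + a ^+ 2 * \sum_(o <- outcomes) p o.
  rewrite eA !mulr_sumr -sumrB -big_split /=; apply: eq_bigr => o _; ring.
rewrite p_sum; have := sqr_ge0 (A - a); nra.
Qed.

(** Induction on the number of steps, for all configurations at once. The first
    step acts on the configuration and the others are handled by the induction
    hypothesis with the evolved test function; the decrements of its norm
    telescope, so the total fluctuation is bounded uniformly in [n]. *)
Lemma history_sqr n phi sigma : (forall x, 0 <= sigma x <= 1) ->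
  \sum_(os <- histories n) weight os * inner phi (sigma \o trace os) ^+ 2 <=
  inner phi (iter n average sigma) ^+ 2 + inner phi phi
   - inner (iter n average phi) (iter n average phi).
Proof.
elim: n sigma => [|n IH] sigma hs.
  by rewrite big_seq1 /weight big_nil mul1r /= addrK.
rewrite sum_histories.
set g := iter n average phi.
apply: (@le_trans _ _ (\sum_(o <- outcomes)
    p o * (inner g (sigma \o oswap o) ^+ 2 + (inner phi phi - inner g g)))).
  rewrite big_seq [leRHS]big_seq; apply: ler_sum => o oO.
  rewrite addrA /g inner_average_iter.
  have := ler_wpM2l (p_ge0 oO) (IH (sigma \o oswap o) (fun x => hs _)).
  apply: le_trans; rewrite big_distrr /=; apply: ler_sum => os _.
  by rewrite weight_cons -mulrA; exact: lexx.
under eq_bigr do rewrite mulrDr.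
rewrite big_split /= -mulr_suml p_sum mul1r.
have := one_step_sqr g hs.
have -> : inner g (average sigma) = inner phi (iter n.+1 average sigma).
  by rewrite /g inner_average_iter -iterSr.
rewrite /= -/g; lra.
Qed.

(** Bias-variance decomposition around an arbitrary prediction [c]; the variance
    is at most the squared norm of [phi], as for independent particles. *)
Lemma history_deviation n phi sigma c : (forall x, 0 <= sigma x <= 1) ->
  \sum_(os <- histories n) weight os * (inner phi (sigma \o trace os) - c) ^+ 2 <=
  inner phi phi + (inner (iter n average phi) sigma - c) ^+ 2.
Proof.
move=> hs; have := history_sqr n phi hs.
rewrite [inner (iter n average phi) sigma]inner_average_iter.
set A := inner phi (iter n average sigma).
have eA : A = \sum_(os <- histories n) weight os * inner phi (sigma \o trace os).
  rewrite /A {1}/inner.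
  under eq_bigr do rewrite -average_trace mulr_sumr.
  rewrite exchange_big /=; apply: eq_bigr => os _; rewrite /inner mulr_sumr.
  by apply: eq_bigr => x _; rewrite mulrCA.
clearbody A.
have -> : \sum_(os <- histories n) weight os * (inner phi (sigma \o trace os) - c) ^+ 2 =
   \sum_(os <- histories n) weight os * inner phi (sigma \o trace os) ^+ 2
   - 2 * c * A + c ^+ 2 * \sum_(os <- histories n) weight os.
  rewrite eA !mulr_sumr -sumrB -big_split /=; apply: eq_bigr => os _; ring.
rewrite weight_sum.
have : 0 <= inner (iter n average phi) (iter n average phi).
  by apply: sumr_ge0 => x _; rewrite -expr2 sqr_ge0.
nra.
Qed.

End Stirring.

(** * The law of the clocks on a time grid *)

Lemma measurable_increment d (T : measurableType d) (f g : T -> nat) k :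
  (forall i, measurable (f @^-1` [set i])) ->
  (forall i, measurable (g @^-1` [set i])) ->
  measurable [set w | (f w - g w)%N = k].
Proof.
move=> mf mg.
rewrite (_ : [set w | _] = \bigcup_i \bigcup_j
    if (i - j == k)%N then f @^-1` [set i] `&` g @^-1` [set j] else set0).
  apply: bigcupT_measurable => i; apply: bigcupT_measurable => j.
  by case: ifP => // _; apply: measurableI.
apply/seteqP; split=> [w <-|w [i _ [j _]]] /=.
  by exists (f w) => //; exists (g w) => //=; rewrite eqxx.
by case: eqP => // <- [/= -> ->].
Qed.

Section PoissonLaw.
Context (R : realType).

Lemma poisson_prob01 (rho : R) (b : bool) : 0 <= rho ->
  poisson_prob rho 0 [set (b : nat)] =
  (expR (- rho) * (if b then rho else 1))%:E.
Proof.
move=> rho0; rewrite /poisson_prob; case: ltP => h.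
  rewrite esum_set1 ?lee_fin ?poisson_pmf_ge0 // /poisson_pmf h.
  by case: b; rewrite ?expr1 ?expr0 ?fact0 ?factS ?invr1 ?mulr1 ?mul1r // mulrC.
have -> : rho = 0 by apply/eqP; rewrite eq_le h rho0.
rewrite oppr0 expR0 mul1r diracE; case: b; first by rewrite memNset.
by rewrite mem_set.
Qed.

Context (d : measure_display) (Om : measurableType d) (P : probability Om R).

Definition grid_event (N : R -> Om -> nat) (h : R) n (k : nat -> nat) : set Om :=
  [set w | forall j, (j < n)%N -> subn (N (j.+1%:R * h) w) (N (j%:R * h) w) = k j].

Lemma grid_event_sigma (N : R -> Om -> nat) (h : R) n (k : nat -> nat)
    (T : set R) : 0 <= h -> (forall j, (j <= n)%N -> T (j%:R * h)) ->
  sigma_of_process T N (grid_event N h n k).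
Proof.
move=> h0 hT.
pose G := [set A | exists t k, T t /\ A = N t @^-1` [set k]].
suff : measurable (grid_event N h n k : set (g_sigma_algebraType G)) by [].
have mN j : (j <= n)%N -> forall i,
    measurable (N (j%:R * h) @^-1` [set i] : set (g_sigma_algebraType G)).
  move=> jn i; apply: sub_sigma_algebra; exists (j%:R * h), i; split => //.
  exact: hT.
rewrite (_ : grid_event N h n k = \bigcap_(j in [set j | (j < n)%N])
   ([set w | subn (N (j.+1%:R * h) w) (N (j%:R * h) w) = k j]
      : set (g_sigma_algebraType G))).
  apply: bigcap_measurableType => j jn.
  by apply: measurable_increment => i; apply: mN => //; apply: ltnW.
by apply/seteqP; split=> w /= hw j jn; apply: hw.
Qed.

(** Each increment is independent of the past of the process. *)
Lemma grid_eventP lambda (N : R -> Om -> nat) (h : R) n (k : nat -> nat) :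
  poisson_process P lambda N -> 0 <= h ->
  P (grid_event N h n k) = (\prod_(j < n) poisson_prob (lambda * h) 0 [set k j])%E.
Proof.
move=> hN h0; elim: n => [|n IH].
  rewrite big_ord0 (_ : grid_event _ _ _ _ = setT) ?probability_setT //.
  by apply/seteqP; split.
rewrite big_ord_recr /= -IH.
have -> : grid_event N h n.+1 k = grid_event N h n k `&`
    [set w | subn (N (n.+1%:R * h) w) (N (n%:R * h) w) = k n].
  apply/seteqP; split=> [w hw|w [hw1 hw2] j].
    by split=> [j jn|]; apply: hw => //; rewrite ltnW.
  by rewrite ltnS leq_eqVlt => /orP[/eqP->//|]; apply: hw1.
rewrite (poisson_increments hN); first by rewrite -mulrBl -natrB // subSnn mul1r.
  by rewrite mulr_ge0 //= ler_wpM2r // ler_nat.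
apply: grid_event_sigma => // j jn /=.
by rewrite in_itv /= mulr_ge0 //= ler_wpM2r // ler_nat.
Qed.

End PoissonLaw.

Section HistoryLaw.
Context (R : realType) (V : choiceType) (d : measure_display)
  (Om : measurableType d) (P : probability Om R).
Variables (E : set (set V)) (bn : R) (c : set V -> R)
  (N : set V -> R -> Om -> nat) (eps : R) (mu : probability (config V) R)
  (eta : R -> Om -> V -> bool).
Hypothesis bn0 : 0 < bn.
Hypothesis c0 : forall b, E b -> 0 <= c b.
Hypothesis hN : poisson_clocks P bn E c N.
Hypothesis heta : exclusion_process P E N eps mu eta.
Variables (B : {fset set V}) (h : R).
Hypothesis BE : forall b, b \in B -> E b.
Hypothesis h0 : 0 <= h.

Definition rate (b : set V) : R := bn * c b.
Definition total_rate : R := \sum_(b <- B) rate b.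

(** The probabilities of the outcomes of one time step of length [h],
    conditionally on at most one ring; [step_mass] is the probability of that
    condition. *)
Definition step_law (o : option (set V)) : R :=
  (if o is Some b then rate b * h else 1) / (1 + total_rate * h).
Definition step_mass : R := expR (- (total_rate * h)) * (1 + total_rate * h).

Definition history_event (os : seq (option (set V))) : set Om :=
  [set w | outcome (fun b t => N b t w) [set` B] h os].

Lemma rate_ge0 b : b \in B -> 0 <= rate b.
Proof. by move=> bB; apply: mulr_ge0; [exact: ltW|apply/c0/BE]. Qed.

Lemma total_rate_ge0 : 0 <= total_rate.
Proof. by rewrite /total_rate big_seq sumr_ge0 // => b; exact: rate_ge0. Qed.

Lemma mass_gt0 : 0 < 1 + total_rate * h.
Proof. by rewrite ltr_pwDl // mulr_ge0 // total_rate_ge0. Qed.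

Lemma step_law_ge0 o : o \in outcomes B -> 0 <= step_law o.
Proof.
move=> oB; rewrite divr_ge0 // ?(ltW mass_gt0) //.
case: o oB => // b; rewrite inE /= => /mapP[b' b'B [->]].
by rewrite mulr_ge0 // rate_ge0.
Qed.

Lemma step_law_sum : \sum_(o <- outcomes B) step_law o = 1.
Proof.
rewrite /step_law -mulr_suml /outcomes big_cons big_map /=.
by rewrite -mulr_suml divff // gt_eqF // mass_gt0.
Qed.

Lemma history_eventE os : history_event os =
  \bigcap_(b in [set` B]) grid_event (N b) h (size os)
    (fun j => (nth None os j == Some b)).
Proof.
apply/seteqP; split=> w /= hw; first by move=> b bB j js; apply: hw.
by move=> j js b bB; apply: (hw b bB).
Qed.

Lemma grid_event_clock b n k : sigma_of_process `[0, +oo[ (N b) (grid_event (N b) h n k).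
Proof.
apply: grid_event_sigma => // j jn /=.
by rewrite in_itv /= andbT mulr_ge0.
Qed.

Lemma history_event_clocks os :
  <<s \bigcup_(b in E) sigma_of_process `[0, +oo[ (N b) >> (history_event os).
Proof.
set G := \bigcup_(b in E) _.
suff : measurable (history_event os : set (g_sigma_algebraType G)) by [].
rewrite history_eventE; apply: fin_bigcap_measurable => // b bB.
apply: sub_sigma_algebra; exists b; first exact: BE.
exact: grid_event_clock.
Qed.

Lemma measurable_grid_event b n k : b \in B -> measurable (grid_event (N b) h n k).
Proof.
move=> bB; rewrite (_ : grid_event (N b) h n k = \bigcap_(j in [set j | (j < n)%N])
   [set w | subn (N b (j.+1%:R * h) w) (N b (j%:R * h) w) = k j]); last first.
  by apply/seteqP; split=> w /= hw j jn; apply: hw.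
apply: bigcap_measurableType => j jn.
have mN i t : 0 <= t -> measurable (N b t @^-1` [set i]).
  move=> t0; rewrite -[X in measurable X]setTI.
  exact: (poisson_measurable (clock_poisson hN (BE bB)) t0).
by apply: measurable_increment => i; apply: mN; rewrite mulr_ge0.
Qed.

Lemma measurable_history_event os : measurable (history_event os).
Proof.
rewrite history_eventE; apply: fin_bigcap_measurable => // b bB.
exact: measurable_grid_event.
Qed.

(** Independence of the bonds gives a product over the bonds of products over
    the steps. Exchanging the two products leaves one factor per step, because
    at most one bond contributes a factor other than the void probability. *)
Lemma history_eventP n os : os \in histories B n ->
  P (history_event os) = (step_mass ^+ n * weight step_law os)%:E.
Proof.
move=> osB; have sz := size_history osB.
rewrite history_eventE.
rewrite (clock_independent hN); last 2 first.
- by move=> b bB; exact: BE.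
- by move=> b bB; exact: grid_event_clock.
under eq_big_seq => b bB.
  rewrite (grid_eventP _ _ (clock_poisson hN (BE bB))) //.
  under eq_bigr => j _.
    rewrite poisson_prob01; last by rewrite mulr_ge0 // rate_ge0.
    over.
  rewrite prodEFin; over.
rewrite prodEFin; congr EFin.
rewrite exchange_big /= /weight (big_nth None) big_mkord sz.
rewrite -[X in step_mass ^+ X]card_ord -prodr_const -big_split /=.
apply: eq_bigr => j _; rewrite big_split /=.
rewrite -expR_sum sumrN -mulr_suml -/(total_rate).
rewrite /step_mass /step_law -mulrA; congr *%R.
rewrite mulrCA divff ?gt_eqF ?mass_gt0 // mulr1.
have : nth None os j \in os by rewrite mem_nth // sz.
case: nth => [b|] bos; last by rewrite big1_seq // => b _; rewrite eq_sym.
have bB := mem_history osB bos.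
rewrite (big_fsetD1 b) //= eqxx big1_seq ?mulr1 // => b' /andP[_].
by rewrite in_fsetD1 => /andP[b'b _]; case: eqP => // -[e]; rewrite e eqxx in b'b.
Qed.

Lemma uniq_histories n : uniq (histories B n).
Proof.
elim: n => // n IH; apply: allpairs_uniq_dep => //.
- rewrite /outcomes /= map_inj_uniq ?fset_uniq ?andbT; last by move=> ? ? [].
  by apply/mapP => -[].
- by move=> [q os] [q' os'] /= _ _ [-> ->].
Qed.

Lemma history_event_inj n os os' w : os \in histories B n -> os' \in histories B n ->
  history_event os w -> history_event os' w -> os = os'.
Proof.
move=> os1 os2 h1 h2; have s1 := size_history os1; have s2 := size_history os2.
apply: (@eq_from_nth _ None); first by rewrite s1 s2.
move=> j js.
have key b : b \in B -> (nth None os j == Some b) = (nth None os' j == Some b).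
  move=> bB; have k1 := h1 j js b bB.
  have js' : (j < size os')%N by rewrite s2 -s1.
  have k2 := h2 j js' b bB.
  by have := etrans (esym k1) k2; do 2! case: (_ == _).
have m1 : nth None os j \in os by rewrite mem_nth.
have m2 : nth None os' j \in os' by rewrite mem_nth // s2 -s1.
case e1 : (nth None os j) m1 => [b|] m1.
  by have := key _ (mem_history os1 m1); rewrite e1 eqxx => /esym/eqP.
case e2 : (nth None os' j) m2 => [b|] // m2.
by have := key _ (mem_history os2 m2); rewrite e1 e2 eqxx.
Qed.

(** The union runs over incompatible histories, each of which is independent of
    the initial configuration. Letting [A] depend on the history makes this the
    joint law of the initial configuration and the clocks. *)
Lemma history_lawP n (A : seq (option (set V)) -> set (config V)) :
  (forall os, measurable (A os)) ->
  P (\bigcup_(os in [set` histories B n])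
       (eta 0 @^-1` A os `&` history_event os)) =
  (\sum_(os <- histories B n)
     (step_mass ^+ n * weight step_law os)%:E * mu (A os))%E.
Proof.
move=> mA.
have meta0 os : measurable (eta 0 @^-1` A os).
  by rewrite -[X in measurable X]setTI; apply: (exclusion_measurable heta).
rewrite measure_fin_bigcup //; last 3 first.
- exact: finite_seq.
- apply/trivIsetP => os os' /= os1 os2 neq; apply/seteqP; split=> // w.
  by move=> [[_ h1] [_ h2]]; move: neq; rewrite (history_event_inj os1 os2 h1 h2) eqxx.
- by move=> os _; apply: measurableI => //; exact: measurable_history_event.
rewrite -fsbig_seq ?uniq_histories // big_seq [RHS]big_seq.
apply: eq_bigr => os osB.
have initial : exists2 C : set (config V), measurable C &
    eta 0 @^-1` C = eta 0 @^-1` A os by exists (A os).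
have := exclusion_initial_independent heta initial (history_event_clocks os).
move=> /= ->; rewrite (exclusion_initial_law heta) //.
by rewrite (history_eventP osB) muleC.
Qed.

Lemma step_mass_ge0 : 0 <= step_mass.
Proof. by rewrite mulr_ge0 ?expR_ge0 // ltW // mass_gt0. Qed.

Lemma step_mass_le1 : step_mass <= 1.
Proof.
rewrite /step_mass expRN mulrC ler_pdivrMr ?expR_gt0 // mul1r.
exact: expR_ge1Dx.
Qed.

Lemma step_mass_ge : 1 - (total_rate * h) ^+ 2 <= step_mass.
Proof.
have x0 : 0 <= total_rate * h by rewrite mulr_ge0 // total_rate_ge0.
set x := total_rate * h in x0 *.
have := expR_ge1Dx (- x); rewrite /step_mass -/x.
move: (expR (- x)) => e he; nra.
Qed.

(** A step fails with probability at most [(total_rate * h)^2], of second order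
    in the mesh, so refining the grid makes all steps succeed together. *)
Lemma good_ge n : total_rate * h <= 1 ->
  ((1 - n%:R * (total_rate * h) ^+ 2)%:E <=
   P (\bigcup_(os in [set` histories B n]) history_event os))%E.
Proof.
move=> h1; have := @history_lawP n (fun=> setT) (fun=> measurableT).
under eq_bigcupr do rewrite preimage_setT setTI.
move=> ->; under eq_bigr do rewrite probability_setT mule1.
rewrite sumEFin lee_fin -mulr_sumr weight_sum ?mulr1 ?step_law_sum //.
apply: (@le_trans _ _ ((1 - (total_rate * h) ^+ 2) ^+ n)).
  have x0 : 0 <= total_rate * h by rewrite mulr_ge0 // total_rate_ge0.
  set x := total_rate * h in h1 x0 *.
  have x2 : 0 <= 1 - x ^+ 2 by nra.
  elim: n => [|n IH]; first by rewrite expr0 mul0r subr0.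
  rewrite [leRHS]exprS -natr1.
  have := ler_wpM2l x2 IH.
  have : 0 <= n%:R * x ^+ 2 * x ^+ 2.
    by rewrite mulr_ge0 ?sqr_ge0 // mulr_ge0 ?sqr_ge0.
  set y := (1 - x ^+ 2) ^+ n; set z := n%:R; lra.
apply: lerXn2r; rewrite ?nnegrE ?step_mass_ge0 //; last exact: step_mass_ge.
have : 0 <= total_rate * h by rewrite mulr_ge0 // total_rate_ge0.
nra.
Qed.

End HistoryLaw.

(** * Unconditional sums *)

Section UnconditionalSums.
Context (R : realType) (T : choiceType).
Implicit Types (D : set T) (f g : T -> R) (F : {fset T}).

Lemma fset_sum_split (F1 F : {fset T}) f : {subset F1 <= F} ->
  \sum_(x <- F) f x =
  \sum_(x <- F1) f x + \sum_(x <- [fset x in F | x \notin F1]%fset) f x.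
Proof.
move=> s; rewrite (big_fsetID _ (mem F1)) /=; congr +%R.
by apply: eq_fbigl => x; rewrite !inE andb_idl // => /s.
Qed.

Lemma fset_sum_mono (F1 F : {fset T}) f : (forall x, 0 <= f x) ->
  {subset F1 <= F} -> \sum_(x <- F1) f x <= \sum_(x <- F) f x.
Proof. by move=> f0 s; rewrite (fset_sum_split _ s) lerDl sumr_ge0. Qed.

Lemma esum_approx D f (C : R) : (forall x, 0 <= f x) ->
  (forall F, [set` F] `<=` D -> \sum_(x <- F) f x <= C) ->
  exists s : R, [/\ \esum_(x in D) (f x)%:E = s%:E, s <= C,
    (forall F, [set` F] `<=` D -> \sum_(x <- F) f x <= s) &
    (forall e, 0 < e -> exists2 F : {fset T}, [set` F] `<=` D & s - e < \sum_(x <- F) f x)].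
Proof.
move=> f0 fC.
have sumE F : (\sum_(x \in [set` F]) (f x)%:E)%E = (\sum_(x <- F) f x)%:E.
  by rewrite -fsbig_seq ?fset_uniq // sumEFin.
have ub F : [set` F] `<=` D -> ((\sum_(x <- F) f x)%:E <= \esum_(x in D) (f x)%:E)%E.
  move=> FD; apply: esum_ge; exists [set` F]; first by split.
  by rewrite sumE.
have le_C : (\esum_(x in D) (f x)%:E <= C%:E)%E.
  apply: ge_ereal_sup => _ [X [finX XD] <-].
  have {1}-> : X = [set` fset_set X] by rewrite fset_setK.
  by rewrite sumE lee_fin fC // fset_setK.
have fin : \esum_(x in D) (f x)%:E \is a fin_num.
  rewrite ge0_fin_numE; first exact: le_lt_trans (ltry C).
  by apply: esum_ge0 => x _; rewrite lee_fin.
exists (fine (\esum_(x in D) (f x)%:E)); rewrite fineK //; split => //.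
- by rewrite -lee_fin fineK.
- by move=> F /ub; rewrite -lee_fin fineK.
- move=> e e0; have [_ [X [finX XD] <-] lt] := ub_ereal_sup_adherent e0 fin.
  exists (fset_set X); first by rewrite fset_setK.
  rewrite -lte_fin EFinB fineK // -sumE fset_setK //.
Qed.

Definition l1_bound D f (C : R) : Prop :=
  forall F, [set` F] `<=` D -> \sum_(x <- F) `|f x| <= C.

(** For an absolutely summable family the unconditional sum is a limit of finite
    sums; its linearity and monotonicity are read off from those. *)
Lemma rsum_approx D f C : l1_bound D f C -> forall e, 0 < e ->
  exists2 F0 : {fset T}, [set` F0] `<=` D &
   forall F, [set` F] `<=` D -> {subset F0 <= F} ->
     `|\sum_(x <- F) f x - rsum D f| <= e.
Proof.
move=> fC e e0.
pose fp x := Num.max (f x) 0; pose fn x := Num.max (- f x) 0.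
have fp0 x : 0 <= fp x by rewrite /fp le_max lexx orbT.
have fn0 x : 0 <= fn x by rewrite /fn le_max lexx orbT.
have fpf x : fp x <= `|f x| by rewrite /fp ge_max ler_norm normr_ge0.
have fnf x : fn x <= `|f x| by rewrite /fn ge_max -normrN ler_norm normr_ge0.
have fE x : f x = fp x - fn x.
  by rewrite /fp /fn /Num.max; case: ltP => ?; case: ltP => ?; lra.
have [|sp [esp _ ubp adp]] := @esum_approx D fp C fp0.
  by move=> F /fC; apply: le_trans; apply: ler_sum.
have [|sn [esn _ ubn adn]] := @esum_approx D fn C fn0.
  by move=> F /fC; apply: le_trans; apply: ler_sum.
have [Fp FpD ltp] := adp _ e0; have [Fn FnD ltn] := adn _ e0.
exists (Fp `|` Fn)%fset.
  by move=> x /=; rewrite in_fsetU => /orP[/FpD|/FnD].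
move=> F FD sub; have -> : rsum D f = sp - sn by rewrite /rsum esp esn.
have hp : \sum_(x <- Fp) fp x <= \sum_(x <- F) fp x.
  by apply: fset_sum_mono => // x xF; apply: sub; rewrite in_fsetU xF.
have hn : \sum_(x <- Fn) fn x <= \sum_(x <- F) fn x.
  by apply: fset_sum_mono => // x xF; apply: sub; rewrite in_fsetU xF orbT.
have := ubp F FD; have := ubn F FD.
have -> : \sum_(x <- F) f x = \sum_(x <- F) fp x - \sum_(x <- F) fn x.
  by rewrite -sumrB; apply: eq_bigr.
rewrite ler_norml; move: hp hn ltp ltn.
set a1 := \sum_(x <- Fp) _; set a2 := \sum_(x <- Fn) _.
set a3 := \sum_(x <- F) fp x; set a4 := \sum_(x <- F) fn x.
by move=> *; apply/andP; split; lra.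
Qed.

Lemma rsum_dist_le f g C1 C2 C : l1_bound setT f C1 -> l1_bound setT g C2 ->
  l1_bound setT (f \- g) C -> `|rsum setT f - rsum setT g| <= C.
Proof.
move=> hf hg hfg; apply/ler_addgt0Pr => e e0.
have e2 : 0 < e / 2 by rewrite divr_gt0.
have [F1 _ h1] := rsum_approx hf e2.
have [F2 _ h2] := rsum_approx hg e2.
have {}h1 := h1 (F1 `|` F2)%fset (@subsetT _ _) (fun x xF => ltac:(by rewrite in_fsetU xF)).
have {}h2 := h2 (F1 `|` F2)%fset (@subsetT _ _) (fun x xF => ltac:(by rewrite in_fsetU xF orbT)).
have h3 := hfg (F1 `|` F2)%fset (@subsetT _ _).
have h4 := ler_norm_sum (F1 `|` F2)%fset (f \- g) predT.
have {h4}h3 := le_trans h4 h3.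
move: h1 h2 h3; rewrite /= sumrB !ler_norml.
set s1 := \sum_(x <- _) f x; set s2 := \sum_(x <- _) g x.
by move=> *; apply/andP; split; lra.
Qed.

Lemma rsum_finite D f F : [set` F] `<=` D -> (forall x, D x -> x \notin F -> f x = 0) ->
  rsum D f = \sum_(x <- F) f x.
Proof.
move=> FD f0.
have sumF (g : T -> R) (F' : {fset T}) : (forall x, D x -> x \notin F -> g x = 0) ->
    [set` F'] `<=` D -> {subset F <= F'} -> \sum_(x <- F') g x = \sum_(x <- F) g x.
  move=> g0 F'D s; rewrite (fset_sum_split _ s) [X in _ + X]big1_seq ?addr0 //.
  by move=> x /andP[_]; rewrite !inE /= => /andP[/F'D xD xF]; rewrite g0.
have l1 : l1_bound D f (\sum_(x <- F) `|f x|).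
  move=> F' F'D; rewrite -(@sumF (fun x => `|f x|) (F' `|` F)%fset).
  - by apply: fset_sum_mono => // x xF; rewrite in_fsetU xF.
  - by move=> x xD xF; rewrite f0 // normr0.
  - by move=> x /=; rewrite in_fsetU => /orP[/F'D|/FD].
  - by move=> x xF; rewrite in_fsetU xF orbT.
apply/eqP; rewrite -subr_eq0 -normr_le0; apply/ler_addgt0Pr => e e0; rewrite add0r.
have [F1 F1D /(_ (F1 `|` F)%fset)] := rsum_approx l1 e0.
rewrite distrC (sumF f) //.
- by apply => x xF; rewrite ?in_fsetU ?xF //; move: xF => /=; rewrite in_fsetU => /orP[/F1D|/FD].
- by move=> x /=; rewrite in_fsetU => /orP[/F1D|/FD].
- by move=> x xF; rewrite in_fsetU xF orbT.
Qed.

End UnconditionalSums.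

(** * Transition probabilities of the walk *)

Lemma cvg_seq_sum (R : realType) (I : eqType) (T : Type) (F : set_system T)
    (FF : Filter F) (r : seq I) (f : I -> T -> R) (a : I -> R) :
  (forall i, i \in r -> f i x @[x --> F] --> a i) ->
  \sum_(i <- r) f i x @[x --> F] --> \sum_(i <- r) a i.
Proof.
elim: r => [|i r IH] fa.
  by rewrite big_nil; under eq_cvg do rewrite big_nil; exact: cvg_cst.
rewrite big_cons; under eq_cvg do rewrite big_cons.
apply: cvgD; first by apply: fa; rewrite mem_head.
by apply: IH => j jr; apply: fa; rewrite inE jr orbT.
Qed.

Section WalkKernel.
Context (R : realType) (V : choiceType) (d : measure_display)
  (Om : measurableType d) (P : probability Om R).
Variables (E : set (set V)) (bn : R) (c : set V -> R) (Y : V -> R -> Om -> V).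
Hypothesis bn0 : 0 < bn.
Hypothesis c0 : forall b, E b -> 0 <= c b.
Hypothesis hE : unoriented_graph E.
Hypothesis hY : random_walk P (walk_generator bn E c) Y.
Implicit Types (x y z : V) (s t : R) (F : {fset V}).

Definition transition t x y : R := fine (P [set w | Y x t w = y]).

Definition dirac_at y : V -> R := fun x => (x == y)%:R.

Lemma transitionE t x y : 0 <= t ->
  P [set w | Y x t w = y] = (transition t x y)%:E.
Proof.
move=> t0; rewrite /transition fineK // fin_num_measure //.
exact: (walk_measurable hY).
Qed.

Lemma transition_ge0 t x y : 0 <= transition t x y.
Proof. by rewrite fine_ge0. Qed.

Lemma transition_sum_le1 t x F : 0 <= t -> \sum_(y <- F) transition t x y <= 1.
Proof.
move=> t0; rewrite -lee_fin -sumEFin.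
under eq_bigr do rewrite -transitionE //.
rewrite fsbig_seq ?fset_uniq // -measure_fin_bigcup //.
- by apply: probability_le1; apply: fin_bigcup_measurable => // y _; exact: (walk_measurable hY).
- by apply/trivIsetP => y z _ _ yz; apply/seteqP; split=> // w [/= e1 e2]; move: yz; rewrite -e1 e2 eqxx.
- by move=> y _; exact: (walk_measurable hY).
Qed.

Lemma transition0 x : transition 0 x x = 1.
Proof.
have := walk_start hY x; rewrite /transition => h.
have -> : P [set w | Y x 0 w = x] = 1%E; last by [].
have mx : measurable [set w | Y x 0 w = x] by exact: (walk_measurable hY).
have := probability_setC P mx; rewrite (measure_negligible _ h) //; last exact: measurableC.
move=> e; rewrite -[LHS]fineK ?fin_num_measure //; congr EFin.
apply/eqP; rewrite eq_sym -subr_eq0; apply/eqP.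
by have := congr1 fine e; rewrite fineB ?fin_num_measure.
Qed.

Lemma transition_semigroup_ge s t x z F : 0 <= s -> 0 <= t ->
  \sum_(y <- F) transition s x y * transition t y z <= transition (s + t) x z.
Proof.
move=> s0 t0; rewrite -lee_fin -sumEFin -transitionE ?addr_ge0 //.
have mY u v w : 0 <= u -> measurable [set om | Y v u om = w].
  by move=> u0; exact: (walk_measurable hY).
have -> : (\sum_(y <- F) (transition s x y * transition t y z)%:E =
    \sum_(y <- F) P ([set w | Y x s w = y] `&` [set w | Y x (s + t) w = z]))%E.
  apply: eq_bigr => y _.
  have := @walk_markov _ _ _ _ _ _ _ hY x y z s t [::] s0 t0 (fun e => ltac:(by [])).
  rewrite (_ : [set w | forall e, _ -> _] = setT) ?setIT ?setTI; last first.
    by apply/seteqP; split.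
  by move=> /= h; rewrite !setTI in h; rewrite h EFinM !transitionE.
rewrite fsbig_seq ?fset_uniq // -measure_fin_bigcup //.
- apply: le_measure; rewrite ?inE.
  + apply: fin_bigcup_measurable => // y _; apply: measurableI; apply: mY => //.
    exact: addr_ge0.
  + by apply: mY; exact: addr_ge0.
  + by move=> w [y _ []].
- by apply/trivIsetP => y y' _ _ yz; apply/seteqP; split=> // w [[/= e1 _] [/= e2 _]]; move: yz; rewrite -e1 e2 eqxx.
- by move=> y _; apply: measurableI; apply: mY => //; exact: addr_ge0.
Qed.

Lemma semigroup_transition t (f : V -> R) F x : 0 <= t ->
  (forall y, y \notin F -> f y = 0) ->
  semigroup P Y t f x = \sum_(y <- F) f y * transition t x y.
Proof.
move=> t0 f0; rewrite /semigroup unlock.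
have mY y : measurable [set w | Y x t w = y] by exact: (walk_measurable hY).
have -> : (\int[P]_w (f (Y x t w))%:E =
  \int[P]_w (\sum_(y <- F) (f y)%:E * (\1_([set w | Y x t w = y]) w)%:E))%E.
  apply: eq_integral => w _; case: (boolP (Y x t w \in F)) => hw.
    rewrite (big_fsetD1 (Y x t w)) //= big1_seq ?adde0.
      by rewrite indicE mem_set // mule1.
    move=> y /andP[_]; rewrite in_fsetD1 => /andP[yw _].
    by rewrite indicE memNset ?mule0 // => /= e; move: yw; rewrite e eqxx.
  rewrite f0 // big1_seq // => y /andP[_ yF].
  by rewrite indicE memNset ?mule0 // => /= e; move: hw; rewrite e yF.
rewrite integral_sum //; last first.
  by move=> y; apply: integrableZl => //; exact: integrable_indic.
have iE y : (\int[P]_w ((f y)%:E * (\1_([set w | Y x t w = y]) w)%:E) =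
    (f y * transition t x y)%:E)%E.
  rewrite integralZl //; last exact: integrable_indic.
  rewrite integral_indic // setIT EFinM; congr (_ * _)%E; exact: transitionE.
by under eq_bigr do rewrite iE; rewrite sumEFin.
Qed.

Definition jump_rate x y : R := if `[< E [set x; y] >] then bn * c [set x; y] else 0.

Definition escape_rate x : R :=
  - (walk_generator bn E c (dirac_at x) x).

Lemma jump_rate_ge0 x y : 0 <= jump_rate x y.
Proof.
by rewrite /jump_rate; case: asboolP => // h; rewrite mulr_ge0 ?(ltW bn0) ?c0.
Qed.

Lemma transition_derivative x y :
  t^-1 * (transition t x y - dirac_at y x) @[t --> 0^'+] -->
    walk_generator bn E c (dirac_at y) x.
Proof.
have fin : finite_set [set z | dirac_at y z != 0].
  apply: (@sub_finite_set _ _ [set y]) => // z /=; rewrite /dirac_at.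
  by case: (eqVneq z y) => //; rewrite eqxx.
have := @walk_derivative _ _ _ _ _ _ _ hY _ fin x; apply: cvg_trans; apply: near_eq_cvg.
near=> t; have t0 : 0 < t by near: t; exact: nbhs_right_gt.
rewrite (@semigroup_transition _ _ [fset y]%fset) ?(ltW t0) //.
  by rewrite big_seq_fset1 /dirac_at eqxx mul1r.
by move=> z; rewrite inE /dirac_at => /negbTE ->.
Unshelve. all: by end_near. Qed.

Lemma no_loop x : ~ E [set x; x].
Proof.
move=> /hE [y [z [yz e]]].
have h u : [set y; z] u -> u = x by rewrite -e => -[].
by move: yz; rewrite (h y (or_introl erefl)) (h z (or_intror erefl)) eqxx.
Qed.

Lemma generator_offdiag x y : x != y ->
  walk_generator bn E c (dirac_at y) x = jump_rate x y.
Proof.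
move=> xy; rewrite /walk_generator /jump_rate.
case: asboolP => Exy.
  rewrite (@rsum_finite _ _ _ _ [fset y]%fset).
  - by rewrite big_seq_fset1 /dirac_at eqxx (negbTE xy) subr0 mulr1.
  - by move=> z /=; rewrite inE => /eqP->.
  - move=> z _; rewrite inE /dirac_at => /negbTE ->.
    by rewrite (negbTE xy) subrr mulr0.
rewrite (@rsum_finite _ _ _ _ fset0) ?big_seq_fset0 ?mulr0 //.
move=> z /= Exz _; have zy : z != y by apply/eqP => e; apply: Exy; rewrite -e.
by rewrite /dirac_at (negbTE zy) (negbTE xy) subrr mulr0.
Qed.

(** The rates out of [x] have a finite sum even if [x] has infinitely many
    neighbours: the mass [1 - p_t(x, x)] that leaves [x] dominates the mass that
    reaches finitely many neighbours, and both are differentiable at 0. *)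
Lemma jump_rate_sum_le x F : x \notin F -> \sum_(y <- F) jump_rate x y <= escape_rate x.
Proof.
move=> xF.
have h1 : - (t^-1 * (transition t x x - dirac_at x x)) @[t --> 0^'+] --> escape_rate x.
  by apply: cvgN; exact: transition_derivative.
have h2 : \sum_(y <- F) t^-1 * (transition t x y - dirac_at y x) @[t --> 0^'+] -->
    \sum_(y <- F) jump_rate x y.
  apply: cvg_seq_sum => y yF; rewrite -generator_offdiag; first exact: transition_derivative.
  by apply/eqP => e; move: xF; rewrite e yF.
apply: (ler_cvg_to h2 h1); near=> t.
have t0 : 0 < t by near: t; exact: nbhs_right_gt.
rewrite -mulrN -mulr_sumr ler_wpM2l ?invr_ge0 ?(ltW t0) //.
rewrite {2}/dirac_at eqxx opprB lerBrDl.
have := @transition_sum_le1 t x (x |` F)%fset (ltW t0).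
rewrite big_fsetU1 //=; apply: le_trans; rewrite lerD2l big_seq [leRHS]big_seq.
apply: ler_sum => y yF; rewrite /dirac_at; case: eqVneq => [e|_]; last by rewrite subr0.
by move: xF; rewrite e yF.
Unshelve. all: by end_near. Qed.

(** Summability makes the sum in the generator meaningful, so that the diagonal
    entry of the generator is the total rate out of [x]. *)
Lemma escape_rate_approx x e : 0 < e ->
  exists2 F : {fset V}, [set` F] `<=` [set y | E [set x; y]] &
    escape_rate x - e < \sum_(y <- F) jump_rate x y.
Proof.
move=> e0.
pose f y := c [set x; y] * (if `[< E [set x; y] >] then 1 else 0).
pose D := [set y | E [set x; y]].
have f0 y : 0 <= f y.
  by rewrite /f; case: asboolP => h; rewrite ?mulr1 ?mulr0 ?c0.
have jE y : jump_rate x y = bn * f y.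
  by rewrite /jump_rate /f; case: asboolP => _; rewrite ?mulr1 ?mulr0.
have fD F : [set` F] `<=` D -> \sum_(y <- F) f y <= bn^-1 * escape_rate x.
  move=> FD; rewrite -(ler_pM2l bn0) mulrA divff ?gt_eqF // mul1r mulr_sumr.
  apply: le_trans (@jump_rate_sum_le x F _); first by apply: ler_sum => y _; rewrite jE.
  by apply/negP => /FD; exact: no_loop.
have [s [es _ _ ad]] := esum_approx f0 fD.
have escE : escape_rate x = bn * s.
  rewrite /escape_rate /walk_generator -mulrN; congr *%R.
  rewrite /rsum opprB.
  rewrite [X in _ - fine X]esum1 /= ?subr0; last first.
    move=> y /= Exy; have yx : y != x by apply/eqP => eyx; rewrite eyx in Exy; exact: no_loop Exy.
    rewrite /dirac_at eqxx (negbTE yx) sub0r mulrN1; congr EFin.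
    by apply/max_idPr; rewrite oppr_le0; exact: c0.
  rewrite (@eq_esum _ _ _ _ (fun y => (f y)%:E)) ?es // => y /= Exy.
  have yx : y != x by apply/eqP => eyx; rewrite eyx in Exy; exact: no_loop Exy.
  rewrite /dirac_at eqxx (negbTE yx) sub0r mulrN1 opprK /f.
  case: asboolP => // _; rewrite mulr1; congr EFin; apply/max_idPl; exact: c0.
have [F FD lt] := ad (bn^-1 * e) (ltac:(by rewrite mulr_gt0 ?invr_gt0)).
exists F => //; rewrite (eq_bigr _ (fun y _ => jE y)) -mulr_sumr escE.
move: lt; rewrite -(ltr_pM2l bn0) mulrBr mulrA divff ?gt_eqF //.
by rewrite mul1r.
Qed.

End WalkKernel.

(** * Kernels killed outside a finite set *)

Section Killed.
Context (R : realType) (V : choiceType).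
Implicit Types (S : {fset V}) (k : V -> V -> R) (h : V -> R) (x y v : V).

Definition killed k S h x : R := \sum_(y <- S) k x y * h y.

Lemma killed_iter_bound S k n h (C : R) :
  (forall x y, x \in S -> 0 <= k x y) ->
  (forall x, x \in S -> \sum_(y <- S) k x y <= 1) ->
  (forall x, x \in S -> `|h x| <= C) ->
  forall x, x \in S -> `|iter n (killed k S) h x| <= C.
Proof.
move=> k0 k1 hC; elim: n => [|n IH] x xS //=; first exact: hC.
apply: le_trans (ler_norm_sum _ _ _) _.
apply: (@le_trans _ _ (\sum_(y <- S) k x y * C)).
  rewrite big_seq [leRHS]big_seq; apply: ler_sum => y yS.
  by rewrite normrM (ger0_norm (k0 x y xS)) ler_wpM2l ?k0 ?IH.
have C0 : 0 <= C by apply: le_trans (hC x xS); exact: normr_ge0.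
by rewrite -mulr_suml ler_piMl ?k1.
Qed.

(** The factors are exchanged one at a time; each exchange costs the one-step
    distance, because the remaining factors are contractions for the sup norm. *)
Lemma killed_iter_dist S k1 k2 n h (e C : R) :
  (forall x y, x \in S -> 0 <= k1 x y) ->
  (forall x, x \in S -> \sum_(y <- S) k1 x y <= 1) ->
  (forall x y, x \in S -> 0 <= k2 x y) ->
  (forall x, x \in S -> \sum_(y <- S) k2 x y <= 1) ->
  (forall x, x \in S -> \sum_(y <- S) `|k1 x y - k2 x y| <= e) ->
  0 <= C -> (forall x, x \in S -> `|h x| <= C) ->
  forall x, x \in S ->
    `|iter n (killed k1 S) h x - iter n (killed k2 S) h x| <= n%:R * e * C.
Proof.
move=> k10 k11 k20 k21 k12 C0 hC; elim: n => [|n IH] x xS /=.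
  by rewrite subrr normr0 !mul0r.
set u1 := iter n _ h in IH *; set u2 := iter n _ h in IH *.
have -> : killed k1 S u1 x - killed k2 S u2 x =
    \sum_(y <- S) k1 x y * (u1 y - u2 y) + \sum_(y <- S) (k1 x y - k2 x y) * u2 y.
  by rewrite /killed -sumrB -big_split /=; apply: eq_bigr => y _; ring.
apply: le_trans (ler_normD _ _) _.
rewrite -natr1 mulrDl mulrDl mul1r lerD //.
  apply: le_trans (ler_norm_sum _ _ _) _.
  apply: (@le_trans _ _ (\sum_(y <- S) k1 x y * (n%:R * e * C))).
    rewrite big_seq [leRHS]big_seq; apply: ler_sum => y yS.
    by rewrite normrM (ger0_norm (k10 x y xS)) ler_wpM2l ?k10 ?IH.
  have e0 : 0 <= e by apply: le_trans (k12 x xS); apply: sumr_ge0.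
  by rewrite -mulr_suml ler_piMl ?k11 // !mulr_ge0.
apply: le_trans (ler_norm_sum _ _ _) _.
apply: (@le_trans _ _ (\sum_(y <- S) `|k1 x y - k2 x y| * C)).
  rewrite big_seq [leRHS]big_seq; apply: ler_sum => y yS.
  by rewrite normrM ler_wpM2l //; apply: killed_iter_bound.
by rewrite -mulr_suml ler_wpM2r // k12.
Qed.

Fixpoint stays S (os : seq (option (set V))) v : bool :=
  if os is o :: os' then stays S os' v && (trace os v \in S) else v \in S.

Lemma staysP S os v :
  (forall j, (j <= size os)%N -> trace (drop j os) v \in S) -> stays S os v.
Proof.
elim: os => [|o os IH] hj /=; first exact: (hj 0%N).
by rewrite IH => [|j js]; [exact: (hj 0%N)|exact: (hj j.+1)].
Qed.

Lemma stays_sub S S' os v : {subset S <= S'} -> stays S os v -> stays S' os v.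
Proof.
move=> SS'; elim: os => [|o os IH] /=; first exact: SS'.
by move=> /andP[/IH -> /SS' ->].
Qed.

Lemma stays_trace S os v : stays S os v -> trace os v \in S.
Proof. by case: os => [|o os] //= /andP[]. Qed.

Section Average.
Variables (B : {fset set V}) (p : option (set V) -> R).
Hypothesis p_ge0 : forall o, o \in outcomes B -> 0 <= p o.
Hypothesis p_sum : \sum_(o <- outcomes B) p o = 1.

Definition average_kernel x y : R := average B p (@dirac_at R V y) x.

Lemma average_kernel_ge0 x y : 0 <= average_kernel x y.
Proof.
rewrite /average_kernel /average big_seq sumr_ge0 // => o oO.
by rewrite mulr_ge0 ?p_ge0.
Qed.

Lemma average_restrict S h x :
  average B p (fun z => if z \in S then h z else 0) x =
  \sum_(y <- S) average_kernel x y * h y.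
Proof.
rewrite /average_kernel /average.
under [RHS]eq_bigr do rewrite mulr_suml.
rewrite exchange_big /=; apply: eq_bigr => o _.
case: ifP => hS.
  rewrite (big_fsetD1 (oswap o x)) //= /dirac_at eqxx mulr1 big1_seq ?addr0 //.
  by move=> y /andP[_]; rewrite in_fsetD1 eq_sym => /andP[/negbTE ->]; rewrite mulr0 mul0r.
rewrite mulr0 big1_seq // => y /andP[_ yS]; rewrite /dirac_at.
by case: eqP => [e|]; [move: hS; rewrite e yS|rewrite mulr0 mul0r].
Qed.

Lemma average_kernel_sum_le1 x S : \sum_(y <- S) average_kernel x y <= 1.
Proof.
have := average_restrict S (fun=> 1) x; under eq_bigr do rewrite mulr1.
move=> <-; rewrite -[leRHS]p_sum /average big_seq [leRHS]big_seq; apply: ler_sum => o oO.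
by case: ifP => _; rewrite ?mulr1 ?mulr0 ?lexx ?p_ge0.
Qed.

Lemma average_iter_ge0 n h x : (forall y, 0 <= h y) -> 0 <= iter n (average B p) h x.
Proof.
move=> h0; elim: n x => //= n IH x; rewrite /average big_seq sumr_ge0 // => o oO.
by rewrite mulr_ge0 ?p_ge0.
Qed.

Lemma average_iter_mass n x S :
  \sum_(y <- S) iter n (average B p) (@dirac_at R V y) x <= 1.
Proof.
under eq_bigr do rewrite -average_trace.
rewrite exchange_big /= -(weight_sum p_sum n) big_seq [leRHS]big_seq.
apply: ler_sum => os osB; rewrite -mulr_sumr ler_piMr ?(weight_ge0 p_ge0 osB) //.
rewrite /dirac_at; case: (boolP (trace os x \in S)) => hS.
  rewrite (big_fsetD1 (trace os x)) //= eqxx big1_seq ?addr0 //.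
  by move=> y /andP[_]; rewrite in_fsetD1 eq_sym => /andP[/negbTE ->].
rewrite big1_seq // => y /andP[_ yS].
by case: eqP => // e; move: hS; rewrite e yS.
Qed.

(** The histories whose partial compositions keep [v] in [S] contribute the
    powers of the kernel killed outside [S]. *)
Lemma stays_sum n S h v : v \in S ->
  \sum_(os <- histories B n | stays S os v) weight p os * h (trace os v) =
  iter n (killed average_kernel S) h v.
Proof.
move=> vS; elim: n h => [|n IH] h.
  by rewrite big_mkcond big_seq1 /= vS /weight big_nil mul1r.
rewrite iterSr -IH big_mkcond sum_histories exchange_big /= [RHS]big_mkcond /=.
apply: eq_bigr => os _; case: ifP => /= hs; last by rewrite big1.
rewrite /killed -average_restrict /average mulr_sumr; apply: eq_bigr => o _.
by rewrite weight_cons; case: ifP => _; [ring|rewrite !mulr0].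
Qed.

Lemma killed_le_average n S v y : v \in S -> 
  iter n (killed average_kernel S) (@dirac_at R V y) v <=
  iter n (average B p) (@dirac_at R V y) v.
Proof.
move=> vS; rewrite -stays_sum // -average_trace big_mkcond big_seq [leRHS]big_seq.
apply: ler_sum => os osB; case: ifP => // _.
by rewrite mulr_ge0 ?(weight_ge0 p_ge0 osB).
Qed.

(** Both [pt] and the power of the unkilled kernel have mass at most 1 and lie
    above the power of the killed kernel, [pt] up to [e]. As this common lower
    bound has mass at least [1 - a], each of them exceeds it by little mass. *)
Lemma total_variation_le n S v (pt : V -> R) (a e : R) (F : {fset V}) :
  v \in S -> (forall y, 0 <= pt y) ->
  (forall G : {fset V}, \sum_(y <- G) pt y <= 1) -> 0 <= e ->
  (forall y, y \in S ->
     iter n (killed average_kernel S) (@dirac_at R V y) v - e <= pt y) ->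
  1 - a <= \sum_(os <- histories B n | stays S os v) weight p os ->
  \sum_(y <- F) `|iter n (average B p) (@dirac_at R V y) v - pt y| <=
    2 * a + 2 * (#|` S|%:R * e).
Proof.
move=> vS pt0 pt1 e0 low mass.
pose G := (F `|` S)%fset.
pose q y := iter n (average B p) (@dirac_at R V y) v.
pose k y := if y \in S then iter n (killed average_kernel S) (@dirac_at R V y) v else 0.
apply: (@le_trans _ _ (\sum_(y <- G) `|q y - pt y|)).
  by apply: fset_sum_mono => // y yF; rewrite in_fsetU yF.
have kq y : k y <= q y.
  rewrite /k; case: ifP => _; first exact: killed_le_average.
  exact: average_iter_ge0.
have klow y : k y - e * (y \in S)%:R <= pt y.
  by rewrite /k; case: ifP => yS; rewrite ?mulr1 ?mulr0 ?subr0 ?low.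
have sub : {subset S <= G} by move=> y yS; rewrite in_fsetU yS orbT.
have sumk : \sum_(y <- G) k y = \sum_(os <- histories B n | stays S os v) weight p os.
  rewrite (fset_sum_split _ sub) [X in _ + X]big1_seq ?addr0; last first.
    by move=> y /andP[_]; rewrite !inE /= /k => /andP[_ /negbTE ->].
  rewrite (eq_big_seq (fun y => \sum_(os <- histories B n | stays S os v)
      weight p os * @dirac_at R V y (trace os v))); last first.
    by move=> y yS; rewrite /k yS -stays_sum.
  rewrite exchange_big /=; apply: eq_bigr => os st.
  rewrite (big_fsetD1 (trace os v)) ?stays_trace //= /dirac_at eqxx mulr1.
  rewrite big1_seq ?addr0 // => y /andP[_]; rewrite in_fsetD1 eq_sym.
  by move=> /andP[/negbTE ->]; rewrite mulr0.
have sumS : \sum_(y <- G) e * (y \in S)%:R = #|` S|%:R * e.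
  rewrite (fset_sum_split _ sub) [X in _ + X]big1_seq ?addr0; last first.
    by move=> y /andP[_]; rewrite !inE /= => /andP[_ /negbTE ->]; rewrite mulr0.
  rewrite (eq_big_seq (fun=> e)); last by move=> y ->; rewrite mulr1.
  by rewrite big_const_seq count_predT iter_addr_0 cardfE mulr_natl -cardfE.
apply: (@le_trans _ _ (\sum_(y <- G) (q y + pt y - 2 * k y + 2 * (e * (y \in S)%:R)))).
  apply: ler_sum => y _; have := kq y; have := klow y.
  have : 0 <= e * (y \in S)%:R by rewrite mulr_ge0.
  by rewrite ler_norml => *; apply/andP; split; lra.
have k2 : \sum_(y <- G) 2 * k y = 2 * \sum_(y <- G) k y by rewrite mulr_sumr.
have S2 : \sum_(y <- G) 2 * (e * (y \in S)%:R) = 2 * \sum_(y <- G) e * (y \in S)%:R.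
  by rewrite mulr_sumr.
rewrite big_split /= sumrB big_split /= k2 S2 sumk sumS.
have := pt1 G; have := average_iter_mass n v G; rewrite -/q.
move: mass; set m1 := \sum_(os <- _ | _) _; set m2 := \sum_(y <- _) q _.
set m3 := \sum_(y <- G) pt y; set c := #|` S|%:R * e; lra.
Qed.

End Average.
End Killed.

(** * Comparison of the walk with the finite exchange dynamics *)

Section Bonds.
Context (V : choiceType).
Variables (E : set (set V)).
Hypothesis hE : unoriented_graph E.
Implicit Types (S : {fset V}).

Definition bonds S : {fset set V} := fset_set [set b | E b /\ b `<=` [set` S]].

Lemma mem_bonds S b : (b \in bonds S) <-> (E b /\ b `<=` [set` S]).
Proof.
have fin : finite_set [set b | E b /\ b `<=` [set` S]].
  apply: (@sub_finite_set _ _ ((fun p : V * V => [set p.1; p.2]) @` ([set` S] `*` [set` S]))).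
    move=> b' /= [Eb bS]; have [x [y [_ e]]] := hE Eb.
    by exists (x, y) => //=; split; apply: bS; rewrite e; [left|right].
  by apply: finite_image; apply: finite_setX.
by rewrite /bonds in_fset_set // inE.
Qed.

Lemma bonds_E S b : b \in bonds S -> E b.
Proof. by move=> /mem_bonds[]. Qed.

Lemma bonds_in S b x : b \in bonds S -> b x -> x \in S.
Proof. by move=> /mem_bonds[_ bS] /bS. Qed.

Lemma eventually_fset (T : choiceType) (F : {fset T}) (Q : T -> nat -> Prop) :
  (forall x, x \in F -> exists m0, forall m, (m0 <= m)%N -> Q x m) ->
  exists m0, forall m, (m0 <= m)%N -> forall x, x \in F -> Q x m.
Proof.
move=> h.
suff : forall s : seq T, (forall x, x \in s -> exists m0, forall m, (m0 <= m)%N -> Q x m) ->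
    exists m0, forall m, (m0 <= m)%N -> forall x, x \in s -> Q x m by apply.
elim=> [|x s IH] hs; first by exists 0%N.
have [m1 h1] := hs x (mem_head _ _).
have [|m2 h2] := IH; first by move=> y ys; apply: hs; rewrite inE ys orbT.
exists (maxn m1 m2) => m; rewrite geq_max => /andP[hm1 hm2] y.
by rewrite inE => /orP[/eqP ->|]; [exact: h1|exact: h2].
Qed.

Lemma exhaustion_eventually (Lam : nat -> {fset V}) (F : {fset V}) :
  (forall m m', (m <= m')%N -> {subset Lam m <= Lam m'}) ->
  (forall x, exists m, x \in Lam m) ->
  exists m0, forall m, (m0 <= m)%N -> {subset F <= Lam m}.
Proof.
move=> mono cover; apply: eventually_fset => x _; have [m hm] := cover x.
by exists m => m' mm'; apply: mono mm' _ hm.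
Qed.

End Bonds.

Section KernelDerivative.
Context (R : realType) (V : choiceType) (d : measure_display)
  (Om : measurableType d) (P : probability Om R).
Variables (E : set (set V)) (bn : R) (c : set V -> R) (Y : V -> R -> Om -> V).
Hypothesis bn0 : 0 < bn.
Hypothesis c0 : forall b, E b -> 0 <= c b.
Hypothesis hE : unoriented_graph E.
Hypothesis hY : random_walk P (walk_generator bn E c) Y.
Variable L : {fset V}.
Implicit Types (x y z : V) (s : R).

Let B := bonds E L.
Let k s := average_kernel B (step_law bn c B s).
Let lam := total_rate bn c B.

Definition local_rate x : R :=
  \sum_(b <- B) rate bn c b * (swap b x != x)%:R.

Lemma local_rateE x : x \in L -> exists F : {fset V},
  [/\ local_rate x = \sum_(y <- F) jump_rate E bn c x y, x \notin F &
      forall y, y \in L -> E [set x; y] -> y \in F].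
Proof.
move=> xL.
pose B' := [fset b in B | swap b x != x]%fset.
exists [fset swap b x | b in B']%fset.
have swE b : b \in B' -> b = [set x; swap b x] /\ E b.
  rewrite !inE /= => /andP[bB bx]; case: (swap_case b x) => [e|[_ e]].
    by move: bx; rewrite e eqxx.
  split; first by []; exact: (bonds_E hE bB).
split.
- rewrite big_imfset /=; last first.
    by move=> b1 b2 /swE[e1 _] /swE[e2 _] e; rewrite e1 e2 e.
  rewrite /local_rate (big_fsetID _ (fun b => swap b x != x)) /= [X in _ + X]big1_seq ?addr0.
    apply: eq_big_seq => b bB'; have [e Eb] := swE b bB'.
    have : b \in B' by []. rewrite !inE /= => /andP[_ ->]; rewrite mulr1 /jump_rate -e.
    by case: asboolP.
  by move=> b /andP[_]; rewrite !inE /= => /andP[_ /negPn/eqP ->]; rewrite eqxx mulr0.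
- apply/negP => /imfsetP[b /= ]; rewrite !inE /= => /andP[_ h] e.
  by move: h; rewrite -e eqxx.
- move=> y yL Exy; have xy : x != y by apply/eqP => e; rewrite e in Exy; exact: (no_loop hE Exy).
  apply/imfsetP; exists [set x; y]; last by rewrite swap_pair.
  rewrite !inE /= swap_pair // eq_sym xy andbT; apply/(mem_bonds hE).
  by split=> // z [] ->.
Qed.

Lemma local_rate_le x : x \in L -> local_rate x <= escape_rate E bn c x.
Proof.
move=> xL; have [F [-> xF _]] := local_rateE xL.
exact: (jump_rate_sum_le hY).
Qed.

Lemma local_rate_ge x (F : {fset V}) : x \in L ->
  (forall y, y \in F -> y \in L /\ E [set x; y]) ->
  \sum_(y <- F) jump_rate E bn c x y <= local_rate x.
Proof.
move=> xL hF; have [F' [-> _ sub]] := local_rateE xL.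
apply: fset_sum_mono => [y|y /hF[yL Exy]]; last exact: sub.
exact: jump_rate_ge0.
Qed.

Lemma average_kernelE s x y : 0 <= s ->
  k s x y - dirac_at R y x =
  s * (\sum_(b <- B) rate bn c b * (dirac_at R y (swap b x) - dirac_at R y x))
    / (1 + lam * s).
Proof.
move=> s0; have h0 : 1 + lam * s != 0.
  by rewrite gt_eqF // (@mass_gt0 _ _ E) // => b; exact: (bonds_E hE).
rewrite /k /average_kernel /average /outcomes big_cons big_map /= /step_law.
have -> : \sum_(b <- B) rate bn c b * (dirac_at R y (swap b x) - dirac_at R y x) =
   \sum_(b <- B) rate bn c b * dirac_at R y (swap b x) - lam * dirac_at R y x.
  by rewrite /lam /total_rate mulr_suml -sumrB; apply: eq_bigr => b _; rewrite mulrBr.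
have -> : \sum_(b <- B) rate bn c b * s / (1 + total_rate bn c B * s) * dirac_at R y (swap b x)
   = s / (1 + lam * s) * \sum_(b <- B) rate bn c b * dirac_at R y (swap b x).
  by rewrite mulr_sumr; apply: eq_bigr => b _; rewrite -/lam; ring.
rewrite -/lam; field.
exact: h0.
Qed.

(** Off the diagonal only the bond [[set x; y]] contributes. *)
Lemma average_kernel_derivative x y : x \in L -> y \in L ->
  \sum_(b <- B) rate bn c b * (dirac_at R y (swap b x) - dirac_at R y x) =
  if x == y then - local_rate x else jump_rate E bn c x y.
Proof.
move=> xL yL; rewrite /dirac_at; case: eqVneq => [->|xy].
  rewrite /local_rate -sumrN; apply: eq_bigr => b _; rewrite -mulrN; congr *%R.
  by case: eqP => _; rewrite ?subrr ?oppr0 // sub0r.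
rewrite /jump_rate; case: asboolP => Exy.
  have bB : [set x; y] \in B by apply/(mem_bonds hE); split=> // z [] ->.
  rewrite (big_fsetD1 _ bB) /= swap_pair // eqxx subr0 mulr1 big1_seq ?addr0 //.
  move=> b /andP[_]; rewrite in_fsetD1 => /andP[bxy _].
  case: eqP => e; rewrite ?subrr ?mulr0 //.
  case: (swap_case b x) => [e'|[_ e']]; first by move: xy; rewrite -e e' eqxx.
  by move: bxy; rewrite e' e eqxx.
rewrite big1_seq // => b /andP[_ bB]; case: eqP => e; rewrite ?subrr ?mulr0 //.
case: (swap_case b x) => [e'|[_ e']]; first by move: xy; rewrite -e e' eqxx.
by exfalso; apply: Exy; rewrite -e -e'; exact: (bonds_E hE bB).
Qed.

(** On [S] the walk and one step of the finite dynamics have the same jump rates;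
    only the rates of leaving [x] through bonds outside [L] differ. *)
Lemma kernel_distance_derivative (S : {fset V}) : {subset S <= L} ->
  s^-1 * (\sum_(x <- S) \sum_(y <- S) `|transition P Y s x y - k s x y|)
    @[s --> 0^'+] -->
  \sum_(x <- S) (escape_rate E bn c x - local_rate x).
Proof.
move=> SL.
have -> : \sum_(x <- S) (escape_rate E bn c x - local_rate x) =
   \sum_(x <- S) \sum_(y <- S)
     `|walk_generator bn E c (dirac_at R y) x -
       (if x == y then - local_rate x else jump_rate E bn c x y) * 1|.
  apply: eq_big_seq => x xS; rewrite (big_fsetD1 x) //= eqxx mulr1 big1_seq ?addr0.
    have -> : walk_generator bn E c (dirac_at R x) x = - escape_rate E bn c x.
      by rewrite /escape_rate opprK.
    have := local_rate_le (SL _ xS).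
    move: (escape_rate E bn c x) (local_rate x) => u l ul.
    by rewrite ler0_norm; lra.
  move=> y /andP[_]; rewrite in_fsetD1 => /andP[yx _].
  by rewrite eq_sym (negbTE yx) generator_offdiag ?(eq_sym x) // mulr1 subrr normr0.
apply: cvg_trans (_ : \sum_(x <- S) \sum_(y <- S)
   `|s^-1 * (transition P Y s x y - dirac_at R y x) -
     (if x == y then - local_rate x else jump_rate E bn c x y) * (1 + lam * s)^-1|
    @[s --> 0^'+] --> _).
  apply: near_eq_cvg; near=> s; have s0 : 0 < s by near: s; exact: nbhs_right_gt.
  rewrite mulr_sumr; apply: eq_big_seq => x xS; rewrite mulr_sumr.
  apply: eq_big_seq => y yS.
  have es : s^-1 = `|s^-1| by rewrite ger0_norm // invr_ge0 ltW.
  rewrite [X in X * `|_|]es -normrM.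
  have := average_kernelE x y (ltW s0).
  rewrite (average_kernel_derivative (SL _ xS) (SL _ yS)).
  set G := (if _ then _ else _); move=> kE; congr `|_|.
  rewrite -[k s x y](subrK (dirac_at R y x)) kE.
  have h0 : 1 + lam * s != 0.
    by rewrite gt_eqF // (@mass_gt0 _ _ E) ?(ltW s0) // => b; exact: (bonds_E hE).
  field; by rewrite h0 gt_eqF.
apply: cvg_seq_sum => x xS; apply: cvg_seq_sum => y yS.
apply: cvg_norm; apply: cvgB; first exact: transition_derivative.
apply: cvgM; first exact: cvg_cst.
rewrite -[X in _ --> X]invr1; apply: cvgV; first exact: oner_neq0.
rewrite -[X in _ --> X]addr0 -[X in _ --> _ + X](mulr0 lam).
apply: cvgD; first exact: cvg_cst.
apply: cvgM; first exact: cvg_cst.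
by apply: cvg_at_right_filter; exact: cvg_id.
Unshelve. all: by end_near. Qed.

Lemma kernel_distance_near (S : {fset V}) (e : R) : {subset S <= L} -> 0 < e ->
  \forall s \near 0^'+, \sum_(x <- S) \sum_(y <- S) `|transition P Y s x y - k s x y| <=
    s * (\sum_(x <- S) (escape_rate E bn c x - local_rate x) + e).
Proof.
move=> SL e0; near=> s; have s0 : 0 < s by near: s; exact: nbhs_right_gt.
rewrite mulrC -ler_pdivrMr // mulrC; near: s.
by apply: (cvgr_le _ (kernel_distance_derivative SL)); rewrite ltrDl.
Unshelve. all: by end_near. Qed.

End KernelDerivative.

(** * The exclusion process on one graph *)

Lemma nonincreasing_probability (R : realType) d (Om : measurableType d)
    (P : probability Om R) (A : nat -> set Om) (e : R) :
  (forall m, measurable (A m)) ->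
  (forall m m', (m <= m')%N -> A m' `<=` A m) ->
  P (\bigcap_m A m) = 0%E -> 0 < e ->
  exists m0, forall m, (m0 <= m)%N -> (P (A m) <= e%:E)%E.
Proof.
move=> mA ndA A0 e0.
have h : P \o A @ \oo --> P (\bigcap_m A m).
  apply: nonincreasing_cvg_mu => //.
  - by rewrite -ge0_fin_numE // fin_num_measure.
  - exact: bigcapT_measurable.
  - by move=> m m' mm'; apply/subsetPset; exact: ndA.
rewrite A0 in h; have {h}[_ h] := (fine_cvgP _ _).1 h.
have [n0 _ hn0] := cvgr_le _ h _ e0.
exists n0 => m n0m; rewrite -[P (A m)]fineK ?fin_num_measure // lee_fin.
exact: (hn0 m n0m).
Qed.

Lemma probability_setC_ge (R : realType) d (Om : measurableType d)
    (P : probability Om R) (A : set Om) (e : R) : measurable A ->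
  ((1 - e)%:E <= P A)%E -> (P (~` A) <= e%:E)%E.
Proof.
move=> mA; rewrite probability_setC // -[P A]fineK ?fin_num_measure //.
by rewrite -EFinB !lee_fin; lra.
Qed.

Section Graph.
Context (R : realType) (V : choiceType).
Variables (E : set (set V)) (bn : R) (c : set V -> R).
Hypothesis bn0 : 0 < bn.
Hypothesis c0 : forall b, E b -> 0 <= c b.
Hypothesis hE : unoriented_graph E.
Context (d : measure_display) (Om : measurableType d) (P : probability Om R).
Variables (N : set V -> R -> Om -> nat) (eps : R) (mu : probability (config V) R)
  (eta : R -> Om -> V -> bool).
Hypothesis eps0 : 0 < eps.
Hypothesis hN : poisson_clocks P bn E c N.
Hypothesis heta : exclusion_process P E N eps mu eta.
Context (dY : measure_display) (OmY : measurableType dY) (PY : probability OmY R).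
Variable (Y : V -> R -> OmY -> V).
Hypothesis hY : random_walk PY (walk_generator bn E c) Y.
Variable Lam : nat -> {fset V}.
Hypothesis Lam_mono : forall m m', (m <= m')%N -> {subset Lam m <= Lam m'}.
Hypothesis Lam_cover : forall x, exists m, x \in Lam m.
Variables (F : {fset V}) (t : R).
Hypothesis t0 : 0 < t.

Let B M := bonds E (Lam M).
Let h (n : nat) : R := t / n%:R.

Lemma measurable_site u v : 0 <= u -> measurable [set w | eta u w v].
Proof.
move=> u0.
have mv : measurable ([set z | z v] : set (config V)).
  by apply: sub_sigma_algebra; exists v.
have := exclusion_measurable heta u0 measurableT mv.
by rewrite setTI.
Qed.

Lemma measurable_same_value u u' v v' : 0 <= u -> 0 <= u' ->
  measurable [set w | eta u w v = eta u' w v'].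
Proof.
move=> u0 u'0.
rewrite (_ : [set w | _] = ([set w | eta u w v] `&` [set w | eta u' w v']) `|`
   (~` [set w | eta u w v] `&` ~` [set w | eta u' w v'])).
  apply: measurableU; apply: measurableI; do ?apply: measurableC;
  exact: measurable_site.
apply/seteqP; split=> w /=.
  by move=> ->; case: (eta u' w v'); [left|right].
by move=> [[-> ->]//|[/negP/negbTE -> /negP/negbTE ->]].
Qed.

Lemma measurable_same_history os :
  measurable [set w | forall v, v \in F -> eta t w v = eta 0 w (trace os v)].
Proof.
rewrite (_ : [set w | _] = \bigcap_(v in [set` F])
    [set w | eta t w v = eta 0 w (trace os v)]) //.
by apply: fin_bigcap_measurable => // v _; apply: measurable_same_value => //; exact: ltW.
Qed.

(** On [trap m] the sites of [F] at time [t] have all their ancestors in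
    [Lam m], and every exchange dynamics restricted to a larger finite set
    follows these ancestors whenever its grid is fine enough. *)
Definition trap m : set Om := [set w | forall M n, (m <= M)%N -> (0 < n)%N ->
  forall os, os \in histories (B M) n -> history_event N (B M) (h n) os w ->
  forall v, v \in F ->
    stays (Lam m) os v /\ eta t w v = eta 0 w (trace os v)].

Let BE M b : b \in B M -> E b. Proof. exact: (bonds_E hE). Qed.

Lemma h_ge0 n : 0 <= h n. Proof. by rewrite divr_ge0 // ltW. Qed.

Lemma trap_mono m m' : (m <= m')%N -> trap m `<=` trap m'.
Proof.
move=> mm' w hw M n m'M n0 os osB ho v vF.
have [st ->] := hw M n (leq_trans mm' m'M) n0 os osB ho v vF.
by split=> //; apply: stays_sub st; exact: Lam_mono.
Qed.

Lemma measurable_trap m : measurable (trap m).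
Proof.
rewrite (_ : trap m = \bigcap_M \bigcap_n
   \bigcap_(os in [set` histories (B M) n]) \bigcap_(v in [set` F])
     (if (m <= M)%N && (0 < n)%N then
        ~` history_event N (B M) (h n) os `|`
        (if stays (Lam m) os v then [set w | eta t w v = eta 0 w (trace os v)]
         else set0) else setT)).
  apply: bigcapT_measurable => M; apply: bigcapT_measurable => n.
  apply: fin_bigcap_measurable; first exact: finite_seq.
  move=> os osB; apply: fin_bigcap_measurable => // v vF.
  case: ifP => // _; apply: measurableU.
    apply: measurableC; apply: (measurable_history_event hN); last exact: h_ge0.
    exact: BE.
  by case: ifP => // _; apply: measurable_same_value => //; exact: ltW.
apply/seteqP; split=> [w hw M _ n _ os osB v vF|w hw M n mM n0 os osB ho v vF].
  case: ifP => // /andP[mM n0].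
  have [ho|ho] := pselect (history_event N (B M) (h n) os w); last by left.
  by right; have [-> e] := hw M n mM n0 os osB ho v vF.
have := hw M I n I os osB v vF; rewrite mM n0 /= => -[//|].
by case: ifP.
Qed.

(** The ancestral lines of the sites of [F] involve finitely many sites. *)
Lemma ae_trap : \forall w \ae P, exists m, trap m w.
Proof.
have := exclusion_graphical heta; apply: filterS => w hgr.
have nd b : E b -> forall s u, 0 <= s <= u -> (N b s w <= N b u w)%N.
  by move=> Eb; exact: (poisson_nondecreasing (clock_poisson hN Eb)).
have rc b : E b -> forall u, 0 <= u -> \forall s \near u^'+, N b s w = N b u w.
  by move=> Eb; exact: (poisson_right_continuous (clock_poisson hN Eb)).
suff [m hm] : exists m, forall m', (m <= m')%N -> forall v, v \in F ->
    forall M n, (m' <= M)%N -> (0 < n)%N ->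
    forall os, os \in histories (B M) n -> history_event N (B M) (h n) os w ->
    stays (Lam m') os v /\ eta t w v = eta 0 w (trace os v).
  by exists m => M n mM n0 os osB ho v vF; exact: (hm m (leqnn m) v vF M n).
apply: eventually_fset => v vF.
have [L anc etaE] := ancestry_exists (N := fun b s => N b s w) hE nd eps0 hgr v t0.
have [m1 hm1] := exhaustion_eventually [fset v]%fset Lam_mono Lam_cover.
have [m2 hm2] : exists m0, forall m, (m0 <= m)%N -> forall e, e \in
    [fset e | e in L]%fset -> e.2 `<=` [set` Lam m].
  apply: eventually_fset => e; rewrite !inE /= => eL.
  have [_ Ee _] := anc_ring anc eL.
  have [x [y [_ ->]]] := hE Ee.
  have [mx hx] := Lam_cover x; have [my hy] := Lam_cover y.
  exists (maxn mx my) => m; rewrite geq_max => /andP[mxm mym] z [] ->.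
    exact: Lam_mono mxm _ hx.
  exact: Lam_mono mym _ hy.
exists (maxn m1 m2) => m'; rewrite geq_max => /andP[m1m m2m] M n mM n0 os osB ho.
have LS e : e \in L -> e.2 `<=` [set` Lam m'].
  by move=> eL; apply: (hm2 _ m2m); rewrite !inE.
have LB e : e \in L -> [set` B M] e.2.
  move=> eL; apply/(mem_bonds hE); split; first by have [] := anc_ring anc eL.
  by move=> x /(LS _ eL); exact: Lam_mono.
have sz := size_history osB.
have tE : t = (size os)%:R * h n.
  by rewrite sz /h mulrC divfK // pnatr_eq0 -lt0n.
have tr := backtrack_trace (N := fun b s => N b s w) nd rc anc (h_ge0 n) tE (@BE M) LB
  (fun b => mem_history osB) ho.
split.
  apply: staysP => j js; rewrite tr //.
  apply: (@backtrack_sub _ _ _ [set` Lam m']); last exact: LS.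
  by apply: hm1 m1m _ _; rewrite inE.
by rewrite etaE; have := tr 0%N (leq0n _); rewrite drop0 mul0r => ->.
Qed.

Lemma trap_probability e : 0 < e ->
  exists m0, forall m, (m0 <= m)%N -> (P (~` trap m) <= e%:E)%E.
Proof.
apply: nonincreasing_probability.
- by move=> m; apply: measurableC; exact: measurable_trap.
- by move=> m m' mm'; apply: subsetC; exact: trap_mono.
- apply: measure_negligible.
    by apply: bigcapT_measurable => m; apply: measurableC; exact: measurable_trap.
  apply: negligibleS ae_trap => w hw [m]; exact: hw.
Qed.

(** Discarding the paths that leave [S] at a grid time only decreases the
    transition probability. *)
Lemma walk_dominates S n s x y : 0 <= s ->
  iter n (killed (transition PY Y s) S) (dirac_at R y) x <=
  transition PY Y (n%:R * s) x y.
Proof.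
move=> s0; elim: n x => [|n IH] x.
  rewrite mul0r /= /dirac_at; case: eqVneq => [->|_]; last exact: transition_ge0.
  by rewrite (transition0 hY).
have -> : n.+1%:R * s = s + n%:R * s by rewrite -natr1 mulrDl mul1r addrC.
have ns0 : 0 <= n%:R * s by rewrite mulr_ge0.
apply: le_trans (transition_semigroup_ge hY x y S s0 ns0).
by apply: ler_sum => z _; apply: ler_wpM2l; [exact: transition_ge0|exact: IH].
Qed.

Lemma near_zero_exists (Q : R -> Prop) : (\forall s \near 0^'+, Q s) ->
  exists2 r, 0 < r & forall s, 0 < s -> s < r -> Q s.
Proof.
move=> H; have /nbhs_ballP[r /= r0 hr] : nbhs (0 : R) (fun s => 0 < s -> Q s) by exact: H.
exists r => // s s0 sr; apply: hr => //.
by rewrite /ball /= sub0r normrN gtr0_norm.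
Qed.

(** The discrepancy of the escape rates disappears as the finite dynamics
    exhausts the graph, [S] being fixed. *)
Lemma local_rate_tail (S : {fset V}) e : 0 < e ->
  exists m0, forall M, (m0 <= M)%N -> forall x, x \in S ->
    escape_rate E bn c x - local_rate E bn c (Lam M) x <= e.
Proof.
move=> e0; apply: eventually_fset => x _.
have [G GE lt] := escape_rate_approx bn0 c0 hE hY x e0.
have [m1 hm1] := exhaustion_eventually (x |` G)%fset Lam_mono Lam_cover.
exists m1 => M m1M; have hM := hm1 M m1M.
have : \sum_(y <- G) jump_rate E bn c x y <= local_rate E bn c (Lam M) x.
  apply: local_rate_ge => //; first by apply: hM; rewrite in_fset1U eqxx.
  by move=> y yG; split; [apply: hM; rewrite in_fset1U yG orbT|exact: GE].
by move: lt; lra.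
Qed.

(** The exchange dynamics on a large finite set, sampled on a fine grid,
    describes both the exclusion process on [F] and the walk from [F]. The
    parameters are chosen in the following order: [S = Lam m] traps the ancestral
    lines of [F] with large probability; then [M] makes the escape rates from
    [S] nearly exact; then [n] makes the grid fine. The walk dominates the walk
    killed outside [S], which is close to the killed finite dynamics, whose
    mass is nearly 1 because ancestral lines stay in [S]; so the walk and the
    finite dynamics are close in total variation. *)
Lemma finite_approximation e : 0 < e -> exists M n,
  let p := step_law bn c (B M) (h n) in
  [/\ {subset F <= Lam M},
      total_rate bn c (B M) * h n <= 1,
      (P (~` \bigcup_(os in [set` histories (B M) n])
          ([set w | forall v, v \in F -> eta t w v = eta 0 w (trace os v)]
            `&` history_event N (B M) (h n) os)) <= e%:E)%E &
      forall v, v \in F -> forall G : {fset V},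
        \sum_(y <- G) `|iter n (average (B M) p) (dirac_at R y) v
                        - transition PY Y t v y| <= e].
Proof.
move=> e0.
have e8 : 0 < e / 8 by rewrite divr_gt0.
have [m1 hm1] := trap_probability e8.
have [m2 hm2] := exhaustion_eventually F Lam_mono Lam_cover.
pose m := maxn m1 m2; pose S := Lam m.
have Ptrap : (P (~` trap m) <= (e / 8)%:E)%E by apply: hm1; rewrite leq_maxl.
have FS : {subset F <= S} by apply: hm2; rewrite leq_maxr.
pose K : R := #|` S|%:R + 1.
have K0 : 0 < K by rewrite ltr_wpDl.
pose e2 := e / (16 * K * t).
have e20 : 0 < e2 by rewrite divr_gt0 // !mulr_gt0.
have [m3 hm3] := @local_rate_tail S (e2 / K) (divr_gt0 e20 K0).
pose M := maxn m m3.
have SL : {subset S <= Lam M} by apply: Lam_mono; rewrite leq_maxl.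
have tail : \sum_(x <- S) (escape_rate E bn c x - local_rate E bn c (Lam M) x) <= e2.
  apply: (@le_trans _ _ (\sum_(x <- S) e2 / K)).
    rewrite big_seq [leRHS]big_seq; apply: ler_sum => x xS.
    by apply: hm3 => //; rewrite leq_maxr.
  rewrite big_const_seq count_predT iter_addr_0 -mulr_natl mulrCA -[leRHS]mulr1.
  by rewrite ler_pM2l // ler_pdivrMr // mul1r /K lerDl.
have [r r0 near_r] := near_zero_exists (kernel_distance_near bn0 c0 hE hY SL e20).
pose lam := total_rate bn c (B M).
have lam0 : 0 <= lam by apply: (total_rate_ge0 bn0 c0); exact: BE.
pose N0 : R := t / r + lam * t + (lam * t) ^+ 2 / (e / 8).
have N00 : 0 <= N0.
  by rewrite !addr_ge0 ?divr_ge0 ?mulr_ge0 ?sqr_ge0 // ltW.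
pose n := (Num.truncn N0).+1.
have nN : N0 < n%:R by exact: truncnS_gt.
have n0 : 0 < n%:R :> R by rewrite ltr0n.
have hn0 : 0 < h n by rewrite divr_gt0.
have hr : h n < r.
  rewrite /h ltr_pdivrMr // mulrC -ltr_pdivrMr //.
  apply: le_lt_trans nN; rewrite /N0 -addrA lerDl.
  by rewrite !addr_ge0 ?divr_ge0 ?mulr_ge0 ?sqr_ge0 // ltW.
have lamh : lam * h n <= 1.
  rewrite /h mulrA ler_pdivrMr // mul1r; apply: le_trans (ltW nN).
  have : 0 <= t / r by rewrite divr_ge0 // ltW.
  have : 0 <= (lam * t) ^+ 2 / (e / 8) by rewrite divr_ge0 ?sqr_ge0 // ltW.
  rewrite /N0; lra.
have nlam2 : n%:R * (lam * h n) ^+ 2 <= e / 8.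
  have -> : n%:R * (lam * h n) ^+ 2 = (lam * t) ^+ 2 / n%:R.
    by rewrite /h; field; rewrite gt_eqF.
  rewrite ler_pdivrMr // [leRHS]mulrC -ler_pdivrMr //; apply: le_trans (ltW nN).
  have : 0 <= t / r by rewrite divr_ge0 // ltW.
  have : 0 <= lam * t by rewrite mulr_ge0 // ltW.
  rewrite /N0; lra.
have tn : n%:R * h n = t by rewrite /h mulrC divfK // gt_eqF.
exists M, n => p.
have p0 o : o \in outcomes (B M) -> 0 <= p o.
  by apply: (step_law_ge0 bn0 c0) => //; [exact: BE|exact: ltW].
have p1 : \sum_(o <- outcomes (B M)) p o = 1.
  by apply: (step_law_sum bn0 c0) => //; [exact: BE|exact: ltW].
pose G := \bigcup_(os in [set` histories (B M) n]) history_event N (B M) (h n) os.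
have mG : measurable G.
  apply: fin_bigcup_measurable; first exact: finite_seq.
  by move=> os _; apply: (measurable_history_event hN); [exact: BE|exact: ltW].
have PG : (P (~` G) <= (e / 8)%:E)%E.
  apply: probability_setC_ge => //.
  apply: le_trans (good_ge bn0 c0 hN heta (@BE M) (ltW hn0) n lamh).
  by rewrite lee_fin lerD2l lerN2.
have PGtrap : (P (~` (G `&` trap m)) <= (e / 8 + e / 8)%:E)%E.
  rewrite setCI EFinD; have H := leeD PG Ptrap; apply: le_trans H.
  by apply: measureU2; apply: measurableC => //; exact: measurable_trap.
have mGt : measurable (G `&` trap m) by apply: measurableI => //; exact: measurable_trap.
have inG w : (G `&` trap m) w -> exists os, [/\ os \in histories (B M) n,
    history_event N (B M) (h n) os w &
    forall v, v \in F -> stays S os v /\ eta t w v = eta 0 w (trace os v)].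
  move=> [[os osB ho] tr]; exists os; split=> // v vF.
  by apply: (tr M n _ _ os osB ho v vF) => //; rewrite leq_maxl.
split => //.
- by move=> v /FS /SL.
- apply: le_trans (_ : (P (~` (G `&` trap m)) <= e%:E)%E); last first.
    by apply: le_trans PGtrap _; rewrite lee_fin; lra.
  apply: le_measure; rewrite ?inE.
  + apply: measurableC; apply: fin_bigcup_measurable; first exact: finite_seq.
    move=> os _; apply: measurableI; last first.
      by apply: (measurable_history_event hN); [exact: BE|exact: ltW].
    exact: measurable_same_history.
  + exact: measurableC.
  + apply: subsetC => w /inG[os [osB ho tr]]; exists os => //; split=> // v vF.
    by have [] := tr v vF.
move=> v vF G'.
set eps_n := \sum_(x <- S) \sum_(y <- S)
  `|transition PY Y (h n) x y - average_kernel (B M) p x y|.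
have eps_n0 : 0 <= eps_n by apply: sumr_ge0 => x _; apply: sumr_ge0.
have eps_nle : n%:R * eps_n <= e / (8 * K).
  have : eps_n <= h n * (2 * e2).
    apply: le_trans (near_r _ hn0 hr) _; rewrite ler_pM2l //.
    by rewrite mulr_natl mulr2n lerD2r.
  rewrite -(ler_pM2l n0); move/le_trans; apply; rewrite mulrA tn /e2.
  rewrite le_eqVlt; apply/orP; left; apply/eqP; field.
  by rewrite !gt_eqF.
have mass : 1 - e / 4 <= \sum_(os <- histories (B M) n | stays S os v) weight p os.
  pose A os : set (config V) := if stays S os v then setT else set0.
  have mA os : measurable (A os) by rewrite /A; case: ifP.
  have law := history_lawP bn0 c0 hN heta (@BE M) (ltW hn0) n mA.
  have sub : G `&` trap m `<=` \bigcup_(os in [set` histories (B M) n])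
       (eta 0 @^-1` A os `&` history_event N (B M) (h n) os).
    by move=> w /inG[os [osB ho tr]]; exists os => //; split=> //; have [st _] := tr v vF; rewrite /A st.
  have : (P (G `&` trap m) <= P (\bigcup_(os in [set` histories (B M) n])
       (eta 0 @^-1` A os `&` history_event N (B M) (h n) os)))%E.
    apply: le_measure => //; rewrite inE //.
    apply: fin_bigcup_measurable; first exact: finite_seq.
    move=> os _; apply: measurableI.
      by rewrite -[X in measurable X]setTI; exact: (exclusion_measurable heta).
    by apply: (measurable_history_event hN); [exact: BE|exact: ltW].
  rewrite law; have -> : (\sum_(os <- histories (B M) n)
      (step_mass bn c (B M) (h n) ^+ n * weight (step_law bn c (B M) (h n)) os)%:E * mu (A os))%E =
    (step_mass bn c (B M) (h n) ^+ n *
      \sum_(os <- histories (B M) n | stays S os v) weight p os)%:E.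
    rewrite mulr_sumr [in RHS]big_mkcond -sumEFin; apply: eq_bigr => os _.
    by rewrite /A; case: ifP => _; rewrite ?probability_setT ?mule1 ?measure0 ?mule0.
  have : ((1 - e / 4)%:E <= P (G `&` trap m))%E.
    move: PGtrap; rewrite probability_setC // -[P (G `&` trap m)]fineK ?fin_num_measure //.
    by rewrite -EFinB !lee_fin; lra.
  move=> l1 l2; have := le_trans l1 l2; rewrite lee_fin => /le_trans; apply.
  rewrite ler_piMl ?exprn_ile1 //.
  - by rewrite big_seq_cond sumr_ge0 // => os /andP[osB _]; exact: (weight_ge0 p0 osB).
  - by apply: (step_mass_ge0 bn0 c0); [exact: BE|exact: ltW].
  - exact: step_mass_le1.
have := @total_variation_le _ _ _ _ p0 p1 n S v (transition PY Y t v) (e / 4)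
  (n%:R * eps_n) G' (FS v vF).
move=> /(_ (transition_ge0 _ _ _ _) (fun D => transition_sum_le1 hY v D (ltW t0))).
have -> : 0 <= n%:R * eps_n by rewrite mulr_ge0.
move=> /(_ isT) tv; apply: le_trans (tv _ mass) _.
  move=> y yS; have := walk_dominates S n v y (ltW hn0); rewrite tn.
  apply: le_trans.
  have := @killed_iter_dist _ _ S (transition PY Y (h n)) (average_kernel (B M) p) n
    (dirac_at R y) eps_n 1 _ _ _ _ _ _ _ v (FS v vF).
  rewrite mulr1 ler_norml => H; have /andP[] : - (n%:R * eps_n) <=
    iter n (killed (transition PY Y (h n)) S) (dirac_at R y) v -
    iter n (killed (average_kernel (B M) p) S) (dirac_at R y) v <= n%:R * eps_n.
    apply: H => //.
    - by move=> x z _; exact: transition_ge0.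
    - by move=> x _; apply: (transition_sum_le1 hY); exact: ltW.
    - by move=> x z _; exact: average_kernel_ge0.
    - by move=> x _; exact: average_kernel_sum_le1.
    - move=> x xS; rewrite /eps_n [leRHS](big_fsetD1 x xS) /= lerDl.
      by apply: sumr_ge0 => x' _; apply: sumr_ge0.
    - by move=> x _; rewrite /dirac_at; case: eqP; rewrite ?normr1 ?normr0.
  lra.
have cK : #|` S|%:R * (n%:R * eps_n) <= e / 8.
  apply: (@le_trans _ _ (K * (e / (8 * K)))).
    by apply: ler_pM; rewrite ?mulr_ge0 // /K lerDl.
  rewrite le_eqVlt; apply/orP; left; apply/eqP; field.
  by rewrite gt_eqF.
by lra.
Qed.

End Graph.

(** * Fluctuations of the exclusion process on one graph *)

Section ConfigurationSums.
Context (R : realType) (V : choiceType).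
Variable Lam : nat -> {fset V}.
Hypothesis Lam_mono : forall m m', (m <= m')%N -> {subset Lam m <= Lam m'}.
Hypothesis Lam_cover : forall x, exists m, x \in Lam m.

(** An unconditional sum is a countable supremum, hence measurable in the
    configuration. *)
Lemma esum_Lam (f : V -> R) : (forall x, 0 <= f x) ->
  \esum_(x in [set: V]) (f x)%:E =
  esups (fun M => (\sum_(x <- Lam M) f x)%:E) 0.
Proof.
move=> f0; apply/eqP; rewrite eq_le; apply/andP; split.
  apply: ge_ereal_sup => _ [X [finX _] <-].
  have [m hm] := exhaustion_eventually (fset_set X) Lam_mono Lam_cover.
  apply: le_trans (_ : ((\sum_(x <- Lam m) f x)%:E <= _)%E); last first.
    by apply: ereal_sup_ubound; exists m.
  rewrite -[X]fset_setK // -fsbig_seq ?fset_uniq // sumEFin lee_fin.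
  by apply: fset_sum_mono => //; exact: hm.
apply: ge_ereal_sup => _ [M _ <-]; apply: esum_ge; exists [set` Lam M] => //.
by rewrite -fsbig_seq ?fset_uniq // sumEFin.
Qed.

Lemma measurable_coordinate (y : V) :
  measurable_fun [set: config V] (fun s : config V => (s y)%:R : R).
Proof.
have m : measurable ([set s | s y] : set (config V)).
  by apply: sub_sigma_algebra; exists y.
rewrite (_ : (fun _ => _) = \1_([set s | s y] : set (config V))).
  exact: measurable_indic.
by apply/funext => s; rewrite indicE; congr ((nat_of_bool _)%:R); apply/idP/idP; rewrite inE.
Qed.

Lemma measurable_rsum_config (g : V -> R) :
  measurable_fun [set: config V]
    (fun s : config V => rsum [set: V] (fun y => g y * (s y)%:R)).
Proof.
have part (k : V -> R) : (forall y, 0 <= k y) ->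
  measurable_fun [set: config V] (fun s : config V =>
    \esum_(y in [set: V]) (k y * (s y)%:R)%:E).
  move=> k0.
  rewrite (_ : (fun _ => _) = fun s : config V =>
     esups (fun M => (\sum_(y <- Lam M) k y * (s y)%:R)%:E) 0).
    apply: measurable_fun_esups => M; apply/measurable_EFinP.
    apply: measurable_sum => y; apply: measurable_funM => //.
    exact: measurable_coordinate.
  by apply/funext => s; rewrite esum_Lam // => y; rewrite mulr_ge0.
rewrite /rsum; apply: measurable_funB.
- apply: measurableT_comp; first exact: fine_measurable.
  rewrite (_ : (fun _ => _) = fun s : config V =>
     \esum_(y in [set: V]) ((Num.max (g y) 0) * (s y)%:R)%:E).
    by apply: part => y; rewrite le_max lexx orbT.
  apply/funext => s; apply: eq_esum => y _.
  by case: (s y); rewrite ?mulr1 ?mulr0 ?maxxx.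
- apply: measurableT_comp; first exact: fine_measurable.
  rewrite (_ : (fun _ => _) = fun s : config V =>
     \esum_(y in [set: V]) ((Num.max (- g y) 0) * (s y)%:R)%:E).
    by apply: part => y; rewrite le_max lexx orbT.
  apply/funext => s; apply: eq_esum => y _.
  by case: (s y); rewrite ?mulr1 ?mulr0 ?oppr0 ?maxxx.
Qed.

End ConfigurationSums.

Section Deviation.
Context (R : realType) (V : choiceType).
Variables (E : set (set V)) (bn : R) (c : set V -> R).
Hypothesis bn0 : 0 < bn.
Hypothesis c0 : forall b, E b -> 0 <= c b.
Hypothesis hE : unoriented_graph E.
Context (d : measure_display) (Om : measurableType d) (P : probability Om R).
Variables (N : set V -> R -> Om -> nat) (eps : R) (mu : probability (config V) R)
  (eta : R -> Om -> V -> bool).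
Hypothesis eps0 : 0 < eps.
Hypothesis hN : poisson_clocks P bn E c N.
Hypothesis heta : exclusion_process P E N eps mu eta.
Context (dY : measure_display) (OmY : measurableType dY) (PY : probability OmY R).
Variable (Y : V -> R -> OmY -> V).
Hypothesis hY : random_walk PY (walk_generator bn E c) Y.
Variable Lam : nat -> {fset V}.
Hypothesis Lam_mono : forall m m', (m <= m')%N -> {subset Lam m <= Lam m'}.
Hypothesis Lam_cover : forall x, exists m, x \in Lam m.
Variable t : R.
Hypothesis t0 : 0 < t.

Let approximation F e :=
  @finite_approximation _ _ _ _ _ bn0 c0 hE _ _ _ _ _ _ _ eps0 hN heta
    _ _ _ _ hY _ Lam_mono Lam_cover F _ t0 e.

Lemma total_variation_entry (f g : V -> R) (e : R) :
  (forall G : {fset V}, \sum_(y <- G) `|f y - g y| <= e) ->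
  forall y, `|f y - g y| <= e.
Proof. by move=> h y; have := h [fset y]%fset; rewrite big_seq_fset1. Qed.

(** A composition of exchanges and its inverse have the same law. *)
Lemma kernel_symmetric (B : {fset set V}) (p : option (set V) -> R) (L : {fset V}) n u v :
  (forall b, b \in B -> forall x, b x -> x \in L) -> u \in L -> v \in L ->
  iter n (average B p) (dirac_at R v) u = iter n (average B p) (dirac_at R u) v.
Proof.
move=> BL uL vL.
have innerE f w : w \in L -> inner L f (dirac_at R w) = f w.
  move=> wL; rewrite /inner (big_fsetD1 w) //= /dirac_at eqxx mulr1 big1_seq ?addr0 //.
  by move=> y /andP[_]; rewrite in_fsetD1 => /andP[/negbTE ->]; rewrite mulr0.
have := @inner_average_iter _ _ B p L BL n (dirac_at R u) (dirac_at R v).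
by rewrite innerE // innerC innerE.
Qed.

(** Reversibility of the walk for the counting measure. *)
Lemma transition_sym u v : transition PY Y t u v = transition PY Y t v u.
Proof.
apply/eqP; rewrite -subr_eq0 -normr_le0; apply/ler_addgt0Pr => e e0; rewrite add0r.
have [M [n [FL _ _ tv]]] := @approximation [fset u; v]%fset _ (divr_gt0 e0 (ltr0n _ 2)).
have uF : u \in [fset u; v]%fset by rewrite !inE eqxx.
have vF : v \in [fset u; v]%fset by rewrite !inE eqxx orbT.
have := total_variation_entry (tv u uF) v; have := total_variation_entry (tv v vF) u.
rewrite (@kernel_symmetric _ _ (Lam M)) ?FL //; last first.
  by move=> b bB x; exact: (bonds_in hE bB).
rewrite !ler_norml => /andP[a1 a2] /andP[a3 a4]; apply/andP; split; lra.
Qed.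

Variables (F : {fset V}) (phi : V -> R).
Hypothesis phiF : forall v, v \notin F -> phi v = 0.

Let g := semigroup PY Y t phi.

Lemma semigroupE y : g y = \sum_(v <- F) phi v * transition PY Y t v y.
Proof.
rewrite /g (semigroup_transition hY _ _ phiF) ?(ltW t0) //.
by apply: eq_bigr => v _; rewrite transition_sym.
Qed.

Lemma semigroup_l1 : l1_bound setT g (\sum_(v <- F) `|phi v|).
Proof.
move=> G _; under eq_bigr do rewrite semigroupE.
apply: (@le_trans _ _ (\sum_(y <- G) \sum_(v <- F) `|phi v| * transition PY Y t v y)).
  apply: ler_sum => y _; apply: le_trans (ler_norm_sum _ _ _) _.
  by apply: ler_sum => v _; rewrite normrM (ger0_norm (transition_ge0 _ _ _ _ _)).
rewrite exchange_big /=; apply: ler_sum => v _; rewrite -mulr_sumr ler_piMr //.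
exact: (transition_sum_le1 hY) (ltW t0).
Qed.

Definition deviation (w : Om) : R :=
  \sum_(v <- F) phi v * (eta t w v)%:R
  - rsum [set: V] (fun y => g y * (eta 0 w y)%:R).

Lemma measurable_deviation : measurable_fun setT deviation.
Proof.
apply: measurable_funB.
  apply: measurable_sum => v; apply: measurable_funM => //.
  exact: (measurableT_comp (@measurable_coordinate R V v)
    (exclusion_measurable heta (ltW t0))).
exact: (measurableT_comp (measurable_rsum_config Lam_mono Lam_cover g)
  (exclusion_measurable heta (lexx 0))).
Qed.

Lemma measurable_deviation_event (theta : R) :
  measurable [set w : Om | theta < `|deviation w|].
Proof.
have := measurableT_comp (@normr_measurable R setT) measurable_deviation.
move=> /(measurable_fun_ltr (measurable_cst theta)) /(_ measurableT [set true]).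
by move=> /(_ (ltac:(by []))); rewrite setTI.
Qed.

Section OneApproximation.
Variables (M n : nat) (e theta : R).
Let B := bonds E (Lam M).
Let p := step_law bn c B (t / n%:R).
Hypothesis FL : {subset F <= Lam M}.
Hypothesis p_None : 1 / 2 <= p None.
Hypothesis tv : forall v, v \in F -> forall G : {fset V},
  \sum_(y <- G) `|iter n (average B p) (dirac_at R y) v - transition PY Y t v y| <= e.
Hypothesis theta0 : 0 < theta.

Let BE b : b \in B -> E b. Proof. exact: (bonds_E hE). Qed.
Let BL b : b \in B -> forall x, b x -> x \in Lam M.
Proof. by move=> bB x; exact: (bonds_in hE bB). Qed.
Let h0 : 0 <= t / n%:R. Proof. by rewrite divr_ge0 // ltW. Qed.
Let p0 o : o \in outcomes B -> 0 <= p o.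
Proof. exact: (step_law_ge0 bn0 c0). Qed.
Let p1 : \sum_(o <- outcomes B) p o = 1.
Proof. exact: (step_law_sum bn0 c0). Qed.

Let s (sigma : config V) (y : V) : R := (sigma y)%:R.

(** By symmetry of the average both sides are [sum_v phi(v)] times an expectation
    of [sigma], under the finite dynamics from [v] on one side and under the walk
    from [v] on the other; [sigma] has values in [[0, 1]] and the two laws are
    [e]-close in total variation. *)
Lemma mean_bias (sigma : config V) :
  `|inner (Lam M) (iter n (average B p) phi) (s sigma)
    - rsum [set: V] (fun y => g y * (sigma y)%:R)| <= e * \sum_(v <- F) `|phi v|.
Proof.
pose q y := if y \in Lam M then iter n (average B p) phi y else 0.
have qE y : q y = \sum_(v <- F) phi v * iter n (average B p) (dirac_at R y) v.
  rewrite /q; case: ifP => yL.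
    have := @inner_average_iter _ _ B p (Lam M) BL n phi (dirac_at R y).
    have -> : inner (Lam M) (iter n (average B p) phi) (dirac_at R y) =
        iter n (average B p) phi y.
      rewrite /inner (big_fsetD1 y) //= /dirac_at eqxx mulr1 big1_seq ?addr0 //.
      by move=> z /andP[_]; rewrite in_fsetD1 => /andP[/negbTE ->]; rewrite mulr0.
    move=> ->; rewrite /inner (fset_sum_split _ FL) [X in _ + X]big1_seq ?addr0 //.
    by move=> z /andP[_]; rewrite !inE /= => /andP[_ /phiF ->]; rewrite mul0r.
  rewrite big1_seq // => v /andP[_ vF].
  rewrite (@average_iter_Lam _ _ B p (Lam M) BL n (dirac_at R y) (fun=> 0)) ?FL //.
    have z k w : iter k (average B p) (fun=> 0) w = 0 :> R.
      by elim: k w => //= k IH w; rewrite /average big1 // => o _; rewrite IH mulr0.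
    by rewrite z mulr0.
  by move=> z zL; rewrite /dirac_at; case: eqP => // ezy; move: yL; rewrite -ezy zL.
have b0 (b : bool) : `|b%:R| <= 1 :> R by case: b; rewrite ?normr1 ?normr0.
have s01 (f : V -> R) y : `|f y * (sigma y)%:R| <= `|f y|.
  by rewrite normrM ler_piMr.
have -> : inner (Lam M) (iter n (average B p) phi) (s sigma) =
    rsum [set: V] (fun y => q y * (sigma y)%:R).
  rewrite (@rsum_finite _ _ _ _ (Lam M)) //.
    by rewrite /inner; apply: eq_big_seq => y yL; rewrite /q yL.
  by move=> y _ /negbTE yL; rewrite /q yL mul0r.
apply: (@rsum_dist_le _ _ _ _ (\sum_(y <- Lam M) `|q y|) (\sum_(v <- F) `|phi v|)).
- move=> G _; apply: (@le_trans _ _ (\sum_(y <- G) `|q y|)).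
    by apply: ler_sum => y _.
  apply: (@le_trans _ _ (\sum_(y <- (Lam M `|` G)%fset) `|q y|)).
    by apply: fset_sum_mono => // y yG; rewrite in_fsetU yG orbT.
  have sub : {subset Lam M <= (Lam M `|` G)%fset} by move=> y yL; rewrite in_fsetU yL.
  rewrite (fset_sum_split _ sub) [X in _ + X]big1_seq ?addr0 //.
  by move=> y /andP[_]; rewrite !inE /= /q => /andP[_ /negbTE ->]; rewrite normr0.
- move=> G GT; apply: le_trans (semigroup_l1 GT).
  by apply: ler_sum => y _.
- move=> G _.
  apply: (@le_trans _ _ (\sum_(y <- G) \sum_(v <- F) `|phi v| *
      `|iter n (average B p) (dirac_at R y) v - transition PY Y t v y|)).
    apply: ler_sum => y _; rewrite /= -mulrBl.
    apply: le_trans (s01 (fun y => q y - g y) y) _.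
    rewrite qE semigroupE -sumrB; apply: le_trans (ler_norm_sum _ _ _) _.
    by apply: ler_sum => v _; rewrite -mulrBr normrM.
  rewrite exchange_big /= mulr_sumr big_seq [leRHS]big_seq; apply: ler_sum => v vF.
  by rewrite -mulr_sumr mulrC ler_wpM2r // tv.
Qed.

Let A os : set (config V) := [set sigma : config V | theta <
  `|\sum_(v <- F) phi v * (sigma (trace os v))%:R
    - rsum [set: V] (fun y => g y * (sigma y)%:R)|].

Lemma measurable_history_deviation os : measurable (A os).
Proof.
have mf : measurable_fun [set: config V] (fun sigma : config V =>
    \sum_(v <- F) phi v * (sigma (trace os v))%:R
    - rsum [set: V] (fun y => g y * (sigma y)%:R)).
  apply: measurable_funB.
    apply: measurable_sum => v; apply: measurable_funM => //.
    exact: measurable_coordinate.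
  exact: (measurable_rsum_config Lam_mono Lam_cover g).
have := measurableT_comp (@normr_measurable R setT) mf.
move=> /(measurable_fun_ltr (measurable_cst theta)) /(_ measurableT [set true]).
by move=> /(_ (ltac:(by []))); rewrite setTI.
Qed.

(** Given the initial configuration, Chebyshev's inequality for the random
    history; the prediction is the semigroup of the walk, whose bias is [e]. *)
Lemma history_chebyshev (sigma : config V) :
  \sum_(os <- histories B n) weight p os * \1_(A os) sigma <=
  (\sum_(v <- F) phi v ^+ 2 + (e * \sum_(v <- F) `|phi v|) ^+ 2) / theta ^+ 2.
Proof.
have s01 x : 0 <= s sigma x <= 1 by rewrite /s; case: (sigma x); rewrite ?lexx ?ler01.
set C := rsum [set: V] (fun y => g y * (sigma y)%:R).
have := @history_deviation _ _ B p (Lam M) p0 p1 p_None BL n phi (s sigma) C s01.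
have -> : inner (Lam M) phi phi = \sum_(v <- F) phi v ^+ 2.
  rewrite /inner (fset_sum_split _ FL) [X in _ + X]big1_seq ?addr0 //.
  by move=> z /andP[_]; rewrite !inE /= => /andP[_ /phiF ->]; rewrite mul0r.
have inE' os : inner (Lam M) phi (s sigma \o trace os) =
    \sum_(v <- F) phi v * (sigma (trace os v))%:R.
  rewrite /inner (fset_sum_split _ FL) [X in _ + X]big1_seq ?addr0 //.
  by move=> z /andP[_]; rewrite !inE /= => /andP[_ /phiF ->]; rewrite mul0r.
have bias : (inner (Lam M) (iter n (average B p) phi) (s sigma) - C) ^+ 2 <=
    (e * \sum_(v <- F) `|phi v|) ^+ 2.
  rewrite -[X in X <= _]real_normK ?num_real //.
  apply: lerXn2r; rewrite ?nnegrE ?normr_ge0 //; last exact: mean_bias.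
  by apply: le_trans (mean_bias sigma); exact: normr_ge0.
move=> dev; rewrite ler_pdivlMr ?exprn_gt0 //.
apply: (@le_trans _ _ (\sum_(os <- histories B n)
    weight p os * (inner (Lam M) phi (s sigma \o trace os) - C) ^+ 2)).
  rewrite mulr_suml big_seq [leRHS]big_seq; apply: ler_sum => os osB.
  rewrite -mulrA; apply: ler_wpM2l; first exact: (weight_ge0 p0 osB).
  rewrite indicE inE' ; case: (boolP (sigma \in A os)) => hA; last by rewrite mul0r sqr_ge0.
  move: hA; rewrite inE mul1r /A /= -/C => hA.
  rewrite -[leRHS]real_normK ?num_real //.
  by apply: lerXn2r; rewrite ?nnegrE ?normr_ge0 ?(ltW theta0) ?(ltW hA).
by apply: le_trans dev _; rewrite lerD2l.
Qed.

Lemma history_deviation_probability :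
  (P (\bigcup_(os in [set` histories B n])
       (eta 0 @^-1` A os `&` history_event N B (t / n%:R) os)) <=
   ((\sum_(v <- F) phi v ^+ 2 + (e * \sum_(v <- F) `|phi v|) ^+ 2) / theta ^+ 2)%:E)%E.
Proof.
rewrite (history_lawP bn0 c0 hN heta BE h0 n measurable_history_deviation).
apply: (@le_trans _ _ (\sum_(os <- histories B n) (weight p os)%:E * mu (A os))%E).
  rewrite big_seq [leRHS]big_seq; apply: lee_sum => os osB.
  apply: lee_wpmul2r => //; rewrite lee_fin ler_piMl ?(weight_ge0 p0 osB) //.
  apply: exprn_ile1; first exact: (step_mass_ge0 bn0 c0).
  exact: step_mass_le1.
have mA os : measurable (A os) by exact: measurable_history_deviation.
have -> : (\sum_(os <- histories B n) (weight p os)%:E * mu (A os) =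
   \int[mu]_sigma (\sum_(os <- histories B n) weight p os * \1_(A os) sigma)%:E)%E.
  under [RHS]eq_integral do rewrite -sumEFin.
  rewrite integral_sum //; last first.
    by move=> os; exact: (integrableZl measurableT (weight p os) (integrable_indic mu (mA os))).
  apply: eq_bigr => os _; under [RHS]eq_integral do rewrite EFinM.
  by rewrite integralZl ?integral_indic ?setIT //; exact: integrable_indic.
apply: (@le_trans _ _ (\int[mu]_sigma
   ((\sum_(v <- F) phi v ^+ 2 + (e * \sum_(v <- F) `|phi v|) ^+ 2) / theta ^+ 2)%:E)%E).
  apply: ge0_le_integral => //.
  - move=> sigma _; rewrite lee_fin big_seq sumr_ge0 // => os osB.
    by rewrite mulr_ge0 // (weight_ge0 p0 osB).
  - apply/measurable_EFinP; apply: measurable_sum => os; apply: measurable_funM => //.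
  - by move=> sigma _; rewrite lee_fin history_chebyshev.
by rewrite integral_cst // [X in (_ * X)%E](probability_setT mu) mule1.
Qed.

End OneApproximation.

(** Chebyshev's inequality for the exclusion process. The bound is that of
    independent particles: exclusion does not increase the variance. *)
Lemma deviation_probability (theta : R) : 0 < theta ->
  (P [set w : Om | (theta < `|deviation w|)%R] <=
   ((\sum_(v <- F) phi v ^+ 2) / theta ^+ 2)%:E)%E.
Proof.
move=> th0.
set a := \sum_(v <- F) phi v ^+ 2; set l := \sum_(v <- F) `|phi v|.
have l0 : 0 <= l by apply: sumr_ge0.
apply/lee_addgt0Pr => e e0.
pose r := Num.min 1 (e / (1 + l ^+ 2 / theta ^+ 2)).
have K0 : 0 < 1 + l ^+ 2 / theta ^+ 2 by rewrite ltr_pwDl // divr_ge0 ?sqr_ge0.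
have r0 : 0 < r by rewrite lt_min ltr01 divr_gt0.
have r1 : r <= 1 by rewrite ge_min lexx.
have rK : r * (1 + l ^+ 2 / theta ^+ 2) <= e.
  by rewrite -ler_pdivlMr // ge_min lexx orbT.
have [M [n [FL lamh bad tv]]] := @approximation F r r0.
have pN : 1 / 2 <= step_law bn c (bonds E (Lam M)) (t / n%:R) None.
  rewrite /step_law ler_pdivlMr; first by move: lamh => /=; lra.
  apply: (@mass_gt0 _ _ E _ _ bn0 c0) => [b|]; first exact: (bonds_E hE).
  by rewrite divr_ge0 // ltW.
have dev := history_deviation_probability FL pN tv th0.
set G1 := \bigcup_(os in _) _ in bad.
set G2 := \bigcup_(os in _) _ in dev.
have h0 : 0 <= t / n%:R by rewrite divr_ge0 // ltW.
have mho os : measurable (history_event N (bonds E (Lam M)) (t / n%:R) os).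
  by apply: (measurable_history_event hN) => // b; exact: (bonds_E hE).
have mG1 : measurable G1.
  apply: fin_bigcup_measurable; first exact: finite_seq.
  move=> os _; apply: measurableI => //.
  exact: (measurable_same_history heta).
have mG2 : measurable G2.
  apply: fin_bigcup_measurable; first exact: finite_seq.
  move=> os _; apply: measurableI => //.
  have := exclusion_measurable heta (lexx 0) measurableT
    (measurable_history_deviation theta os).
  by rewrite setTI.
have sub : [set w : Om | (theta < `|deviation w|)%R] `<=` ~` G1 `|` G2.
  move=> w dw; have [[os osB [same ho]]|] := pselect (G1 w); last by left.
  right; exists os => //; split=> //=.
  move: dw; rewrite /= /deviation.
  by rewrite (eq_big_seq (fun v => phi v * (eta 0 w (trace os v))%:R)) // => v vF; rewrite same.
apply: (@le_trans _ _ (P (~` G1 `|` G2))).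
  by apply: le_measure => //; rewrite inE; [exact: measurable_deviation_event|apply: measurableU => //; exact: measurableC].
have := measureU2 P (measurableC mG1) mG2; move/le_trans; apply.
have := leeD bad dev; move/le_trans; apply; rewrite -!EFinD lee_fin.
rewrite mulrDl addrCA lerD2l; apply: le_trans rK; rewrite mulrDr mulr1 lerD2l.
rewrite mulrA ler_pM2r ?invr_gt0 ?exprn_gt0 // exprMn ler_wpM2r ?sqr_ge0 //.
by rewrite expr2 ler_piMr // ltW.
Qed.

End Deviation.

(** * Symmetry of the limiting semigroup *)

Section NonnegInduction.
Import HBNNSimple.
Context d (X : measurableType d) (R : realType).
Variable Q : (X -> R) -> Prop.
Hypothesis Q_indic : forall A, measurable A -> Q \1_A.
Hypothesis Q_add : forall f g : X -> R, measurable_fun setT f -> measurable_fun setT g ->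
  (forall x, 0 <= f x) -> (forall x, 0 <= g x) -> Q f -> Q g -> Q (f \+ g).
Hypothesis Q_scale : forall (r : R) (f : X -> R), measurable_fun setT f ->
  (forall x, 0 <= f x) -> 0 <= r -> Q f -> Q (fun x => r * f x).
Hypothesis Q_limit : forall (f_ : nat -> X -> R) (f : X -> R),
  (forall n, measurable_fun setT (f_ n)) -> measurable_fun setT f ->
  (forall n x, 0 <= f_ n x <= f x) -> (forall x, nondecreasing_seq (f_ ^~ x)) ->
  (forall x, (f_ n x)%:E @[n --> \oo] --> (f x)%:E) ->
  (forall n, Q (f_ n)) -> Q f.

(** A nonnegative measurable function is an increasing limit of simple functions,
    which are finite nonnegative combinations of indicators of level sets. *)
Lemma nonneg_measurable_ind (f : X -> R) :
  measurable_fun setT f -> (forall x, 0 <= f x) -> Q f.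
Proof.
move=> mf f0.
have mEf : measurable_fun setT (EFin \o f) by apply/measurable_EFinP.
have Ef0 x : [set: X] x -> (0 <= (EFin \o f) x)%E by move=> _; rewrite lee_fin.
pose f_ n : X -> R := nnsfun_approx measurableT mEf n.
have cv x : (f_ n x)%:E @[n --> \oo] --> (f x)%:E.
  exact: (cvg_nnsfun_approx measurableT mEf Ef0).
have nd x : nondecreasing_seq (f_ ^~ x).
  by move=> m n mn; have /lefP := nd_nnsfun_approx measurableT mEf mn; apply.
apply: (@Q_limit f_) => //.
- move=> n x; apply/andP; split; first exact: fun_ge0.
  have cvR : f_ ^~ x @ \oo --> f x by exact: (fine_cvg (cv x)).
  rewrite -(cvg_lim _ cvR) //; apply: nondecreasing_cvgn_le => //.
  by apply/cvg_ex; exists (f x).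
- move=> n; rewrite /f_; set g := nnsfun_approx measurableT mEf n.
  have -> : (g : X -> R) = fun x =>
      \sum_(y <- fset_set (range g)) (y * \1_(g @^-1` [set y]) x).
    by apply/funext => x; rewrite fimfunE fsbig_finite.
  have r0 y : y \in enum_fset (fset_set (range g)) -> 0 <= y.
    have -> : (y \in enum_fset (fset_set (range g))) = (y \in fset_set (range g)) by [].
    by rewrite in_fset_set // inE => -[x _ <-].
  elim: (enum_fset (fset_set (range g))) r0 => [|y s IH] s0.
    have -> : (fun x : X => \sum_(y <- [::]) (y * \1_(g @^-1` [set y]) x)) = \1_(set0 : set X).
      by apply/funext => x; rewrite big_nil indicE in_set0.
    exact: Q_indic.
  have -> : (fun x : X => \sum_(z <- y :: s) (z * \1_(g @^-1` [set z]) x)) =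
     (fun x => y * \1_(g @^-1` [set y]) x) \+
     (fun x => \sum_(z <- s) (z * \1_(g @^-1` [set z]) x)).
    by apply/funext => x; rewrite big_cons.
  have mg z : measurable (g @^-1` [set z]) by [].
  have y0 : 0 <= y by apply: s0; rewrite mem_head.
  apply: Q_add.
  + by apply: measurable_funM => //; exact: measurable_indic.
  + by apply: measurable_sum => z; apply: measurable_funM => //; exact: measurable_indic.
  + by move=> x; rewrite mulr_ge0.
  + move=> x; rewrite big_seq sumr_ge0 // => z zs; rewrite mulr_ge0 //.
    by apply: s0; rewrite inE zs orbT.
  + by apply: Q_scale => //; exact: Q_indic.
  + by apply: IH => z zs; apply: s0; rewrite inE zs orbT.
Qed.

End NonnegInduction.

Lemma cvg_integral_nondecreasing d (X : measurableType d) (R : realType)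
    (mu : {measure set X -> \bar R}) (f_ : nat -> X -> \bar R) (f : X -> \bar R) :
  (forall n, measurable_fun setT (f_ n)) -> (forall n x, (0 <= f_ n x)%E) ->
  (forall x, nondecreasing_seq (f_ ^~ x)) ->
  (forall x, f_ n x @[n --> \oo] --> f x) ->
  (\int[mu]_x f_ n x)%E @[n --> \oo] --> (\int[mu]_x f x)%E.
Proof.
move=> mf f0 nd cv.
rewrite (_ : (fun x => f x) = fun x => limn (f_ ^~ x)); last first.
  by apply/funext => x; apply/esym/cvg_lim => //; exact: cv.
by apply: cvg_monotone_convergence.
Qed.

Section SymmetricKernel.
Context (R : realType) (X : pmetricType R) (dW : measure_display)
  (OmW : measurableType dW) (PW : probability OmW R).
Variables (m : {measure set (borel X) -> \bar R}) (W : X -> R -> OmW -> X).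
Hypothesis hW : symmetric_process PW m W.
Variable t : R.
Hypothesis t0 : 0 <= t.

Implicit Types (f g : borel X -> R) (x y u : borel X) (r M : R).

Definition kernel_integral (f : borel X -> R) (x : borel X) : \bar R :=
  (\int[PW]_w (f (W x t w))%:E)%E.

Let T := kernel_integral.

Lemma measurable_along (f : borel X -> R) x : measurable_fun setT f ->
  measurable_fun setT (fun w => (f (W x t w))%:E).
Proof.
move=> mf; apply/measurable_EFinP.
exact: (measurableT_comp mf (process_measurable hW x t0)).
Qed.

Lemma kernel_integral_ge0 f x : (forall y, 0 <= f y) -> (0 <= T f x)%E.
Proof. by move=> f0; apply: integral_ge0 => w _; rewrite lee_fin. Qed.

Lemma kernel_integral_indic (A : set (borel X)) x : measurable A ->
  T \1_A x = PW (W x t @^-1` A).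
Proof.
move=> mA; rewrite /T /kernel_integral.
have mWA : measurable (W x t @^-1` A).
  by rewrite -[X in measurable X]setTI; apply: (process_measurable hW x t0).
rewrite (eq_integral (fun w => (\1_(W x t @^-1` A) w)%:E)) ?integral_indic ?setIT //.
Qed.

Lemma kernel_integralD f g x : measurable_fun setT f -> measurable_fun setT g ->
  (forall y, 0 <= f y) -> (forall y, 0 <= g y) ->
  T (f \+ g) x = (T f x + T g x)%E.
Proof.
move=> mf mg f0 g0; rewrite /T /kernel_integral.
under eq_integral do rewrite EFinD.
by rewrite ge0_integralD //; do ?[by move=> w _; rewrite lee_fin]; exact: measurable_along.
Qed.

Lemma kernel_integralZ r f x : measurable_fun setT f -> (forall y, 0 <= f y) ->
  0 <= r -> T (fun y => r * f y) x = (r%:E * T f x)%E.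
Proof.
move=> mf f0 r0; rewrite /T /kernel_integral.
under eq_integral do rewrite EFinM.
by rewrite ge0_integralZl //; do ?[by move=> w _; rewrite lee_fin]; exact: measurable_along.
Qed.

Lemma kernel_integral_cvg (f_ : nat -> borel X -> R) f x :
  (forall n, measurable_fun setT (f_ n)) -> (forall n y, 0 <= f_ n y) ->
  (forall y, nondecreasing_seq (f_ ^~ y)) ->
  (forall y, (f_ n y)%:E @[n --> \oo] --> (f y)%:E) ->
  T (f_ n) x @[n --> \oo] --> T f x.
Proof.
move=> mf f0 nd cv; apply: cvg_integral_nondecreasing => //.
- by move=> n; exact: measurable_along.
- by move=> n w; rewrite lee_fin.
- by move=> w a b ab; rewrite lee_fin; exact: nd.
Qed.

Lemma kernel_integral_le f g x : measurable_fun setT f -> measurable_fun setT g ->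
  (forall y, 0 <= f y <= g y) -> (T f x <= T g x)%E.
Proof.
move=> mf mg fg; apply: ge0_le_integral => //.
- by move=> w _; rewrite lee_fin; have /andP[] := fg (W x t w).
- exact: measurable_along.
- exact: measurable_along.
- by move=> w _; rewrite lee_fin; have /andP[] := fg (W x t w).
Qed.

Lemma measurable_kernel_integral f : measurable_fun setT f -> (forall y, 0 <= f y) ->
  measurable_fun [set: borel X] (T f).
Proof.
move: f; apply: nonneg_measurable_ind.
- move=> A mA; rewrite (_ : T \1_A = fun x => PW (W x t @^-1` A)).
    exact: (process_kernel hW t0 mA).
  by apply/funext => x; exact: kernel_integral_indic.
- move=> f g mf mg f0 g0 hf hg.
  rewrite (_ : T (f \+ g) = (fun x => T f x + T g x)%E); first exact: emeasurable_funD.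
  by apply/funext => x; exact: kernel_integralD.
- move=> r f mf f0 r0 hf.
  rewrite (_ : T _ = (fun x => r%:E * T f x)%E); first exact: measurable_funeM.
  by apply/funext => x; exact: kernel_integralZ.
- move=> f_ f mf_ mf f_f nd cv hf; apply: (@emeasurable_fun_cvg _ _ _ _ (fun n => T (f_ n))) => // x _.
  by apply: kernel_integral_cvg => // n y; have /andP[] := f_f n y.
Qed.

Let sym (f g : borel X -> R) := 
  (\int[m]_x ((f x)%:E * T g x) = \int[m]_u (T f u * (g u)%:E))%E.

Lemma kernel_integral_fin f (M : R) x : measurable_fun setT f ->
  (forall y, 0 <= f y <= M) -> T f x \is a fin_num.
Proof.
move=> mf fM; rewrite ge0_fin_numE; last first.
  by apply: kernel_integral_ge0 => y; have /andP[] := fM y.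
apply: le_lt_trans (ltry M).
apply: le_trans (_ : (\int[PW]_w (cst M%:E w) <= _)%E); last first.
  by rewrite integral_cst // [X in (_ * X)%E](probability_setT PW) mule1.
apply: ge0_le_integral => //.
- by move=> w _; rewrite lee_fin; have /andP[] := fM (W x t w).
- exact: measurable_along.
- by move=> w _; rewrite lee_fin; have /andP[] := fM (W x t w).
Qed.

Lemma sym_indic (A B : set (borel X)) : measurable A -> measurable B -> sym \1_A \1_B.
Proof.
move=> mA mB; have := process_symmetric hW t0 (measurableX mA mB).
rewrite /sym.
rewrite (eq_integral (fun x => ((\1_A x)%:E * T \1_B x)%E)); last first.
  move=> x _; rewrite kernel_integral_indic // indicE.
  case: (boolP (x \in A)); rewrite ?inE ?mul1e ?mul0e => xA.
    by congr (PW _); apply/seteqP; split=> w /=; tauto.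
  rewrite (_ : [set w | _] = set0) ?measure0 //.
  by apply/seteqP; split=> w //= []; move/negP: xA; rewrite inE.
move=> ->; apply: eq_integral => u _; rewrite kernel_integral_indic // indicE.
case: (boolP (u \in B)); rewrite ?inE ?mule1 ?mule0 => uB.
  by congr (PW _); apply/seteqP; split=> w /=; tauto.
rewrite (_ : [set w | _] = set0) ?measure0 //.
by apply/seteqP; split=> w //= []; move/negP: uB; rewrite inE.
Qed.

Lemma sym_swap f g : sym f g -> sym g f.
Proof.
rewrite /sym => e; under eq_integral do rewrite muleC.
by rewrite -e; apply: eq_integral => x _; rewrite muleC.
Qed.

(** Symmetry passes from indicators to all functions, one argument at a time. *)
Lemma sym_extend (g : borel X -> R) (M : R) : measurable_fun setT g ->
  (forall y, 0 <= g y <= M) ->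
  (forall A, measurable A -> sym \1_A g) ->
  forall f, measurable_fun setT f -> (forall y, 0 <= f y) -> sym f g.
Proof.
move=> mg gM hA.
have g0 y : 0 <= g y by have /andP[] := gM y.
have mTg := measurable_kernel_integral mg g0.
have Tg0 x : (0 <= T g x)%E by exact: kernel_integral_ge0.
have mE (f : borel X -> R) : measurable_fun setT f -> measurable_fun setT (fun x => (f x)%:E).
  by move=> mf; apply/measurable_EFinP.
apply: nonneg_measurable_ind; first exact: hA.
- move=> f1 f2 m1 m2 f10 f20 h1 h2; rewrite /sym.
  under eq_integral do rewrite EFinD ge0_muleDl ?lee_fin //.
  rewrite ge0_integralD; last 5 first.
  + exact: measurableT.
  + by move=> x _; rewrite mule_ge0 ?lee_fin.
  + by apply: emeasurable_funM => //; exact: mE.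
  + by move=> x _; rewrite mule_ge0 ?lee_fin.
  + by apply: emeasurable_funM => //; exact: mE.
  rewrite h1 h2 -ge0_integralD; last 5 first.
  + exact: measurableT.
  + by move=> x _; rewrite mule_ge0 ?lee_fin // kernel_integral_ge0.
  + by apply: emeasurable_funM; [exact: measurable_kernel_integral|exact: mE].
  + by move=> x _; rewrite mule_ge0 ?lee_fin // kernel_integral_ge0.
  + by apply: emeasurable_funM; [exact: measurable_kernel_integral|exact: mE].
  apply: eq_integral => u _; rewrite kernel_integralD //.
  by apply/esym/ge0_muleDl; exact: kernel_integral_ge0.
- move=> r f mf f0 r0 h; rewrite /sym.
  under eq_integral do rewrite EFinM -muleA.
  under [RHS]eq_integral do rewrite kernel_integralZ // -muleA.
  rewrite ge0_integralZl; [|exact: measurableT| | |by rewrite lee_fin].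
  + rewrite ge0_integralZl; [by rewrite h|exact: measurableT| | |by rewrite lee_fin].
      by apply: emeasurable_funM; [exact: measurable_kernel_integral|exact: mE].
    by move=> x _; rewrite mule_ge0 ?lee_fin // kernel_integral_ge0.
  + by apply: emeasurable_funM => //; exact: mE.
  + by move=> x _; rewrite mule_ge0 ?lee_fin.
- move=> f_ f mf_ mf f_f nd cv h.
  have f_0 n y : 0 <= f_ n y by have /andP[] := f_f n y.
  have l1 : (\int[m]_x ((f_ n x)%:E * T g x))%E @[n --> \oo] -->
      (\int[m]_x ((f x)%:E * T g x))%E.
    apply: cvg_integral_nondecreasing.
    + by move=> n; apply: emeasurable_funM => //; exact: mE.
    + by move=> n x; rewrite mule_ge0 ?lee_fin.
    + by move=> x a b ab; rewrite lee_wpmul2r // lee_fin; exact: nd.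
    + move=> x; apply: cvgeZr; first exact: (kernel_integral_fin x mg gM).
      exact: cv.
  have l2 : (\int[m]_u (T (f_ n) u * (g u)%:E))%E @[n --> \oo] -->
      (\int[m]_u (T f u * (g u)%:E))%E.
    apply: cvg_integral_nondecreasing.
    + move=> n; apply: emeasurable_funM; last exact: mE.
      by apply: measurable_kernel_integral.
    + by move=> n x; rewrite mule_ge0 ?lee_fin // kernel_integral_ge0.
    + move=> x a b ab; rewrite lee_wpmul2r ?lee_fin //.
      by apply: kernel_integral_le => // y; rewrite f_0; exact: nd.
    + by move=> x; apply: cvgeZr => //; exact: kernel_integral_cvg.
  have e : (fun n => \int[m]_x ((f_ n x)%:E * T g x))%E =
      (fun n => \int[m]_u (T (f_ n) u * (g u)%:E))%E by apply/funext => n; exact: h.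
  rewrite e in l1; exact: (cvg_unique (@ereal_hausdorff R) l1 l2).
Qed.

Lemma kernel_integral_sym (f g : borel X -> R) (M : R) :
  measurable_fun setT f -> measurable_fun setT g ->
  (forall y, 0 <= f y <= M) -> (forall y, 0 <= g y <= M) ->
  (\int[m]_x ((f x)%:E * T g x) = \int[m]_u (T f u * (g u)%:E))%E.
Proof.
move=> mf mg fM gM.
have f0 y : 0 <= f y by have /andP[] := fM y.
have g0 y : 0 <= g y by have /andP[] := gM y.
have indic1 (A : set (borel X)) y : (0 : R) <= \1_A y <= 1.
  by rewrite indicE ler0n lern1 leq_b1.
apply: (sym_extend mg gM) => // A mA; apply: sym_swap.
have mI : measurable_fun [set: borel X] (\1_A : borel X -> R) by exact: measurable_indic.
have hB (B : set (borel X)) : measurable B -> sym \1_B \1_A.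
  by move=> mB; exact: sym_indic.
exact: (sym_extend mI (indic1 R A) hB mg g0).
Qed.

End SymmetricKernel.

(** * Compactly supported functions *)

Section CompactSupport.
Context (R : realType) (X : pmetricType R).
Implicit Types (phi : X -> R).

Definition support phi : set X := closure [set x | phi x != 0].

Lemma Cc_out phi x : ~ support phi x -> phi x = 0.
Proof.
by move=> hx; apply/eqP/negPn/negP => px; apply: hx; exact: subset_closure.
Qed.

(** Local properties are made uniform on a compact set. *)
Lemma compact_cover_open (K : set X) (Q : X -> set X -> Prop) : compact K ->
  (forall x, exists U, [/\ open U, U x & Q x U]) ->
  exists2 D : {fset X}, [set` D] `<=` K &
    exists U : X -> set X, (forall x, Q x (U x) /\ open (U x)) /\
      K `<=` \bigcup_(x in [set` D]) U x.
Proof.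
move=> cK hQ; have [U hU] := choice hQ.
move: cK; rewrite compact_cover => /(_ X K U).
case.
- by move=> x _; have [] := hU x.
- by move=> x Kx; exists x => //; have [] := hU x.
move=> D DK cov; exists D.
  by move=> x /DK; rewrite inE.
by exists U; split=> // x; have [] := hU x.
Qed.

Lemma Cc_bounded phi : Cc phi -> exists M, forall x, `|phi x| <= M.
Proof.
move=> [cphi cK].
have cvg_phi x : phi y @[y --> x] --> phi x by exact: cphi.
have [|D _ [U [hU cov]]] := @compact_cover_open _
    (fun x U => forall y, U y -> `|phi y| <= `|phi x| + 1) cK.
  move=> x.
  have : \forall y \near x, `|phi y| <= `|phi x| + 1.
    by apply: (cvgr_norm_le _ (cvg_phi x)); rewrite ltrDl.
  move=> /nbhs_interior; rewrite nbhsE => -[U [oU Ux] hU].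
  by exists U; split => // y /hU; exact: interior_subset.
exists (\sum_(x <- D) (`|phi x| + 1)) => y.
have [Ky|nK] := pselect (support phi y); last by rewrite Cc_out // normr0 sumr_ge0.
have [x xD Uy] := cov _ Ky.
apply: le_trans ((hU x).1 _ Uy) _.
by rewrite [leRHS](big_fsetD1 x) //= lerDl sumr_ge0.
Qed.

Lemma continuous_borel phi : continuous phi -> measurable_fun setT (phi : borel X -> R).
Proof.
move=> cphi; apply: (measurability _ (RGenOInfty.measurableE R)).
move=> _ [_ [r ->] <-]; rewrite setTI; apply: sub_sigma_algebra.
by move/continuousP : cphi; apply; exact: interval_open.
Qed.

Lemma measurable_support phi : measurable (support phi : set (borel X)).
Proof.
rewrite -[X in measurable X]setCK; apply: measurableC; apply: sub_sigma_algebra.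
by apply: closed_openC; exact: closed_closure.
Qed.

Lemma radon_support (m : {measure set (borel X) -> \bar R}) phi :
  radon m -> Cc phi -> (m (support phi) < +oo)%E.
Proof.
move=> [locfin _] [_ cK].
have [|D _ [U [hU cov]]] := @compact_cover_open _ (fun _ U => (m U < +oo)%E) cK.
  by move=> x; have [U [oU Ux mU]] := locfin x; exists U.
have mU x : measurable (U x : set (borel X)).
  by apply: sub_sigma_algebra; exact: (hU x).2.
apply: (@le_lt_trans _ _ (m (\bigcup_(x in [set` D]) U x))).
  apply: le_measure; rewrite ?inE //; first exact: measurable_support.
  by apply: fin_bigcup_measurable.
rewrite bigcup_fset.
apply: (@le_lt_trans _ _ (\sum_(x <- D) m (U x))%E).
  elim: (enum_fset D) => [|x s IH]; first by rewrite !big_nil measure0.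
  rewrite !big_cons; apply: le_trans (measureU2 _ _ _) _ => //.
    by apply: bigsetU_measurable.
  exact: leeD2l.
elim: (enum_fset D) => [|x s IH]; first by rewrite big_nil.
by rewrite big_cons lte_add_pinfty //; exact: (hU x).1.
Qed.

Lemma Cc_locally_finite (V : set X) phi : locally_finite V -> Cc phi ->
  finite_set [set v : V | phi (val v) != 0].
Proof.
move=> lf [_ cK].
have [|D _ [U [hU cov]]] := @compact_cover_open _ (fun _ U => finite_set (U `&` V)) cK.
  move=> x; have [U nU fU] := lf x.
  move: nU; rewrite nbhsE => -[U' [oU' U'x] U'U]; exists U'; split=> //.
  by apply: sub_finite_set fU => y [/U'U].
have fin : finite_set (support phi `&` V).
  apply: (@sub_finite_set _ _ (\bigcup_(x in [set` D]) (U x `&` V))).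
    by move=> y [/cov[x xD Uy] Vy]; exists x.
  by apply: bigcup_finite => // x _; exact: (hU x).1.
apply: (@sub_finite_set _ _ ((val : V -> X) @^-1` (support phi `&` V))).
  by move=> v pv; split; [exact: subset_closure|exact: (set_valP v)].
by apply: finite_preimage fin => u v _ _; exact: val_inj.
Qed.

Lemma Cc_sqr phi : Cc phi -> Cc (fun x => phi x ^+ 2).
Proof.
move=> [cphi cK]; split.
  rewrite (_ : (fun x => phi x ^+ 2) = fun x => phi x * phi x).
    by move=> x; apply: cvgM; exact: cphi.
  by apply/funext => x; rewrite expr2.
apply: (subclosed_compact _ cK); first exact: closed_closure.
by apply: closure_subset => x /=; apply: contra => /eqP ->; rewrite expr0n.
Qed.

End CompactSupport.

Section Pairing.
Context (R : realType) (X : pmetricType R) (dW : measure_display)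
  (OmW : measurableType dW) (PW : probability OmW R).
Variables (m : {measure set (borel X) -> \bar R}) (W : X -> R -> OmW -> X).
Hypothesis hm : radon m.
Hypothesis hW : symmetric_process PW m W.
Variable t : R.
Hypothesis t0 : 0 <= t.

Let T := kernel_integral PW W t.
Let K := kernel_average PW W t.

Lemma kernel_averageE (f : borel X -> R) (M : R) x : measurable_fun setT f ->
  (forall y, 0 <= f y <= M) -> T f x = (K f x)%:E.
Proof.
move=> mf fM; rewrite /K /kernel_average unlock fineK //.
exact: (kernel_integral_fin hW t0 x mf fM).
Qed.

Lemma kernel_average_bound (f : borel X -> R) (M : R) x : measurable_fun setT f ->
  (forall y, 0 <= f y <= M) -> 0 <= K f x <= M.
Proof.
move=> mf fM; have M0 : 0 <= M by have /andP[a b] := fM x; exact: le_trans b.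
have f0 y : 0 <= f y by have /andP[] := fM y.
rewrite -!lee_fin -(kernel_averageE x mf fM); apply/andP; split.
  exact: kernel_integral_ge0.
apply: le_trans (kernel_integral_le hW t0 x mf (measurable_cst M) fM) _.
rewrite /kernel_integral (_ : (fun w => _) = cst M%:E) //.
by rewrite integral_cst // [X in (_ * X)%E](probability_setT PW) mule1.
Qed.

Lemma measurable_kernel_average (f : borel X -> R) (M : R) : measurable_fun setT f ->
  (forall y, 0 <= f y <= M) -> measurable_fun [set: borel X] (K f).
Proof.
move=> mf fM; apply/measurable_EFinP.
rewrite (_ : EFin \o K f = T f).
  by apply: (measurable_kernel_integral hW t0 mf) => y; have /andP[] := fM y.
by apply/funext => x; rewrite /= (kernel_averageE x mf fM).
Qed.

(** Boundedness keeps all values finite, so the symmetry of the extended real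
    integrals is one of real integrals. *)
Lemma pairing_nonneg (f g : borel X -> R) (M : R) :
  measurable_fun setT f -> measurable_fun setT g ->
  (forall y, 0 <= f y <= M) -> (forall y, 0 <= g y <= M) ->
  (\int[m]_x (f x * K g x)%:E = \int[m]_u (K f u * g u)%:E)%E.
Proof.
move=> mf mg fM gM.
rewrite (eq_integral (fun x => ((f x)%:E * T g x)%E)); last first.
  by move=> x _; rewrite EFinM -(kernel_averageE x mg gM).
rewrite (kernel_integral_sym hW t0 mf mg fM gM); apply: eq_integral => u _.
by rewrite EFinM -(kernel_averageE u mf fM).
Qed.

Lemma integrable_bounded_support (S : set (borel X)) (h : borel X -> R) (M : R) :
  measurable S -> (m S < +oo)%E -> measurable_fun setT h ->
  (forall x, `|h x| <= M) -> (forall x, ~ S x -> h x = 0) ->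
  m.-integrable setT (fun x => (h x)%:E).
Proof.
move=> mS fS mh hM h0; apply/integrableP; split; first exact/measurable_EFinP.
have M0 : 0 <= M by apply: le_trans (hM point); exact: normr_ge0.
apply: (@le_lt_trans _ _ (\int[m]_x (M%:E * (\1_S x)%:E))%E).
  apply: ge0_le_integral => //.
  - by apply: measurableT_comp => //; apply/measurable_EFinP.
  - by apply: measurable_funeM; apply/measurable_EFinP; exact: measurable_indic.
  - move=> x _; rewrite abse_EFin -EFinM lee_fin indicE.
    case: (boolP (x \in S)); rewrite ?inE ?mulr1 // => xS.
    by rewrite h0 ?normr0 ?mulr0 //; move/negP: xS; rewrite inE.
rewrite ge0_integralZl; [|exact: measurableT| | |by rewrite lee_fin].
- by rewrite integral_indic // setIT lte_mul_pinfty.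
- by apply/measurable_EFinP; exact: measurable_indic.
- by move=> x _; rewrite lee_fin.
Qed.

Definition pos_part (phi : X -> R) : borel X -> R := fun x => Num.max (phi x) 0.

Lemma pos_partB (phi : X -> R) x : phi x = pos_part phi x - pos_part (\- phi) x.
Proof.
by rewrite /pos_part /Num.max /=; case: ltP => ?; case: ltP => ?; lra.
Qed.

Lemma pos_part_bound (phi : X -> R) (M : R) x : (forall y, `|phi y| <= M) ->
  0 <= pos_part phi x <= M.
Proof.
move=> hM; rewrite /pos_part le_max lexx orbT ge_max /=.
by rewrite (le_trans (ler_norm _) (hM x)) (le_trans (normr_ge0 _) (hM x)).
Qed.

Lemma measurable_pos_part (phi : X -> R) : measurable_fun setT (phi : borel X -> R) ->
  measurable_fun setT (pos_part phi).
Proof. by move=> mphi; apply: measurable_maxr. Qed.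

Lemma kernel_averageB (phi : X -> R) (M : R) x :
  measurable_fun setT (phi : borel X -> R) -> (forall y, `|phi y| <= M) ->
  K phi x = K (pos_part phi) x - K (pos_part (\- phi)) x.
Proof.
move=> mphi hM.
have mN : measurable_fun setT ((\- phi) : borel X -> R) by exact: measurableT_comp.
have hN y : `|(\- phi) y| <= M by rewrite normrN.
have int (f : borel X -> R) : measurable_fun setT f -> (forall y, 0 <= f y <= M) ->
    PW.-integrable setT (EFin \o (fun w => f (W x t w))).
  move=> mf fM; apply/integrableP; split; first exact: (measurable_along hW t0).
  under eq_integral => w _.
    rewrite /= ger0_norm; last by have /andP[] := fM (W x t w).
    over.
  have := kernel_integral_fin hW t0 x mf fM.
  by rewrite ge0_fin_numE // kernel_integral_ge0 // => y; have /andP[] := fM y.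
rewrite /K /kernel_average !unlock.
have := RintegralB measurableT (int _ (measurable_pos_part mphi) (fun y => pos_part_bound y hM))
  (int _ (measurable_pos_part mN) (fun y => pos_part_bound y hN)).
rewrite /Rintegral => <-; congr fine; apply: eq_integral => w _.
by rewrite -pos_partB.
Qed.

(** The nonnegative case is applied to the positive and negative parts of [phi].
    Their pairings with [rho] are finite because the support of [phi] has finite
    measure, so that they can be subtracted. *)
Lemma pairing_sym (phi rho : X -> R) : Cc phi -> (forall x, 0 <= rho x) ->
  (exists M : R, forall x, rho x <= M) ->
  measurable_fun [set: borel X] (rho : borel X -> R) ->
  \int[m]_u (phi u * K rho u) = \int[m]_u (K phi u * rho u).
Proof.
move=> Cphi rho0 [M1 hM1] mrho.
have [M2 hM2] := Cc_bounded Cphi.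
pose M := Num.max M1 M2.
have rhoM y : 0 <= rho y <= M by rewrite rho0 le_max hM1.
have phiM y : `|phi y| <= M by rewrite le_max hM2 orbT.
have phiNM y : `|(\- phi) y| <= M by rewrite normrN.
have mphi : measurable_fun setT (phi : borel X -> R) by apply: continuous_borel; case: Cphi.
have mphiN : measurable_fun setT ((\- phi) : borel X -> R) by exact: measurableT_comp.
have mS := measurable_support phi.
have fS := radon_support hm Cphi.
have mK := measurable_kernel_average mrho rhoM.
have KM y := kernel_average_bound y mrho rhoM.
have M0 : 0 <= M by have /andP[a b] := rhoM point; exact: le_trans b.
have one (f : borel X -> R) : measurable_fun setT f -> (forall y, 0 <= f y <= M) ->
    (forall y, ~ support phi y -> f y = 0) ->
    [/\ m.-integrable setT (fun x => (f x * K rho x)%:E),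
        m.-integrable setT (fun x => (K f x * rho x)%:E) &
        \int[m]_u (f u * K rho u) = \int[m]_u (K f u * rho u)].
  move=> mf fM f0.
  have e := pairing_nonneg mf mrho fM rhoM.
  have i1 : m.-integrable setT (fun x => (f x * K rho x)%:E).
    apply: (@integrable_bounded_support (support phi) _ (M * M)) => //.
    - exact: measurable_funM.
    - move=> x; have /andP[a b] := fM x; have /andP[a' b'] := KM x.
      by rewrite ger0_norm ?mulr_ge0 // ler_pM.
    - by move=> x /f0 ->; rewrite mul0r.
  split=> //; last by rewrite /Rintegral e.
  have mKf := measurable_kernel_average mf fM.
  have Kf0 x : 0 <= K f x * rho x.
    by have /andP[a _] := kernel_average_bound x mf fM; rewrite mulr_ge0.
  apply/integrableP; split; first by apply/measurable_EFinP; exact: measurable_funM.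
  under eq_integral do rewrite /= ger0_norm //.
  rewrite -e; move/integrableP : i1 => [_]; apply: le_lt_trans.
  rewrite le_eqVlt; apply/orP; left; apply/eqP; apply: eq_integral => x _.
  rewrite /= ger0_norm // mulr_ge0 //; first by have /andP[] := fM x.
  by have /andP[] := KM x.
have out1 y : ~ support phi y -> pos_part phi y = 0.
  by move=> /Cc_out e; rewrite /pos_part e maxxx.
have out2 y : ~ support phi y -> pos_part (\- phi) y = 0.
  by move=> /Cc_out e; rewrite /pos_part /= e oppr0 maxxx.
have [i1 j1 e1] := one _ (measurable_pos_part mphi) (fun y => pos_part_bound y phiM) out1.
have [i2 j2 e2] := one _ (measurable_pos_part mphiN) (fun y => pos_part_bound y phiNM) out2.
transitivity (\int[m]_u (pos_part phi u * K rho u - pos_part (\- phi) u * K rho u)).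
  by congr fine; apply: eq_integral => u _; rewrite -mulrBl -pos_partB.
rewrite RintegralB // e1 e2 -RintegralB //.
congr fine; apply: eq_integral => u _; rewrite -mulrBl.
by rewrite (kernel_averageB u mphi phiM).
Qed.

End Pairing.

(** * The hydrodynamic limit *)

Lemma finite_exhaustion (X : choiceType) (V : set X) : countable V ->
  exists Lam : nat -> {fset V},
    (forall m m', (m <= m')%N -> {subset Lam m <= Lam m'}) /\
    (forall x, exists m, x \in Lam m).
Proof.
move=> /countable_injP[f injf].
have fin (m : nat) : finite_set [set v : V | (f (val v) < m)%N].
  apply: (@finite_preimage _ _ [set k | (k < m)%N] (fun v : V => f (val v))).
    move=> u v _ _ e; apply: val_inj; apply: injf e; exact: (valP _).
  exact: finite_II.
exists (fun m => fset_set [set v : V | (f (val v) < m)%N]); split.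
  move=> m m' mm' v; rewrite !in_fset_set // !inE /= => h.
  exact: leq_trans mm'.
by move=> v; exists (f (val v)).+1; rewrite in_fset_set // inE /=.
Qed.

Lemma esum_l1_bound (R : realType) (T : choiceType) (f : T -> R) (C : R) :
  (\esum_(x in [set: T]) (`|f x|)%:E <= C%:E)%E -> l1_bound setT f C.
Proof.
move=> le_C G _; rewrite -lee_fin; apply: le_trans le_C.
apply: esum_ge; exists [set` G] => //.
by rewrite -fsbig_seq ?fset_uniq // sumEFin.
Qed.

Section OneGraph.
Context (R : realType) (V : choiceType).
Variables (E : set (set V)) (bn : R) (c : set V -> R).
Hypothesis bn0 : 0 < bn.
Hypothesis c0 : forall b, E b -> 0 <= c b.
Hypothesis hE : unoriented_graph E.
Context (d : measure_display) (Om : measurableType d) (P : probability Om R).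
Variables (N : set V -> R -> Om -> nat) (eps : R) (mu : probability (config V) R)
  (eta : R -> Om -> V -> bool).
Hypothesis eps0 : 0 < eps.
Hypothesis hN : poisson_clocks P bn E c N.
Hypothesis heta : exclusion_process P E N eps mu eta.
Context (dY : measure_display) (OmY : measurableType dY) (PY : probability OmY R).
Variable (Y : V -> R -> OmY -> V).
Hypothesis hY : random_walk PY (walk_generator bn E c) Y.
Variable Lam : nat -> {fset V}.
Hypothesis Lam_mono : forall m m', (m <= m')%N -> {subset Lam m <= Lam m'}.
Hypothesis Lam_cover : forall x, exists m, x \in Lam m.
Variable t : R.
Hypothesis t0 : 0 < t.
Variables (F : {fset V}) (phi : V -> R).
Hypothesis phiF : forall v, v \notin F -> phi v = 0.

(** The deviation [delta] is divided into three parts: the fluctuation of the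
    process, the replacement of the semigroup of the walk by [k], which costs at
    most its distance in l1 since occupation numbers are at most 1, and the
    deviation of the initial field. *)
Lemma field_probability (k : V -> R) (a delta D : R) : 0 < a -> 0 < delta ->
  (\esum_(x in [set: V]) (`|semigroup PY Y t phi x - k x|)%:E <= (a * (delta / 3))%:E)%E ->
  (P [set w : Om | (delta < `|a^-1 * rsum [set: V] (fun x => phi x * (eta t w x)%:R) - D|)%R]
   <= ((\sum_(v <- F) phi v ^+ 2) / (a * (delta / 3)) ^+ 2)%:E
      + mu [set s : V -> bool | (delta / 3 < `|a^-1 * rsum [set: V] (fun x => k x * (s x)%:R) - D|)%R])%E.
Proof.
move=> a0 d0 /esum_l1_bound hk.
have th0 : 0 < a * (delta / 3) by rewrite mulr_gt0 // divr_gt0.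
have := deviation_probability bn0 c0 hE eps0 hN heta hY Lam_mono Lam_cover t0 phiF th0.
set G1 := [set w : Om | (a * _ < _)%R] => dev.
set G2 := (X in (_ + mu X)%E).
have mf (g : V -> R) : measurable_fun [set: config V] (fun s : config V =>
    `|a^-1 * rsum [set: V] (fun x => g x * (s x)%:R) - D|).
  apply: (measurableT_comp (@normr_measurable R setT)).
  apply: measurable_funB => //; apply: measurable_funM => //.
  exact: measurable_rsum_config Lam_mono Lam_cover _.
have mev (g : V -> R) (r : R) : measurable ([set s : V -> bool |
    r < `|a^-1 * rsum [set: V] (fun x => g x * (s x)%:R) - D|] : set (config V)).
  have := measurable_fun_ltr (measurable_cst r) (mf g).
  move=> /(_ measurableT [set true]) /(_ (ltac:(by []))).
  by rewrite setTI.
have mG1 : measurable G1.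
  exact: (measurable_deviation_event heta PY Y Lam_mono Lam_cover t0 F phi).
have mG2 : measurable (eta 0 @^-1` G2).
  have := exclusion_measurable heta (lexx 0) measurableT (mev k (delta / 3)).
  by rewrite setTI.
have mev_t : measurable [set w : Om |
    delta < `|a^-1 * rsum [set: V] (fun x => phi x * (eta t w x)%:R) - D|].
  have := exclusion_measurable heta (ltW t0) measurableT (mev phi delta).
  by rewrite setTI.
rewrite -(exclusion_initial_law heta (mev k (delta / 3))).
have l1g := semigroup_l1 bn0 c0 hE eps0 hN heta hY Lam_mono Lam_cover t0 phiF.
have s01 (f : V -> R) (s : V -> bool) y : `|f y * (s y)%:R| <= `|f y|.
  by rewrite normrM ler_piMr //; case: (s y); rewrite ?normr1 ?normr0.
have near_k (s : V -> bool) : `|rsum [set: V] (fun y => semigroup PY Y t phi y * (s y)%:R)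
      - rsum [set: V] (fun y => k y * (s y)%:R)| <= a * (delta / 3).
  apply: (@rsum_dist_le _ _ _ _ (\sum_(v <- F) `|phi v|)
      (\sum_(v <- F) `|phi v| + a * (delta / 3))).
  - move=> H HT; apply: le_trans (l1g _ HT).
    by apply: ler_sum => y _; exact: s01.
  - move=> H HT; apply: le_trans (lerD (l1g _ HT) (hk _ HT)).
    rewrite -big_split /=; apply: ler_sum => y _; apply: le_trans (s01 _ _ _) _.
    have := ler_normB (semigroup PY Y t phi y) (semigroup PY Y t phi y - k y).
    by rewrite opprB [X in `|X|]addrC subrK.
  - move=> H HT; apply: le_trans (hk _ HT).
    by apply: ler_sum => y _; rewrite /= -mulrBl; exact: (s01 (fun y => _ y - k y)).
apply: (@le_trans _ _ (P (G1 `|` eta 0 @^-1` G2))).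
  apply: le_measure; rewrite ?inE //; first exact: measurableU.
  move=> w /= hw; apply: contrapT => /not_orP[n1 n2].
  move: n1 n2 hw; rewrite /G1 /G2 /= => /negP; rewrite -leNgt => n1 /negP; rewrite -leNgt => n2.
  apply/negP; rewrite -leNgt.
  have n3 := near_k (eta 0 w).
  have e1 : rsum [set: V] (fun x => phi x * (eta t w x)%:R) =
      \sum_(v <- F) phi v * (eta t w v)%:R.
    by apply: rsum_finite => // v _ /phiF ->; rewrite mul0r.
  move: n1 n2 n3; rewrite /deviation -e1.
  set r1 := rsum _ _; set r2 := rsum _ _; set r3 := rsum _ _ => n1 n2 n3.
  have -> : a^-1 * r1 - D = a^-1 * (r1 - r2) + a^-1 * (r2 - r3) + (a^-1 * r3 - D).
    by ring.
  have sc x : `|x| <= a * (delta / 3) -> `|a^-1 * x| <= delta / 3.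
    by move=> hx; rewrite normrM gtr0_norm ?invr_gt0 // ler_pdivrMl.
  apply: le_trans (ler_normD _ _) _.
  have h1 := sc _ n1; have h2 := sc _ n3.
  have h3 := ler_normD (a^-1 * (r1 - r2)) (a^-1 * (r2 - r3)).
  by lra.
have := measureU2 P mG1 mG2; move/le_trans; apply.
exact: leeD.
Qed.

End OneGraph.

Theorem theorem2p1 (R : realType) (X : pmetricType R)
  (* the space, the graphs and the vague convergence of m_n to m *)
  (m : {measure set (borel X) -> \bar R}) (hm : radon m)
  (V : nat -> set X)
  (hVfin : forall n, locally_finite (V n))
  (hVcount : forall n, countable (V n))
  (E : forall n, set (set (V n))) (hE : forall n, unoriented_graph (E n))
  (a : nat -> R) (ha0 : forall n, 0 < a n) (ha : a n @[n --> \oo] --> +oo)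
  (hvague : forall phi : X -> R, Cc phi ->
     (a n)^-1 * rsum [set: V n] (fun x : V n => phi (val x)) @[n --> \oo]
       --> \int[m]_u phi u)
  (* the Poisson processes and the standing percolation assumption *)
  (bs : nat -> R) (hbs : forall n, 0 < bs n)
  (c : forall n, set (V n) -> R) (hc : forall n b, E n b -> 0 <= c n b)
  (d : measure_display) (Om : nat -> measurableType d)
  (P : forall n, probability (Om n) R)
  (N : forall n, set (V n) -> R -> Om n -> nat)
  (hN : forall n, poisson_clocks (P n) (bs n) (E n) (c n) (N n))
  (eps : nat -> R)
  (heps : forall n, percolation_bound (P n) (E n) (N n) (eps n))
  (* the random walks *)
  (dY : measure_display) (OmY : nat -> measurableType dY)
  (PY : forall n, probability (OmY n) R)
  (Y : forall n, V n -> R -> OmY n -> V n)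
  (hY : forall n,
     random_walk (PY n) (walk_generator (bs n) (E n) (c n)) (Y n))
  (* the limiting process and the homogenization property *)
  (dW : measure_display) (OmW : measurableType dW) (PW : probability OmW R)
  (W : X -> R -> OmW -> X) (hW : symmetric_process PW m W)
  (homogenization : forall t : R, 0 <= t -> forall phi : X -> R, Cc phi ->
     ((a n)^-1%:E * \esum_(x in [set: V n])
        (`| semigroup (PY n) (Y n) t (fun y : V n => phi (val y)) x
            - kernel_average PW W t phi (val x) |)%:E)%E @[n --> \oo]
       --> 0%E)
  (* the initial profile and the initial laws *)
  (rho0 : X -> R) (hrho0 : forall x, 0 <= rho0 x)
  (hrho0_bounded : exists M : R, forall x, rho0 x <= M)
  (hrho0_borel : measurable_fun [set: borel X] (rho0 : borel X -> R))
  (mu : forall n, probability (config (V n)) R)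
  (hmu : forall (delta t : R) (psi : X -> R), 0 < delta -> 0 <= t -> Cc psi ->
     let phi := kernel_average PW W t psi in
     mu n [set eta : V n -> bool |
       delta < `| (a n)^-1 *
                    rsum [set: V n] (fun x : V n => phi (val x) * (eta x)%:R)
                  - \int[m]_u (phi u * rho0 u) |] @[n --> \oo]
       --> 0%E)
  (* the exclusion processes with initial laws mu n *)
  (eta : forall n, R -> Om n -> V n -> bool)
  (heta : forall n,
     exclusion_process (P n) (E n) (N n) (eps n) (mu n) (eta n)) :
  forall (delta t : R) (phi : X -> R), 0 < delta -> 0 < t -> Cc phi ->
    P n [set w : Om n |
      delta < `| (a n)^-1 *
                   rsum [set: V n]
                     (fun x : V n => phi (val x) * (eta n t w x)%:R)
                 - \int[m]_u (phi u * kernel_average PW W t rho0 u) |]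
      @[n --> \oo]
      --> 0%E.
Proof.
move=> delta t phi d0 t0 Cphi.
have t0' : 0 <= t by exact: ltW.
have d3 : 0 < delta / 3 by rewrite divr_gt0.
pose k n (v : V n) := kernel_average PW W t phi (val v).
pose g n := semigroup (PY n) (Y n) t (fun v : V n => phi (val v)).
pose D := \int[m]_u (kernel_average PW W t phi u * rho0 u).
have DE : \int[m]_u (phi u * kernel_average PW W t rho0 u) = D.
  exact: (pairing_sym hm hW t0' Cphi hrho0 hrho0_bounded hrho0_borel).
rewrite DE.
have finF n := Cc_locally_finite (hVfin n) Cphi.
pose F n : {fset V n} := fset_set [set v : V n | phi (val v) != 0].
have phiF n (v : V n) : v \notin F n -> phi (val v) = 0.
  rewrite (in_fset_set (finF n)) => h; apply/eqP/negPn/negP => ph.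
  by move/negP: h; apply; rewrite inE.
(* [phi ^ 2] is again a test function, so [(1 / a_n) sum phi ^ 2] converges, and
   the variance bound has one more factor [1 / a_n] *)
pose q n := (a n)^-1 * rsum [set: V n] (fun x : V n => phi (val x) ^+ 2).
have cq : q n @[n --> \oo] --> \int[m]_u (phi u ^+ 2) by exact: (hvague _ (Cc_sqr Cphi)).
have ca : (a n)^-1 @[n --> \oo] --> (0 : R).
  apply/cvgrPdist_lt => e e0; move/cvgryPgt : ha => /(_ e^-1).
  apply: filterS => n hn; rewrite sub0r normrN gtr0_norm ?invr_gt0 //.
  by rewrite invf_plt ?posrE.
pose vb n := (\sum_(v <- F n) phi (val v) ^+ 2) / (a n * (delta / 3)) ^+ 2.
have cvb : vb n @[n --> \oo] --> (0 : R).
  have -> : vb = fun n => (delta / 3) ^- 2 * ((a n)^-1 * q n).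
    apply/funext => n; rewrite /vb /q (@rsum_finite _ _ _ _ (F n)) //.
      by field; rewrite !gt_eqF.
    by move=> v _ /phiF ->; rewrite expr0n.
  rewrite -(mulr0 ((delta / 3) ^- 2)); apply: cvgM; first exact: cvg_cst.
  rewrite -(mul0r (\int[m]_u (phi u ^+ 2))); exact: cvgM.
have cmu := hmu _ _ _ d3 t0' Cphi.
apply: (@squeeze_cvge _ _ _ _ (fun=> 0%E) _ (fun n => ((vb n)%:E + mu n [set s : V n -> bool |
   (delta / 3 < `|(a n)^-1 * rsum [set: V n] (fun x : V n => k n x * (s x)%:R) - D|)%R])%E)).
- have hom := homogenization _ t0' _ Cphi.
  have : \forall n \near \oo, ((a n)^-1%:E * (\esum_(x in [set: V n])
      (`|g n x - k n x|)%:E) < (delta / 3)%:E)%E.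
    have [fin /cvgr_lt hlt] := (fine_cvgP _ _).1 hom.
    move: (fin) (hlt _ d3); apply: filterS2 => n fn ln.
    by rewrite -[X in (X < _)%E]fineK // lte_fin.
  apply: filterS => n hn; rewrite measure_ge0 andTb.
  have [Lam [Lmono Lcover]] := finite_exhaustion (hVcount n).
  apply: (field_probability (hbs n) (hc n) (hE n) (heps n).1 (hN n) (heta n) (hY n)
    Lmono Lcover t0 (@phiF n) D (ha0 n) d0).
  by rewrite EFinM -lee_pdivrMl // ltW.
- exact: cvg_cst.
- rewrite -[X in _ --> X]adde0; apply: cvgeD => //.
  by apply/fine_cvgP; split; [exact: nearW|exact: cvb].
Qed.
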